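(* Let $\Gamma$ be a metric graph and $J$ a kernel as described in the context. For any $1\le p<\infty$ and any $\mathbf{u}_0\in L^1(\Gamma)\cap L^p(\Gamma)$, the solution $\mathbf{u}$ of $$\mathbf{u}_t(t,x)=\int_\Gamma J(d(x,y))\big(\mathbf{u}(t,y)-\mathbf{u}(t,x)\big)\,dy\quad(x\in\Gamma,\ t>0),\qquad \mathbf{u}(0,x)=\mathbf{u}_0(x)\quad(x\in\Gamma)$$ satisfies $$\|\mathbf{u}(t)\|_{L^p(\Gamma)}\le\frac{C(\|\mathbf{u}_0\|_{L^1(\Gamma)},\|\mathbf{u}_0\|_{L^p(\Gamma)})}{(1+t)^{\frac12\left(1-\frac1p\right)}}\qquad\text{for all } t>0.$$ In addition, for any $\mathbf{u}_0\in L^1(\Gamma)\cap L^2(\Gamma)$, $$\int_\Gamma\int_\Gamma J(d(x,y))\big(\mathbf{u}(t,x)-\mathbf{u}(t,y)\big)^2\,dx\,dy\le C(\|\mathbf{u}_0\|_{L^1(\Gamma)},\|\mathbf{u}_0\|_{L^2(\Gamma)})\,t^{-\frac32}\qquad\text{for all } t>0.$$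
   Context: **Graph.** $\Gamma=(V,E)$ is a connected metric graph with finitely many vertices and edges, at least one edge having infinite length. Each edge $e$ is oriented and identified with an interval $I_e$: $I_e=[0,l_e]$ if $e$ has finite length $l_e$ (both ends are vertices), and $I_e=[0,\infty)$ if $e$ is infinite (a ray with a single vertex, at coordinate $0$). Every vertex has degree at least three. $d(x,y)$ is the distance in $\Gamma$: the length of the minimal path in $\Gamma$ joining $x$ and $y$. **Functions.** A function $\mathbf{u}$ on $\Gamma$ is a family $\{u^e\}_{e\in E}$ of functions $u^e$ on $I_e$. $L^p(\Gamma)$ is the space of families with $u^e\in L^p(I_e)$ for all $e$, with $\|\mathbf{u}\|_{L^p(\Gamma)}^p=\sum_e\|u^e\|_{L^p(I_e)}^p$; $\int_\Gamma \mathbf{u}\,dx=\sum_e\int_{I_e}u^e\,dx$. **Kernel.** $J:\mathbb{R}\to[0,\infty)$ is symmetric, $J\in L^1(\mathbb{R})\cap L^1(\mathbb{R},|x|^2)$, $J(z)$ is non-increasing for $z>0$, and $J$ is strictly positive in a neighbourhood of the origin. The nonlocal operator is bounded on each $L^p(\Gamma)$ and for every $\mathbf{u}_0\in L^p(\Gamma)$ the problem has a unique solution in $C([0,\infty),L^p(\Gamma))$. **Constants.** $C(a,b)$ denotes a constant depending on $a,b$ and on the fixed data $\Gamma,J,p$, but not on $t$ nor otherwise on $\mathbf{u}_0$. *)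

(* Defs.v *)
From HB Require Import structures.
From mathcomp Require Import all_boot all_order all_algebra.
From mathcomp Require Import all_classical all_reals all_analysis.
Set Implicit Arguments.
Unset Strict Implicit.
Unset Printing Implicit Defensive.
Import Order.TTheory GRing.Theory Num.Theory.
Import numFieldNormedType.Exports.
Local Open Scope classical_set_scope.
Local Open Scope ring_scope.

(* [term e = None]: [e] is a ray attached at its coordinate 0 to [orig e];
   [term e = Some (w, l)]: [e] has length [l] and its coordinate l is the
   vertex [w].  Loops and multiple edges are allowed. *)
Record metric_graph (R : realType) := MetricGraph {
  vertex : finType;
  edge : finType;
  orig : edge -> vertex;
  term : edge -> option (vertex * R) }.

Section Graph.
Context {R : realType} (G : metric_graph R).
Implicit Types (e f : edge G) (v w : vertex G).

Definition edge_itv e : set R :=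
  if term e is Some (_, l) then `[0, l] else `[0, +oo[.

Definition ends_at e v : bool := if term e is Some (w, _) then w == v else false.

Definition adjacent : rel (vertex G) := fun v w =>
  [exists e, ((orig e == v) && ends_at e w) || ((orig e == w) && ends_at e v)].

(* A loop contributes 2 to the degree. *)
Definition degree v : nat :=
  (#|[set e | orig e == v]%SET| + #|[set e | ends_at e v]%SET|)%N.

Record graph_axioms : Prop := GraphAxioms {
  length_gt0 : forall e v l, term e = Some (v, l) -> 0 < l;
  graph_connected : forall v w, connect adjacent v w;
  has_infinite_edge : exists e, term e = None;
  degree_ge3 : forall v, (3 <= degree v)%N }.

(* Points of the graph in edge coordinates: (e, s) with s in [edge_itv e].
   Different pairs may represent the same vertex. *)
Definition gpoint : Type := (edge G * R)%type.

Definition at_vertex (x : gpoint) v : Prop :=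
  (x.2 = 0 /\ orig x.1 = v) \/ term x.1 = Some (v, x.2).

(* [path_length x y l]: some path from x to y, made of finitely many segments
   each contained in one edge, has length l; at a vertex one may switch between
   its coordinate representations at no cost. *)
Inductive path_length : gpoint -> gpoint -> R -> Prop :=
| path_nil x : x.2 \in edge_itv x.1 -> path_length x x 0
| path_segment e (s t : R) y l :
    s \in edge_itv e -> t \in edge_itv e ->
    path_length (e, t) y l -> path_length (e, s) y (`|s - t| + l)
| path_vertex x x' v y l :
    at_vertex x v -> at_vertex x' v ->
    path_length x' y l -> path_length x y l.

Definition gdist (x y : gpoint) : R := inf [set l | path_length x y l].

Notation mu := (@lebesgue_measure R).

(* Only the values of [u e] on [edge_itv e] are relevant. *)
Definition gfun : Type := edge G -> R -> R.

Definition restr (u : gfun) e : R -> R := u e \_ (edge_itv e).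

Definition in_Lp (p : R) (u : gfun) : Prop :=
  forall e, restr u e \in Lfun mu p%:E.

Definition Lp_norm (p : R) (u : gfun) : \bar R :=
  ((\sum_(e : edge G) ('N[mu]_(p%:E)[EFin \o restr u e]) `^ p) `^ p^-1)%E.

Definition nonlocal_op (J : R -> R) (u : gfun) : gfun := fun e x =>
  \sum_(f : edge G)
     \int[mu]_(y in edge_itv f) (J (gdist (e, x) (f, y)) * (u f y - u e x)).

(* Extended-real valued: the integrand is nonnegative. *)
Definition energy (J : R -> R) (u : gfun) : \bar R :=
  (\sum_(f : edge G) \int[mu]_(y in edge_itv f)
     \sum_(e : edge G) \int[mu]_(x in edge_itv e)
       (J (gdist (e, x) (f, y)) * (u e x - u f y) ^+ 2)%:E)%E.

(* u in C([0,oo), L^p), the equation holding with u_t the derivative in L^p. *)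
Record solution (p : R) (J : R -> R) (u0 : gfun) (u : R -> gfun) : Prop :=
  Solution {
    solution_Lp : forall t, 0 <= t -> in_Lp p (u t);
    solution_continuous : forall t, 0 <= t ->
      Lp_norm p (fun e x => u s e x - u t e x)
        @[s --> within `[0, +oo[ (nbhs t)] --> 0%E;
    solution_equation : forall t, 0 < t ->
      Lp_norm p (fun e x => h^-1 * (u (t + h) e x - u t e x)
                            - nonlocal_op J (u t) e x) @[h --> 0^'] --> 0%E;
    solution_initial : forall e, ae_eq mu (edge_itv e) (u 0 e) (u0 e) }.

End Graph.

Record kernel_axioms {R : realType} (J : R -> R) : Prop := KernelAxioms {
  kernel_ge0 : forall z, 0 <= J z;
  kernel_sym : forall z, J (- z) = J z;
  kernel_L1 : (@lebesgue_measure R).-integrable setT (EFin \o J);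
  kernel_moment2 :
    (@lebesgue_measure R).-integrable setT (fun z => (J z * `|z| ^+ 2)%:E);
  kernel_nonincreasing : forall y z, 0 < y -> y <= z -> J z <= J y;
  kernel_gt0_near0 : \forall z \near (0 : R), 0 < J z }.

(* Main.v *)
(* Write E for the quadratic form of the kernel K(x, y) = J(d(x, y)).  For small
   h0 the map u |-> u + h0 L u is an average, so Jensen's inequality with a
   refined tangent bound for |.|^p gives
     int |u + h0 L u|^p + c h0 E(|u|^(p/2)) <= int |u|^p,
   and convexity transfers this dissipation to the continuous flow as a bound on
   the upper right Dini derivative of int |u(t)|^p; the L^1 norm does not increase.
   The missing ingredient is a Nash inequality: for every integer n >= 1,
     int |u|^p <= C n^2 E(|u|^(p/2)) + C n^(1-p) ||u||_1^p.
   On a ray it follows by cutting into pieces of n cells of length comparable to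
   the range where J is bounded below, and comparing neighbouring cells; on the
   finite edges |u|^(p/2) is controlled, through connectedness, by E and by its
   values near the end of one ray.  Taking n of order sqrt t yields the decay
   t^(-(p-1)/2) of int |u|^p.  For p = 2 the energy E(u(t)) is itself
   nonincreasing, so t E(u(t)) is bounded by ||u(t/2)||_2^2, which gives t^(-3/2). *)
From HB Require Import structures.
Require Import Defs.
From mathcomp Require Import all_boot all_order all_algebra.
From mathcomp Require Import all_classical all_reals all_analysis.
From mathcomp Require Import measurable_realfun ring lra.
Set Implicit Arguments.
Unset Strict Implicit.
Unset Printing Implicit Defensive.
Import Order.TTheory GRing.Theory Num.Theory.
Import numFieldNormedType.Exports.
Local Open Scope classical_set_scope.
Local Open Scope ring_scope.

(** * Real inequalities *)

(** A solution is differentiable in time only as a curve in L^p, so no chain rule for |u|^p is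
    invoked. The time increment is compared instead with one averaging step of fixed length h0,
    which is estimated exactly; convexity scales its dissipation by h / h0, and a growth bound on
    the convex function turns the L^p error of the difference quotient into o(h). Only a
    subgradient, a quadratic gap and a growth bound enter, hence the [entropy] abstraction: it
    serves |.|^p for the decay, the square with its exact gap for the energy, and truncations of |.|
    for the L^1 bound. The evolution argument uses no geometry, only a symmetric kernel of bounded
    mass. The graph contributes that mass bound, a lower bound of the kernel at small distance, and
    connectedness. A finite edge cannot be cut into pieces of arbitrarily many cells, so spreading
    of mass at scale n is available on rays only; this is why an infinite edge is needed and why all
    finite edges are compared with one ray. *)

Section RealInequalities.
Context {R : realType}.
Implicit Types (a b p x y e k : R).

Lemma powR_weighted_AMGM (x y s t : R) : 0 <= x -> 0 <= y -> 0 < s -> 0 < t ->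
  s + t = 1 -> x `^ s * y `^ t <= s * x + t * y.
Proof.
move=> x0 y0 s0 t0 st.
have := @conjugate_powR _ (x `^ s) (y `^ t) s^-1 t^-1.
rewrite !powR_ge0 !invr_gt0 !invrK => /(_ isT isT s0 t0 st).
by rewrite -!powRrM !divff ?gt_eqF// !powRr1// mulrC (mulrC y); lra.
Qed.

(* Kittaneh--Manasrah refinement of Young's inequality: subtracting
   [min(1, p - 1) (a^(p/2) - b^(p/2))^2] leaves a weighted mean of
   [(a b)^(p/2)] and of the larger-weight power, to which AM-GM applies. *)
Lemma young_powR_refined a b p : 0 <= a -> 0 <= b -> 1 <= p ->
  Num.min 1 (p - 1) * (a `^ (p / 2) - b `^ (p / 2)) ^+ 2
    <= a `^ p + (p - 1) * b `^ p - p * (a * b `^ (p - 1)).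
Proof.
move=> a0 b0; rewrite le_eqVlt => /predU1P[<-|p1].
  move: ((_ - _) ^+ 2) => q.
  rewrite subrr powRr0 powRr1// mulr1 mul1r mul0r addr0 subrr.
  by rewrite (_ : Num.min 1 0 = 0) ?mul0r// min_r.
have p0 : 0 < p by lra.
have AE : a `^ p = (a `^ (p / 2)) ^+ 2.
  by rewrite -powR_mulrn ?powR_ge0// -powRrM mulfVK.
have BE : b `^ p = (b `^ (p / 2)) ^+ 2.
  by rewrite -powR_mulrn ?powR_ge0// -powRrM mulfVK.
have aE : a = (a `^ (p / 2)) `^ (2 / p).
  by rewrite -powRrM mulrA mulfVK ?divff ?gt_eqF// powRr1.
have bE : b `^ (p - 1) = (b `^ (p / 2)) `^ (2 * (p - 1) / p).
  rewrite -powRrM; congr (_ `^ _).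
  by field; rewrite gt_eqF.
rewrite AE BE [in X in _ <= _ - X]aE bE.
have := powR_ge0 a (p / 2); have := powR_ge0 b (p / 2).
move: (a `^ (p / 2)) (b `^ (p / 2)) => A B B0 A0.
move: p1 p0 A0 B0; clear => p1 p0 A0 B0.
have sqrE x : 0 <= x -> x ^+ 2 = x `^ 2 by move=> x0; rewrite powR_mulrn.
have D0 : 0 < 2 / p by rewrite divr_gt0.
have D1 : 0 < 2 * (p - 1) / p by rewrite divr_gt0// mulr_gt0// subr_gt0.
have [p2|p2] := leP p 2.
  have -> : Num.min 1 (p - 1) = p - 1 by apply: min_r; move: p2; clear; lra.
  (* At p = 2 the weight (2 - p) / p vanishes, while AM-GM is stated for positive weights; there the
     claim is an identity. *)
  have [p2'|pn2] := eqVneq p 2.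
    have -> : 2 * (p - 1) / p = 1 by rewrite p2'; field.
    have -> : 2 / p = 1 by rewrite p2'; field.
    rewrite !powRr1// p2'; move: (A) (B); clear => X Y; lra.
  have {}p2 : 0 < 2 - p by rewrite subr_gt0 lt_neqAle pn2.
  have h : (2 - p) / p + 2 * (p - 1) / p = 1 by field; rewrite gt_eqF.
  have := @powR_weighted_AMGM (A ^+ 2) (A * B) _ _ (sqr_ge0 _)
    (mulr_ge0 A0 B0) (divr_gt0 p2 p0) D1 h.
  have e : 2 * ((2 - p) / p) + 2 * (p - 1) / p = 2 / p by field; rewrite gt_eqF.
  rewrite (powRM _ A0 B0) (sqrE _ A0) -powRrM mulrA -powRD e; last by rewrite gt_eqF.
  rewrite -sqrE//.
  rewrite -(ler_pM2l p0).
  have -> : p * ((2 - p) / p * A ^+ 2 + 2 * (p - 1) / p * (A * B)) =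
    (2 - p) * A ^+ 2 + 2 * (p - 1) * (A * B) by field; rewrite gt_eqF.
  by move: (_ * B `^ _) => X; clear; lra.
have -> : Num.min 1 (p - 1) = 1 by apply: min_l; move: p2; clear; lra.
rewrite -subr_gt0 in p2.
have h : 2 / p + (p - 2) / p = 1 by field; rewrite gt_eqF.
have := @powR_weighted_AMGM (A * B) (B ^+ 2) _ _
  (mulr_ge0 A0 B0) (sqr_ge0 _) D0 (divr_gt0 p2 p0) h.
have e : 2 / p + 2 * ((p - 2) / p) = 2 * (p - 1) / p by field; rewrite gt_eqF.
rewrite (powRM _ A0 B0) (sqrE _ B0) -powRrM -mulrA -powRD e; last by rewrite gt_eqF.
rewrite -sqrE//.
rewrite -(ler_pM2l p0).
have -> : p * (2 / p * (A * B) + (p - 2) / p * B ^+ 2) =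
  2 * (A * B) + (p - 2) * B ^+ 2 by field; rewrite gt_eqF.
by move: (_ * B `^ _) => X; clear; lra.
Qed.

(** Since [Num.sg b * a <= |a|], opposite signs only help, and the claim reduces to
    [young_powR_refined] at |a| and |b|. *)
Lemma bregman_powR p a b : 1 <= p ->
  `|b| `^ p + p * Num.sg b * `|b| `^ (p - 1) * (a - b)
    + Num.min 1 (p - 1) * (`|a| `^ (p / 2) - `|b| `^ (p / 2)) ^+ 2
  <= `|a| `^ p.
Proof.
move=> p1; have p0 : 0 < p by lra.
have := @young_powR_refined `|a| `|b| p (normr_ge0 _) (normr_ge0 _) p1.
set m := Num.min _ _ * _ => hm.
have bp : `|b| * `|b| `^ (p - 1) = `|b| `^ p by rewrite mulr_powRB1.
have h : Num.sg b * a <= `|a|.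
  case: sgrP => _; rewrite ?mul0r ?mul1r ?mulN1r ?ler_norm//.
  by rewrite -normrN ler_norm.
have hp : 0 <= p * `|b| `^ (p - 1) by rewrite mulr_ge0 ?powR_ge0// ltW.
have := ler_wpM2l hp h.
have hb : Num.sg b * b = `|b| by rewrite -normrEsg.
have -> : p * Num.sg b * `|b| `^ (p - 1) * (a - b) =
   p * `|b| `^ (p - 1) * (Num.sg b * a) - p * (`|b| * `|b| `^ (p - 1)).
  by rewrite -hb; ring.
rewrite bp; lra.
Qed.

(** A perturbation b costs an arbitrarily small fraction of |a|^p. With d such that (1 + d)^p = 1 +
    e, either |b| <= d |a| and the first two terms suffice, or |a| < |b| / d and the last one
    does. *)
Lemma powR_normD_le p : 1 <= p -> forall e, 0 < e -> exists2 C, 0 <= C &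
  forall a b, `|a + b| `^ p <= `|a| `^ p + e * `|a| `^ p + C * `|b| `^ p.
Proof.
move=> p1 e e0; have p0 : 0 < p by lra.
pose d := (1 + e) `^ p^-1 - 1.
have d0 : 0 < d.
  have := @gt0_ltr_powR _ p^-1 _ 1 (1 + e); rewrite powR1 subr_gt0; apply.
  - by rewrite invr_gt0.
  - by rewrite nnegrE.
  - by rewrite nnegrE; lra.
  - lra.
exists ((1 + d^-1) `^ p); first exact: powR_ge0.
move=> a b; have n0 := normr_ge0; have q0 x : 0 <= x `^ p := powR_ge0 _ _.
have [ba|ab] := leP `|b| (d * `|a|).
  apply: (@le_trans _ _ (((1 + d) * `|a|) `^ p)).
    rewrite ge0_ler_powR ?nnegrE ?mulr_ge0 ?(ltW p0)//; first lra.
    by apply: (le_trans (ler_normD _ _)); lra.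
  have d1 : 0 <= 1 + d by lra.
  rewrite (powRM _ d1 (n0 _ _ _)) {2}/d addrC subrK.
  rewrite -powRrM mulVf ?gt_eqF// powRr1; last lra.
  by have := mulr_ge0 (q0 (1 + d^-1)) (q0 `|b|); lra.
apply: (@le_trans _ _ (((1 + d^-1) * `|b|) `^ p)).
  rewrite ge0_ler_powR ?nnegrE ?(ltW p0)//.
    by rewrite mulr_ge0// addr_ge0// invr_ge0 ltW.
  apply: (le_trans (ler_normD _ _)); rewrite mulrDl mul1r addrC lerD2l.
  by rewrite ler_pdivlMl// ltW.
have d1 : 0 <= 1 + d^-1 by rewrite addr_ge0// invr_ge0 ltW.
rewrite (powRM _ d1 (n0 _ _ _)).
by rewrite lerDr addr_ge0// mulr_ge0// ltW.
Qed.

(* For U in L^p only, the L^1 norm may be infinite; [soft k] is bounded by a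
   multiple of |.|^p, and letting k tend to 0 gives the L^1 contraction. *)
Definition soft k x := Num.max (`|x| - k) 0.

Lemma soft_ge0 k x : 0 <= soft k x.
Proof. by rewrite le_max lexx orbT. Qed.

Lemma soft0 k : 0 <= k -> soft k 0 = 0.
Proof. by move=> k0; rewrite /soft normr0 max_r// sub0r oppr_le0. Qed.

Lemma soft_tangent k a b : 0 <= k ->
  soft k b + (if `|b| <= k then 0 else Num.sg b) * (a - b) <= soft k a.
Proof.
move=> k0; rewrite {1}/soft; have [bk|kb] := leP `|b| k.
  by rewrite max_r ?subr_le0// mul0r addr0 soft_ge0.
rewrite max_l ?subr_ge0 ?(ltW kb)//.
have hb : Num.sg b * b = `|b| by rewrite -normrEsg.
rewrite mulrBr hb; have h : Num.sg b * a <= `|a|.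
  case: sgrP => _; rewrite ?mul0r ?mul1r ?mulN1r ?ler_norm//.
  by rewrite -normrN ler_norm.
have : `|a| - k <= soft k a by rewrite /soft le_max lexx.
lra.
Qed.

(** Away from 0 the first power is dominated by the p-th; this is what makes [soft k] controllable
    by L^p norms. *)
Lemma powR_lower k x p : 0 < k -> k <= x -> 1 <= p ->
  x <= (k^-1) `^ (p - 1) * x `^ p.
Proof.
move=> k0 kx p1; have x0 : 0 < x by lra.
rewrite -(@mulr_powRB1 _ x p) ?(ltW x0)//; last lra.
have k1 : 0 <= k^-1 by rewrite invr_ge0 ltW.
rewrite mulrCA -(powRM _ k1 (ltW x0)) ler_pMr//.
rewrite -[X in X <= _](powRr0 (k^-1 * x)) ler_powR ?subr_ge0//.
by rewrite ler_pdivlMl// mulr1.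
Qed.

Lemma softD_le k p : 0 < k -> 1 <= p -> forall e, 0 < e -> exists2 C, 0 <= C &
  forall a b, soft k (a + b) <= soft k a + e * `|a| `^ p + C * `|b| `^ p.
Proof.
move=> k0 p1 e e0; have p0 : 0 < p by lra.
pose q := ((k / 2)^-1) `^ (p - 1).
have q0 : 0 < q by rewrite powR_gt0// invr_gt0; lra.
(* If |b| <= d |a| with d <= 1 and |a + b| > k, then |a| >= k / 2, the level for which q is the
   constant of [powR_lower]; d <= e / q then leaves e |a|^p. *)
pose d := Num.min 1 (e / q).
have d0 : 0 < d by rewrite lt_min ltr01 divr_gt0.
have d1 : d <= 1 by rewrite ge_min lexx.
have dq : d * q <= e by rewrite -ler_pdivlMr// ge_min lexx orbT.
(* If |b| > d |a| and |a + b| > k, then (1 + 1/d) |b| > k, so [k'] is a level below |b|. *)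
pose k' := k / (1 + d^-1).
have di : 0 < d^-1 by rewrite invr_gt0.
have k'0 : 0 < k' by rewrite divr_gt0//; lra.
exists ((k'^-1) `^ (p - 1)); first exact: powR_ge0.
move=> a b; have n0 := normr_ge0; have pp x : 0 <= x `^ p := powR_ge0 _ _.
have ea : 0 <= e * `|a| `^ p by rewrite mulr_ge0// ltW.
have cb : 0 <= (k'^-1) `^ (p - 1) * `|b| `^ p by rewrite mulr_ge0// powR_ge0.
have sa := soft_ge0 k a.
have tr := ler_normD a b.
rewrite {1}/soft ge_max; apply/andP; split; last lra.
have [abk|kab] := leP `|a + b| k; first lra.
have sa' : `|a| - k <= soft k a by rewrite /soft le_max lexx.
suff : `|b| <= e * `|a| `^ p + k'^-1 `^ (p - 1) * `|b| `^ p by lra.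
have [ba|ab] := leP `|b| (d * `|a|).
  have ak : k / 2 <= `|a|.
    by have := ler_wpM2r (n0 _ _ a) d1; rewrite mul1r; lra.
  have h := @powR_lower (k / 2) `|a| p _ ak p1.
  apply: (@le_trans _ _ (e * `|a| `^ p)); last lra.
  apply: (le_trans ba); apply: (@le_trans _ _ (d * (q * `|a| `^ p))).
    by rewrite ler_wpM2l ?(ltW d0)// h//; lra.
  by rewrite mulrA ler_wpM2r.
apply: (@le_trans _ _ (k'^-1 `^ (p - 1) * `|b| `^ p)); last lra.
apply: powR_lower => //.
rewrite /k' ler_pdivrMr; last lra.
rewrite mulrDr mulr1.
by have := ab; rewrite mulrC -ltr_pdivlMr// => h; lra.
Qed.

Lemma convex_of_tangent (Phi s : R -> R) (a b l : R) : 0 <= l <= 1 ->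
  (forall a b, Phi b + s b * (a - b) <= Phi a) ->
  Phi ((1 - l) * a + l * b) <= (1 - l) * Phi a + l * Phi b.
Proof.
move=> /andP[l0 l1] tan; set z := _ + _.
have l1' : 0 <= 1 - l by lra.
have ha := ler_wpM2l l1' (tan a z).
have hb := ler_wpM2l l0 (tan b z).
have e : (1 - l) * (a - z) + l * (b - z) = 0 by rewrite /z; ring.
have : (1 - l) * (Phi z + s z * (a - z)) + l * (Phi z + s z * (b - z)) =
    Phi z + s z * ((1 - l) * (a - z) + l * (b - z)).
  by move: (Phi z) (s z) (z) => P S w; ring.
rewrite e mulr0; move: ha hb; move: (_ * (Phi z + _)) (_ * (Phi z + _)) => X Y.
by clear; lra.
Qed.

(** Last-crossing argument. The function g below has slope margin e1 and starts at - e1; were g b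
    positive, then at the last point s with g s <= 0 the one-sided bound would make g strictly
    decrease to the right of s. *)
Lemma dini_le (f : R -> R) (a b k : R) : a <= b ->
  (forall t, a <= t <= b -> forall e, 0 < e -> exists2 d, 0 < d &
     forall s, a <= s <= b -> `|s - t| < d -> `|f s - f t| < e) ->
  (forall t, a < t < b -> forall e, 0 < e -> exists2 d, 0 < d &
     forall h, 0 < h < d -> f (t + h) <= f t - k * h + e * h) ->
  f b <= f a - k * (b - a).
Proof.
move=> ab fc fd; apply/ler_addgt0Pr => e e0.
pose e1 := e / (2 * (1 + (b - a))).
have ba1 : 0 < 1 + (b - a) by lra.
have e10 : 0 < e1 by rewrite divr_gt0//; lra.
have e1E : 2 * e1 * (1 + (b - a)) = e.
  by rewrite /e1; field; rewrite gt_eqF.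
pose g t := f t + (k - e1) * (t - a) - f a - e1.
suff gb : g b <= 0 by have := mulr_gt0 e10 ba1; rewrite /g in gb; lra.
have gc t : a <= t <= b -> forall e, 0 < e -> exists2 d, 0 < d &
     forall s, a <= s <= b -> `|s - t| < d -> `|g s - g t| < e.
  move=> tab e' e'0; have [|d d0 hd] := fc _ tab (e' / 2) _; first lra.
  pose K := 1 + `|k - e1|.
  have K0 : 0 < K by have := normr_ge0 (k - e1); rewrite /K; lra.
  exists (Num.min d (e' / 2 / K)).
    by rewrite lt_min d0 divr_gt0//; lra.
  move=> s sab; rewrite lt_min => /andP[sd sk].
  have := hd _ sab sd.
  have -> : g s - g t = (f s - f t) + (k - e1) * (s - t) by rewrite /g; ring.
  move=> h1; apply: (le_lt_trans (ler_normD _ _)); rewrite normrM.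
  have : `|k - e1| * `|s - t| <= K * `|s - t| by rewrite ler_wpM2r// /K; lra.
  by have := sk; rewrite ltr_pdivlMr// mulrC; lra.
rewrite leNgt; apply/negP => gb.
pose S := [set t | a <= t <= b /\ g t <= 0].
have Sa : S a by split; [lra | rewrite /g; lra].
have hS : has_sup S by split; [exists a | exists b => t [/andP[]]].
pose s := sup S.
have as_ : a <= s by apply: sup_upper_bound.
have sb : s <= b by apply: sup_le_ub; [exists a | move=> t [/andP[]]].
have gs : g s <= 0.
  rewrite leNgt; apply/negP => gs.
  have [|d d0 hd] := gc s _ (g s) gs; first lra.
  have [t [tab gt] st] := sup_adherent d0 hS.
  have ts : t <= s by apply: sup_upper_bound.
  have := hd t tab; rewrite ler0_norm; last lra.
  by rewrite ltr_norml => /(_ ltac:(rewrite -/s in st; lra)); lra.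
have ltsb : s < b.
  by rewrite lt_neqAle sb andbT; apply: contraPneq gb => <-; lra.
have up t : s < t <= b -> 0 < g t.
  move=> /andP[st tb]; rewrite ltNge; apply/negP => gt.
  suff : t <= s by lra.
  by apply: sup_upper_bound => //; split=> //; lra.
(* No derivative bound is assumed at the left end; there continuity and the initial value - e1 rule
   out s = a. *)
have [as'|] := ltP a s; last first.
  move=> sa; have {sa} sa : s = a by apply/eqP; rewrite eq_le sa.
  have [|d d0 hd] := gc a _ e1 e10; first lra.
  pose t := s + Num.min (d / 2) (b - s).
  have m0 : 0 < Num.min (d / 2) (b - s) by rewrite lt_min; apply/andP; split; lra.
  have m1 : Num.min (d / 2) (b - s) <= d / 2 by rewrite ge_min lexx.
  have m2 : Num.min (d / 2) (b - s) <= b - s by rewrite ge_min lexx orbT.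
  have := hd t; rewrite /t sa addrAC subrr add0r gtr0_norm -?sa//.
  have := up t; rewrite /t.
  have -> : g s = - e1 by rewrite /g sa; ring.
  move=> h1 /(_ ltac:(lra) ltac:(lra)); rewrite ltr_norml.
  by have := h1 ltac:(lra); lra.
have [||d d0 hd] := fd s _ (e1 / 2) _; [lra|lra|].
pose h := Num.min (d / 2) (b - s).
have m0 : 0 < h by rewrite lt_min; apply/andP; split; lra.
have m1 : h <= d / 2 by rewrite ge_min lexx.
have m2 : h <= b - s by rewrite ge_min lexx orbT.
have h1 := hd h ltac:(lra).
have h2 := up (s + h) ltac:(lra).
have h3 := mulr_gt0 e10 m0.
have : g (s + h) <= g s - e1 / 2 * h by rewrite /g; lra.
lra.
Qed.

End RealInequalities.

(* With F(t) the p-th power of the norm: Nash's inequality at length scale n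
   gives F' <= - kappa F / n^2 as long as F exceeds B n^(-2 beta).  Choosing n of
   order sqrt t and halving t repeatedly yields t^(-beta). *)
Lemma decay_iteration {R : realType} (beta kappa : R) : 0 <= beta -> 0 < kappa ->
  exists2 K0, 0 <= K0 & forall (F : R -> R) (B : R), 0 <= B ->
    (forall t : R, 0 <= t -> 0 <= F t) ->
    (forall s t : R, 0 <= s <= t -> F t <= F s) ->
    (forall (s t : R) (n : nat), 0 <= s < t -> (0 < n)%N ->
       B * n%:R `^ (- (2 * beta)) < F t ->
       F t * (1 + kappa * (t - s) / n%:R ^+ 2) <= F s) ->
    forall t : R, 0 <= t -> F t <= K0 * (B + F 0) * (1 + t) `^ (- beta).
Proof.
move=> b0 k0.
have q0 : 0 < 2 `^ beta :> R by rewrite powR_gt0.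
(* The scale n will be the integer part of e sqrt(1 + t). The bound e^2 <= 1/2 settles t <= 1, where
   n could be 0; the other bound makes the gain over [t/2, t] at least 2^beta, which is what passing
   from t/2 to t loses in the decay rate. *)
have [e [e0 e2h e2k]] : exists e : R,
    [/\ 0 < e, e ^+ 2 <= 2^-1 & 2 `^ beta <= kappa / (4 * e ^+ 2)].
  pose e2 : R := Num.min 2^-1 (kappa / (4 * 2 `^ beta)).
  have e20 : 0 < e2 by rewrite lt_min invr_gt0 ltr0n /= divr_gt0// mulr_gt0.
  exists (Num.sqrt e2); rewrite sqrtr_gt0 (sqr_sqrtr (ltW e20)); split => //.
    by rewrite ge_min lexx.
  have : e2 * (4 * 2 `^ beta) <= kappa.
    by rewrite -ler_pdivlMr ?mulr_gt0// ge_min lexx orbT.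
  rewrite ler_pdivlMr ?mulr_gt0//; move: (2 `^ beta) (e2) => X Y; clear; lra.
have e20 : 0 < e ^+ 2 by rewrite exprn_gt0.
(* As n >= (e / 2) sqrt(1 + t), the threshold n^(-2 beta) is at most K0 (1 + t)^(-beta). *)
pose K0 := (e / 2) `^ (- (2 * beta)).
have K00 : 0 <= K0 by exact: powR_ge0.
have pw (x : R) : 0 <= x -> (x ^+ 2) `^ (- beta) = x `^ (- (2 * beta)).
  by move=> x0; rewrite -powR_mulrn// -powRrM mulrN.
have anti (x y : R) : 0 < x -> x <= y -> y `^ (- beta) <= x `^ (- beta).
  move=> x0 xy; rewrite !powRN lef_pV2 ?posrE ?powR_gt0//; last exact: lt_le_trans xy.
  by rewrite ge0_ler_powR ?nnegrE// ltW//; exact: lt_le_trans xy.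
exists K0 => // F B B0 F0 Fmon Fdec.
have FB0 : 0 <= B + F 0 by rewrite addr_ge0// F0.
(* Induction on a dyadic bound for t, since the estimate at t rests on the one at t/2. *)
suff H m : forall t : R, 0 <= t -> t <= 2 ^+ m ->
    F t <= K0 * (B + F 0) * (1 + t) `^ (- beta).
  move=> t t0; apply: (H (Num.truncn t).+1 t t0).
  have /andP[_ /ltW/le_trans] := truncn_itv t0; apply.
  by rewrite -natrX ler_nat ltnW// ltn_expl.
have small (t : R) : 0 <= t -> (1 + t) * e ^+ 2 <= 1 ->
    F t <= K0 * (B + F 0) * (1 + t) `^ (- beta).
  move=> t0 te; apply: (@le_trans _ _ (F 0)); first by apply: Fmon; rewrite lexx.
  have h : 1 <= K0 * (1 + t) `^ (- beta).
    rewrite /K0 -pw ?divr_ge0 ?(ltW e0)// -powRM ?sqr_ge0//; last lra.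
    have p11 : 1 `^ (- beta) = 1 :> R by rewrite powR1.
    rewrite -[X in X <= _]p11.
    apply: anti.
      by apply: mulr_gt0; [rewrite exprn_gt0// divr_gt0 | lra].
    rewrite expr_div_n mulrAC ler_pdivrMr ?exprn_gt0//; lra.
  have := ler_wpM2l FB0 h; rewrite mulr1 mulrA (mulrC _ K0).
  by apply: le_trans; rewrite lerDr.
elim: m => [|m IH] t t0 tm.
  apply: small => //; move: (e ^+ 2) e2h e20 => E h1 h2.
  have : (1 + t) * E <= 2 * E by rewrite ler_wpM2r ?(ltW h2)//; move: tm; rewrite expr0; lra.
  by move: h1; clear; lra.
have [|te] := leP ((1 + t) * e ^+ 2) 1; first exact: small.
have t1 : 1 <= t.
  have : (1 + t) * e ^+ 2 <= (1 + t) * 2^-1 by rewrite ler_wpM2l//; lra.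
  by move: te; move: (_ * e ^+ 2) => X; clear; lra.
pose r := Num.sqrt (1 + t).
have r0 : 0 < r by rewrite sqrtr_gt0; lra.
have rE : r ^+ 2 = 1 + t by rewrite sqr_sqrtr//; lra.
have er0 : 0 < e * r by rewrite mulr_gt0.
have x1 : 1 < e * r.
  rewrite -(@ltr_pXn2r _ 2)// ?nnegrE ?(ltW er0)//.
  by rewrite expr1n exprMn rE mulrC.
have /andP[nx xn] := truncn_itv (ltW er0).
set n := Num.truncn (e * r) in nx xn.
have n0 : (0 < n)%N.
  by rewrite lt0n; apply/eqP => h; move: xn; rewrite h => /(lt_trans x1); rewrite ltxx.
have n0' : 0 < n%:R :> R by rewrite ltr0n.
have n1 : 1 <= n%:R :> R by rewrite ler1n.
have n2 : e / 2 * r <= n%:R by move: xn n1; rewrite -natr1; clear; lra.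
have [Fn|nF] := leP (F t) (B * n%:R `^ (- (2 * beta))).
  apply: (le_trans Fn); apply: (@le_trans _ _ (B * (K0 * (1 + t) `^ (- beta)))).
    rewrite ler_wpM2l// -pw ?(ltW n0')// /K0 -pw ?divr_ge0 ?(ltW e0)//.
    rewrite -powRM ?sqr_ge0//; last lra.
    rewrite -rE -exprMn; apply: anti.
      by rewrite exprn_gt0// mulr_gt0// divr_gt0.
    by rewrite ler_pXn2r// nnegrE ?(ltW n0')// mulr_ge0 ?divr_ge0// ltW.
  rewrite mulrA (mulrC B) ler_wpM2r ?powR_ge0// ler_wpM2l//.
  by rewrite lerDl F0.
have th : 0 <= t / 2 < t by apply/andP; split; lra.
have := Fdec _ _ _ th n0 nF.
have IHt : F (t / 2) <= K0 * (B + F 0) * (1 + t / 2) `^ (- beta).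
  by apply: IH; [lra | move: tm; rewrite exprS; lra].
have q1 : (1 + t / 2) `^ (- beta) <= 2 `^ beta * (1 + t) `^ (- beta).
  apply: (@le_trans _ _ (((1 + t) / 2) `^ (- beta))); first by apply: anti; lra.
  rewrite powRM//; last lra.
  by rewrite mulrC -powR_inv1// -powRrM mulN1r opprK.
move=> Fh.
have q2 : 2 `^ beta <= 1 + kappa * (t - t / 2) / n%:R ^+ 2.
  apply: (le_trans e2k); apply: (@le_trans _ _ (kappa * (t - t / 2) / n%:R ^+ 2)).
    have nn : n%:R ^+ 2 <= e ^+ 2 * (1 + t).
      by rewrite -rE -exprMn ler_pXn2r// nnegrE ltW.
    rewrite ler_pdivlMr ?exprn_gt0// mulrAC ler_pdivrMr ?mulr_gt0//.
    rewrite -mulrA ler_pM2l//; apply: (le_trans nn).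
    have -> : t - t / 2 = t / 2 by field.
    have -> : t / 2 * (4 * e ^+ 2) = e ^+ 2 * (2 * t) by field.
    by rewrite ler_pM2l//; lra.
  by rewrite lerDr.
rewrite -(ler_pM2r q0).
have Ft0 := F0 t t0.
apply: (le_trans (ler_wpM2l Ft0 q2)); apply: (le_trans Fh); apply: (le_trans IHt).
rewrite -[X in _ <= X]mulrA ler_wpM2l ?mulr_ge0//.
by rewrite [X in _ <= X]mulrC.
Qed.

(** * Symmetric kernels and the averaging step *)

Ltac mf := repeat first
  [ assumption | exact: measurable_cst | exact: measurable_id
  | apply: measurable_funX | apply: measurable_funM
  | apply: measurable_funB | apply: measurable_funD ].

Lemma ge0_fineE (R : realType) (x : \bar R) : (0 <= x)%E -> (x < +oo)%E ->
  x = (fine x)%:E.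
Proof. by move=> x0 xy; rewrite fineK// ge0_fin_numE. Qed.

Section NonnegIntegrals.
Context d (T : measurableType d) (R : realType) (mu : {measure set T -> \bar R}).
Variable D : set T.
Hypothesis mD : measurable D.
Implicit Types f g : T -> R.

Lemma ge0_intD f g : measurable_fun D f -> measurable_fun D g ->
  (forall x, 0 <= f x) -> (forall x, 0 <= g x) ->
  (\int[mu]_(x in D) (f x + g x)%:E =
   \int[mu]_(x in D) (f x)%:E + \int[mu]_(x in D) (g x)%:E)%E.
Proof.
move=> mf_ mg f0 g0; rewrite -ge0_integralD//;
  do ?[exact/measurable_EFinP|by move=> x _; rewrite lee_fin].
Qed.

Lemma ge0_intZ (k : R) f : 0 <= k -> measurable_fun D f -> (forall x, 0 <= f x) ->
  (\int[mu]_(x in D) (k * f x)%:E = k%:E * \int[mu]_(x in D) (f x)%:E)%E.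
Proof.
move=> k0 mf_ f0; rewrite -ge0_integralZl//;
  do ?[exact/measurable_EFinP|by move=> x _; rewrite lee_fin].
Qed.

Lemma ge0_int_le f g : measurable_fun D f -> measurable_fun D g ->
  (forall x, 0 <= f x) -> (forall x, D x -> f x <= g x) ->
  (\int[mu]_(x in D) (f x)%:E <= \int[mu]_(x in D) (g x)%:E)%E.
Proof.
move=> mf_ mg f0 fg; apply: ge0_le_integral => //.
- by move=> x _; rewrite lee_fin.
- exact/measurable_EFinP.
- exact/measurable_EFinP.
Qed.

Lemma ge0_integrable f : measurable_fun D f ->
  (forall x, 0 <= f x) -> (\int[mu]_(x in D) (f x)%:E < +oo)%E ->
  mu.-integrable D (EFin \o f).
Proof.
move=> mf_ f0 fy; apply/integrableP; split; first exact/measurable_EFinP.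
by under eq_integral do rewrite /= ger0_norm//.
Qed.

End NonnegIntegrals.

Record symmetric_kernel d (T : measurableType d) (R : realType)
    (mu : {measure set T -> \bar R}) (K : T -> T -> R) (M : R) : Prop :=
  SymmetricKernel {
    sk_bound_ge0 : 0 <= M;
    sk_ge0 : forall x y, 0 <= K x y;
    sk_sym : forall x y, K x y = K y x;
    sk_measurable : measurable_fun setT (fun z : T * T => K z.1 z.2);
    sk_mass : forall x, (\int[mu]_y (K x y)%:E <= M%:E)%E }.

Section Markov.
Context d (T : measurableType d) (R : realType).
Variables (mu : {sigma_finite_measure set T -> \bar R}) (K : T -> T -> R).
Implicit Types (u v : T -> R) (g : T -> T -> R).

Definition form v : \bar R :=
  (\int[mu]_x \int[mu]_y (K x y * (v x - v y) ^+ 2)%:E)%E.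

Definition gen u x : R := \int[mu]_y (K x y * (u y - u x)).

Definition step (h : R) u x : R := u x + h * gen u x.

Lemma measurable_integral_snd g : (forall x y, 0 <= g x y) ->
  measurable_fun setT (fun z : T * T => g z.1 z.2) ->
  measurable_fun setT (fun x => \int[mu]_y (g x y)%:E)%E.
Proof.
move=> g0 mg.
apply: (measurable_fun_fubini_tonelli_F (fun z => (g z.1 z.2)%:E)).
  exact/measurable_EFinP.
by move=> z; rewrite lee_fin.
Qed.

Lemma integral_swap g : (forall x y, 0 <= g x y) ->
  measurable_fun setT (fun z : T * T => g z.1 z.2) ->
  (\int[mu]_x \int[mu]_y (g x y)%:E = \int[mu]_x \int[mu]_y (g y x)%:E)%E.
Proof.
move=> g0 mg; apply: (fubini_tonelli (fun z => (g z.1 z.2)%:E)).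
  exact/measurable_EFinP.
by move=> z; rewrite lee_fin.
Qed.

Lemma measurable_comp1 u : measurable_fun setT u ->
  measurable_fun setT (fun z : T * T => u z.1).
Proof. by move=> mu_; apply: (measurableT_comp mu_ measurable_fst). Qed.

Lemma measurable_comp2 u : measurable_fun setT u ->
  measurable_fun setT (fun z : T * T => u z.2).
Proof. by move=> mu_; apply: (measurableT_comp mu_ measurable_snd). Qed.

Lemma measurable_section g x :
  measurable_fun setT (fun z : T * T => g z.1 z.2) ->
  measurable_fun setT (g x).
Proof. by move=> mg; apply: (measurable_fun_pair2 x mg). Qed.

Variable M : R.
Hypothesis hK : symmetric_kernel mu K M.

Let K0 := sk_ge0 hK.
Let mK := sk_measurable hK.
Let mKs x : measurable_fun setT (K x). Proof. exact: measurable_section. Qed.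

(** The integrand need not be integrable for every x, so its positive and negative parts are treated
    separately by Tonelli, and [fine] is measurable. A general [D] lets the lemma apply to one edge
    at a time. *)
Lemma measurable_gen (D : set T) u : measurable D -> measurable_fun setT u ->
  measurable_fun setT (fun x => \int[mu]_(y in D) (K x y * (u y - u x)))%R.
Proof.
move=> mD mu_; have mu1 := measurable_comp1 mu_; have mu2 := measurable_comp2 mu_.
have mD2 : measurable_fun setT (fun z : T * T => \1_D z.2 : R).
  exact: (measurable_comp2 (measurable_indic mD)).
pose g x y := K x y * (u y - u x) * \1_D y.
have mg : measurable_fun setT (fun z : T * T => g z.1 z.2) by rewrite /g; mf.
apply: (measurableT_comp (fine_measurable measurableT)) => /=.
have E x : (\int[mu]_(y in D) (K x y * (u y - u x))%:E =
   \int[mu]_y (Num.max (g x y) 0)%:E - \int[mu]_y (Num.max (- g x y) 0)%:E)%E.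
  rewrite integral_mkcond integralE; congr (_ - _)%E; apply: eq_integral => y _.
    rewrite funeposE /patch /g indicE; case: (y \in D) => /=.
      by rewrite mulr1 EFin_max.
    by rewrite mulr0 !maxxx.
  rewrite funenegE /patch /g indicE; case: (y \in D) => /=.
    by rewrite mulr1 -EFin_max.
  by rewrite mulr0 oppr0 !maxxx.
apply: (eq_measurable_fun _ (fun x _ => esym (E x))).
apply: emeasurable_funB; apply: measurable_integral_snd => [x y|].
- by rewrite le_max lexx orbT.
- by apply: measurable_maxr => //; mf.
- by rewrite le_max lexx orbT.
- by apply: measurable_maxr => //; apply: measurable_funN.
Qed.

Lemma measurable_step h u : measurable_fun setT u ->
  measurable_fun setT (step h u).
Proof.
move=> mu_; apply: measurable_funD => //; apply: measurable_funM => //.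
exact: (measurable_gen measurableT).
Qed.

Lemma integrable_kernel x : mu.-integrable setT (EFin \o K x).
Proof.
apply/integrableP; split; first exact/measurable_EFinP.
apply: (@le_lt_trans _ _ M%:E); last exact: ltry.
under eq_integral do rewrite /= ger0_norm//.
exact: (sk_mass hK).
Qed.

Lemma kernel_mass_le x : (\int[mu]_y K x y)%R <= M.
Proof.
rewrite /Rintegral -lee_fin fineK; first exact: (sk_mass hK).
exact: (integrable_fin_num measurableT (integrable_kernel x)).
Qed.

Lemma kernel_mass_ge0 x : 0 <= (\int[mu]_y K x y)%R.
Proof. by apply: Rintegral_ge0. Qed.

(** Tonelli and the symmetry of K collect the kernel mass at the point where f is evaluated. *)
Lemma integral_mass (f : T -> R) : measurable_fun setT f ->
  (forall x, 0 <= f x) ->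
  (\int[mu]_x \int[mu]_y (K x y * f y)%:E =
   \int[mu]_x ((\int[mu]_y K x y)%R * f x)%:E)%E.
Proof.
move=> mf_ f0; have mf2 := measurable_comp2 mf_.
rewrite integral_swap; [|by move=> x y; rewrite mulr_ge0|by mf].
apply: eq_integral => x _.
under eq_integral do rewrite (sk_sym hK) mulrC EFinM.
rewrite ge0_integralZl//; last 3 first.
- exact/measurable_EFinP.
- by move=> y _; rewrite lee_fin.
- by rewrite lee_fin.
rewrite [X in _ = X]EFinM muleC; congr (_ * _)%E.
by rewrite /Rintegral fineK//; apply: (integrable_fin_num measurableT (integrable_kernel x)).
Qed.

Lemma integral_mass_le (f : T -> R) : measurable_fun setT f ->
  (forall x, 0 <= f x) ->
  (\int[mu]_x \int[mu]_y (K x y * f y)%:E <= M%:E * \int[mu]_x (f x)%:E)%E.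
Proof.
move=> mf_ f0; rewrite integral_mass//.
rewrite -ge0_integralZl//; last 3 first.
- exact/measurable_EFinP.
- by move=> y _; rewrite lee_fin.
- by rewrite lee_fin (sk_bound_ge0 hK).
apply: ge0_le_integral => //.
- by move=> y _; rewrite lee_fin mulr_ge0// kernel_mass_ge0.
- apply/measurable_EFinP; apply: measurable_funM => //.
  apply: (measurableT_comp (fine_measurable measurableT)).
  exact: measurable_integral_snd.
- by apply/measurable_EFinP; apply: measurable_funM.
- by move=> y _; rewrite -EFinM lee_fin ler_wpM2r// kernel_mass_le.
Qed.

Definition kernel_integrable u :=
  {ae mu, forall x, mu.-integrable setT (fun y => (K x y * u y)%:E)}.

(** As |u| <= 1 + |u|^p, it suffices that K(x, .) |u|^p be integrable. It is so for almost every x,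
    because its integral, integrated once more in x, is at most M times that of |u|^p. *)
Lemma kernel_integrable_powR p u : 1 <= p -> measurable_fun setT u ->
  (\int[mu]_x (`|u x| `^ p)%:E < +oo)%E -> kernel_integrable u.
Proof.
move=> p1 mu_ up.
have mup : measurable_fun setT (fun x => `|u x| `^ p).
  exact: (measurableT_comp (measurable_powR p) (measurableT_comp (@normr_measurable _ _) mu_)).
have mup2 := measurable_comp2 mup.
have p0 x : 0 <= `|u x| `^ p by exact: powR_ge0.
have m2 : measurable_fun setT (fun x => \int[mu]_y (K x y * `|u y| `^ p)%:E)%E.
  by apply: measurable_integral_snd => [x y|]; [rewrite mulr_ge0 | mf].
have I : mu.-integrable setT (fun x => \int[mu]_y (K x y * `|u y| `^ p)%:E)%E.
  apply/integrableP; split => //.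
  under eq_integral => x _.
    rewrite gee0_abs; last first.
      by apply: integral_ge0 => y _; rewrite lee_fin mulr_ge0.
    over.
  apply: (le_lt_trans (integral_mass_le mup p0)).
  by apply: lte_mul_pinfty => //; rewrite lee_fin (sk_bound_ge0 hK).
have := integrable_ae measurableT I; apply: filterS => x /(_ Logic.I) hx.
have I2 : mu.-integrable setT (EFin \o (fun y => K x y * `|u y| `^ p)).
  apply: ge0_integrable => [|y|].
  - exact: (measurable_funM (mKs x) mup).
  - by rewrite mulr_ge0.
  - by rewrite ltey_eq hx.
apply: (le_integrable measurableT _ _ (integrableD measurableT (integrable_kernel x) I2)).
  by apply/measurable_EFinP; apply: measurable_funM.
move=> y _ /=; rewrite lee_fin normrM (ger0_norm (K0 x y)).
rewrite [X in _ <= X]ger0_norm ?addr_ge0 ?mulr_ge0//.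
rewrite -[X in _ <= X + _]mulr1 -mulrDr ler_wpM2l//.
have [u1|u1] := leP `|u y| 1; first by have := p0 y; lra.
apply: (@le_trans _ _ (`|u y| `^ p)); last by rewrite lerDr.
by rewrite le1r_powR// ltW.
Qed.

(** * Jensen's inequality with dissipation for one averaging step *)

Section Jensen.
Variables (Phi rho s : R -> R) (c h : R).
Hypotheses (Phi0 : forall a, 0 <= Phi a) (c0 : 0 <= c) (h0 : 0 < h).
Hypothesis hM : h * M <= 2^-1.
Hypothesis tangent : forall a b,
  Phi b + s b * (a - b) + c * (rho a - rho b) ^+ 2 <= Phi a.
Hypotheses (mPhi : measurable_fun setT Phi) (mrho : measurable_fun setT rho).

(** With m the kernel mass at x, b = step h u x is the mean of u x with weight 1 - h m and of u y
    with weights h K(x, y). Averaging the tangent bounds at b cancels the linear terms. The gaps at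
    x and y combine through (X - Y)^2 <= 2 (X - Z)^2 + 2 (Y - Z)^2, whence c h / 2; pairing them
    needs 1 - h m >= h m, the origin of h M <= 1/2. *)
Lemma jensen_step_pointwise u x : measurable_fun setT u ->
  mu.-integrable setT (fun y => (K x y * u y)%:E) ->
  ((Phi (step h u x))%:E + (c * h / 2)%:E *
     \int[mu]_y (K x y * (rho (u x) - rho (u y)) ^+ 2)%:E <=
   ((1 - h * (\int[mu]_y K x y)%R) * Phi (u x))%:E
     + h%:E * \int[mu]_y (K x y * Phi (u y))%:E)%E.
Proof.
move=> mu_ Ku.
have mPu : measurable_fun setT (fun y => Phi (u y)) := measurableT_comp mPhi mu_.
have mru : measurable_fun setT (fun y => rho (u y)) := measurableT_comp mrho mu_.
have mKx := mKs x.
have Kx := integrable_kernel x.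
have [KPoo|KPoo] := eqVneq (\int[mu]_y (K x y * Phi (u y))%:E)%E +oo%E.
  by rewrite KPoo gt0_muley ?lte_fin// addey// leey.
have KP : mu.-integrable setT (EFin \o (fun y => K x y * Phi (u y))).
  apply: ge0_integrable => [|y|]; [by mf|by rewrite mulr_ge0|by rewrite ltey].
set b := step h u x; set m := (\int[mu]_y K x y)%R.
have m0 : 0 <= m := kernel_mass_ge0 x.
have mM : m <= M := kernel_mass_le x.
have KZ (k : R) : mu.-integrable setT (EFin \o (fun y => k * K x y)).
  exact: (integrableZl measurableT k Kx).
have KuZ (k : R) : mu.-integrable setT (EFin \o (fun y => k * (K x y * u y))).
  exact: (integrableZl measurableT k Ku).
pose q := (rho (u x) - rho b) ^+ 2.
(* [G y] is h K(x, y) times the tangent gap of u y at b increased by c q, expanded into terms that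
   are each integrable. *)
pose G y := (h * c * q - h * Phi b + h * s b * b) * K x y +
   (h * (K x y * Phi (u y)) + (- (h * s b)) * (K x y * u y)).
have GI : mu.-integrable setT (EFin \o G).
  exact: (integrableD measurableT (KZ (h * c * q - h * Phi b + h * s b * b))
    (integrableD measurableT (integrableZl measurableT h KP) (KuZ (- (h * s b))))).
pose r y := K x y * (rho (u x) - rho (u y)) ^+ 2.
have mr : measurable_fun setT r by rewrite /r; mf.
have r0 y : 0 <= r y by rewrite mulr_ge0// sqr_ge0.
have rG y : c * h / 2 * r y <= G y.
  have := tangent (u y) b; rewrite -subr_ge0 => /(mulr_ge0 (mulr_ge0 (ltW h0) (K0 x y))).
  have := sqr_ge0 ((rho (u x) - rho b) + (rho (u y) - rho b)).
  move=> /(mulr_ge0 (mulr_ge0 (mulr_ge0 (ltW h0) (K0 x y)) c0)).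
  move=> h1 h2; rewrite -subr_ge0 -[X in 0 <= X]addr0.
  have -> : G y - c * h / 2 * r y + 0 =
    h * K x y * (Phi (u y) - (Phi b + s b * (u y - b) + c * (rho (u y) - rho b) ^+ 2)) +
    h * K x y * c * (rho (u x) - rho b + (rho (u y) - rho b)) ^+ 2 / 2.
    by rewrite /G /r /q; field.
  by rewrite addr_ge0// divr_ge0.
have Kl : mu.-integrable setT (EFin \o (fun y => K x y * (u y - u x))).
  apply: (eq_integrable measurableT _ _ _ (integrableD measurableT Ku (KZ (- u x)))).
  by move=> y _ /=; rewrite -EFinD; congr EFin; ring.
have crI : mu.-integrable setT (EFin \o (fun y => c * h / 2 * r y)).
  apply: (le_integrable measurableT _ _ GI); first by apply/measurable_EFinP; mf.
  move=> y _ /=; rewrite lee_fin.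
  have cr : 0 <= c * h / 2 * r y by rewrite mulr_ge0// divr_ge0// mulr_ge0// ltW.
  by rewrite !ger0_norm//; apply: le_trans (rG y).
have HI : ((c * h / 2)%:E * \int[mu]_y (r y)%:E <= (\int[mu]_y G y)%:E)%E.
  rewrite -ge0_integralZl//; last 3 first.
  - exact/measurable_EFinP.
  - by move=> y _; rewrite lee_fin.
  - by rewrite lee_fin divr_ge0// mulr_ge0// ltW.
  have -> : (\int[mu]_y ((c * h / 2)%:E * (r y)%:E) =
             (\int[mu]_y (c * h / 2 * r y))%:E)%E.
    by rewrite /Rintegral fineK// (integrable_fin_num measurableT crI).
  by rewrite lee_fin; apply: le_Rintegral.
have Kuv : \int[mu]_y (K x y * u y) = gen u x + u x * m.
  rewrite /gen -RintegralZl// -RintegralD//.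
  by apply: eq_Rintegral => y _; ring.
have GE : \int[mu]_y G y = (h * c * q - h * Phi b + h * s b * b) * m +
   (h * \int[mu]_y (K x y * Phi (u y)) - h * s b * (gen u x + u x * m)).
  rewrite -Kuv /G RintegralD//; last first.
    exact: (integrableD measurableT (integrableZl measurableT h KP) (KuZ _)).
  rewrite RintegralD//; last exact: (integrableZl measurableT h KP).
  by rewrite !RintegralZl// mulNr.
apply: (le_trans (leeD2l (Phi b)%:E HI)).
have -> : (\int[mu]_y (K x y * Phi (u y))%:E =
    (\int[mu]_y (K x y * Phi (u y)))%:E)%E.
  by rewrite /Rintegral fineK// (integrable_fin_num measurableT KP).
rewrite -EFinM -!EFinD lee_fin GE -/m.
have hm : 0 <= 1 - h * m - h * m.
  have : h * m <= h * M by rewrite ler_pM2l.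
  by have := hM; lra.
have hm1 : 0 <= 1 - h * m.
  by apply: (le_trans hm); rewrite lerBlDr lerDl mulr_ge0// ltW.
have t1 : 0 <= Phi (u x) - (Phi b + s b * (u x - b) + c * (rho (u x) - rho b) ^+ 2).
  by rewrite subr_ge0; exact: tangent.
have h1 := mulr_ge0 hm1 t1.
have h2 := mulr_ge0 (mulr_ge0 hm c0) (sqr_ge0 (rho (u x) - rho b)).
rewrite -/q in h1 h2; rewrite -subr_ge0.
move: h1 h2; move: (\int[mu]_y (K x y * Phi (u y)))%R => I2.
have bE : gen u x = (b - u x) / h by rewrite /b /step; field; rewrite gt_eqF.
rewrite bE; move=> h1 h2; have := addr_ge0 h1 h2; congr (0 <= _).
by field; rewrite gt_eqF.
Qed.

(** After integration in x, the gain from the neighbours cancels the loss h m Phi(u x), by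
    [integral_mass]. *)
Lemma jensen_step u : measurable_fun setT u -> kernel_integrable u ->
  (\int[mu]_x (Phi (step h u x))%:E + (c * h / 2)%:E * form (rho \o u) <=
   \int[mu]_x (Phi (u x))%:E)%E.
Proof.
move=> mu_ Ku.
have mPu : measurable_fun setT (fun y => Phi (u y)) := measurableT_comp mPhi mu_.
have mru : measurable_fun setT (fun y => rho (u y)) := measurableT_comp mrho mu_.
have mPs : measurable_fun setT (fun y => Phi (step h u y)).
  exact: (measurableT_comp mPhi (measurable_step h mu_)).
have mru1 := measurable_comp1 mru; have mru2 := measurable_comp2 mru.
have mPu2 := measurable_comp2 mPu.
have mm : measurable_fun setT (fun x => \int[mu]_y K x y)%R.
  by apply: (measurableT_comp (fine_measurable measurableT)); exact: measurable_integral_snd.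
have ch0 : 0 <= c * h / 2 by rewrite divr_ge0// mulr_ge0// ltW.
have r0 x y : 0 <= K x y * (rho (u x) - rho (u y)) ^+ 2 by rewrite mulr_ge0// sqr_ge0.
have mr : measurable_fun setT
    (fun x => \int[mu]_y (K x y * (rho (u x) - rho (u y)) ^+ 2)%:E)%E.
  by apply: measurable_integral_snd => //; mf.
have p0 x y : 0 <= K x y * Phi (u y) by rewrite mulr_ge0.
have mp : measurable_fun setT (fun x => \int[mu]_y (K x y * Phi (u y))%:E)%E.
  by apply: measurable_integral_snd => //; mf.
have m1 x : 0 <= 1 - h * (\int[mu]_y K x y)%R.
  have : h * (\int[mu]_y K x y)%R <= h * M by rewrite ler_pM2l// kernel_mass_le.
  by have := hM; lra.
rewrite /form /comp -ge0_integralZl//; last by move=> x _; apply: integral_ge0 => y _; rewrite lee_fin.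
rewrite -ge0_integralD//; last 4 first.
- by move=> x _; rewrite lee_fin.
- exact/measurable_EFinP.
- by move=> x _; rewrite mule_ge0 ?lee_fin//; apply: integral_ge0 => y _; rewrite lee_fin.
- exact: measurable_funeM.
have E : (\int[mu]_x (Phi (u x))%:E =
  \int[mu]_x (((1 - h * (\int[mu]_y K x y)%R) * Phi (u x))%:E
     + h%:E * \int[mu]_y (K x y * Phi (u y))%:E))%E.
  rewrite ge0_integralD//; last 4 first.
  - by move=> x _; rewrite lee_fin mulr_ge0.
  - by apply/measurable_EFinP; mf.
  - by move=> x _; rewrite mule_ge0 ?lee_fin ?(ltW h0)//; apply: integral_ge0 => y _; rewrite lee_fin.
  - exact: measurable_funeM.
  rewrite ge0_integralZl//; last 2 first.
  - by move=> x _; apply: integral_ge0 => y _; rewrite lee_fin.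
  - by rewrite lee_fin ltW.
  rewrite integral_mass// -ge0_integralZl//; last 3 first.
  - by apply/measurable_EFinP; mf.
  - by move=> x _; rewrite lee_fin mulr_ge0// kernel_mass_ge0.
  - by rewrite lee_fin ltW.
  rewrite -ge0_integralD//; last 4 first.
  - by move=> x _; rewrite lee_fin mulr_ge0.
  - by apply/measurable_EFinP; mf.
  - by move=> x _; rewrite -EFinM lee_fin !mulr_ge0// ?(ltW h0)// kernel_mass_ge0.
  - by apply/measurable_EFinP; mf.
  apply: eq_integral => x _; rewrite -EFinM -EFinD; congr EFin.
  by ring.
rewrite E; apply: ae_ge0_le_integral => //.
- move=> x _; rewrite adde_ge0 ?lee_fin// mule_ge0 ?lee_fin//.
  by apply: integral_ge0 => y _; rewrite lee_fin.
- by apply: emeasurable_funD; [exact/measurable_EFinP|exact: measurable_funeM].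
- move=> x _; rewrite adde_ge0 ?lee_fin ?mulr_ge0//.
  by rewrite mule_ge0 ?lee_fin ?(ltW h0)//; apply: integral_ge0 => y _; rewrite lee_fin.
- apply: emeasurable_funD; [apply/measurable_EFinP; mf|exact: measurable_funeM].
by apply: filterS Ku => x Kx _; exact: jensen_step_pointwise.
Qed.

End Jensen.

End Markov.

(** * Entropies along solutions *)

(* [s] is a subgradient of the convex function [Phi], with quadratic gap
   measured by [rho]; for Phi = |.|^p one takes rho = |.|^(p/2), which is the
   function to which Nash's inequality applies. *)
Record entropy (R : realType) (p : R) (Phi rho s : R -> R) (c : R) : Prop :=
  Entropy {
    entropy_ge0 : forall a, 0 <= Phi a;
    entropy0 : Phi 0 = 0;
    entropy_dissipation_ge0 : 0 <= c;
    entropy_tangent : forall a b,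
      Phi b + s b * (a - b) + c * (rho a - rho b) ^+ 2 <= Phi a;
    entropy_measurable : measurable_fun setT Phi;
    dissipation_measurable : measurable_fun setT rho;
    entropy_growth : forall e, 0 < e -> exists2 C, 0 <= C &
      forall a b, Phi (a + b) <= Phi a + e * `|a| `^ p + C * `|b| `^ p }.

Lemma entropy_powR (R : realType) (p : R) : 1 <= p ->
  entropy p (fun a => `|a| `^ p) (fun a => `|a| `^ (p / 2))
    (fun b => p * Num.sg b * `|b| `^ (p - 1)) (Num.min 1 (p - 1)).
Proof.
move=> p1; split.
- by move=> a; exact: powR_ge0.
- by rewrite normr0 powR0//; apply/eqP => p0; move: p1; rewrite p0 ler10.
- by rewrite le_min ler01 subr_ge0.
- by move=> a b; exact: bregman_powR.
- exact: (measurableT_comp (measurable_powR p) (@normr_measurable _ _)).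
- exact: (measurableT_comp (measurable_powR _) (@normr_measurable _ _)).
- exact: powR_normD_le.
Qed.

Lemma entropy_soft (R : realType) (p k : R) : 1 <= p -> 0 < k ->
  entropy p (soft k) (fun=> 0) (fun b => if `|b| <= k then 0 else Num.sg b) 0.
Proof.
move=> p1 k0; split.
- exact: soft_ge0.
- by rewrite soft0// ltW.
- by [].
- by move=> a b; rewrite mul0r addr0; apply: soft_tangent; exact: ltW.
- apply: measurable_maxr => //; apply: measurable_funB => //.
- by [].
- exact: softD_le.
Qed.

(** [entropy_powR] at p = 2 dissipates the form of |u|; the energy estimate needs the form of u
    itself, for which the tangent inequality is an identity. *)
Lemma entropy_sqr (R : realType) :
  entropy (2 : R) (fun a => `|a| `^ 2) id (fun b => 2 * b) 1.
Proof.
have e (a : R) : `|a| `^ 2 = a ^+ 2 by rewrite powR_mulrn// real_normK ?num_real.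
have h := @entropy_powR R 2 ltac:(by rewrite ler1n).
split; [exact: (entropy_ge0 h)|exact: (entropy0 h)|by []| |
  exact: (entropy_measurable h)|exact: measurable_id|exact: (entropy_growth h)].
move=> a b; rewrite !e /=.
by have -> : b ^+ 2 + 2 * b * (a - b) + 1 * (a - b) ^+ 2 = a ^+ 2 by ring.
Qed.

(** Continuity and differentiability in L^p, written with p-th powers of norms. The derivative is
    taken from the right only, which is what [dini_le] asks for. *)
Record evolution d (T : measurableType d) (R : realType)
    (mu : {sigma_finite_measure set T -> \bar R}) (K : T -> T -> R) (p : R)
    (U : R -> T -> R) : Prop := Evolution {
  evolution_measurable : forall t : R, 0 <= t -> measurable_fun setT (U t);
  evolution_fin : forall t : R, 0 <= t -> (\int[mu]_x (`|U t x| `^ p)%:E < +oo)%E;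
  evolution_continuous : forall t : R, 0 <= t -> forall e : R, 0 < e -> exists2 d, 0 < d &
    forall s : R, 0 <= s -> `|s - t| < d ->
      (\int[mu]_x (`|U s x - U t x| `^ p)%:E <= e%:E)%E;
  evolution_derivative : forall t : R, 0 < t -> forall e : R, 0 < e -> exists2 d, 0 < d &
    forall h : R, 0 < h < d ->
      (\int[mu]_x (`|h^-1 * (U (t + h) x - U t x) - gen mu K (U t) x| `^ p)%:E
         <= e%:E)%E }.

Lemma abs_diff_lt (R : realFieldType) (e x y a b a' b' : R) : 0 < e ->
  x <= y + a + b -> y <= x + a' + b' -> a <= e / 4 -> b <= e / 4 ->
  a' <= e / 4 -> b' <= e / 4 -> `|x - y| < e.
Proof. by move=> *; rewrite ltr_norml; apply/andP; split; lra. Qed.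

Lemma dini_combine (R : realFieldType) (k e l h h0 f f' g X a b : R) :
  0 <= l -> l * h0 = h -> f' <= (1 - l) * f + l * X -> X <= g + a + b ->
  g + k * h0 <= f -> a <= e * h0 / 2 -> b <= e * h0 / 2 ->
  f' <= f - k * h + e * h.
Proof.
move=> l0 <- hf hX hg ha hb; apply: (le_trans hf).
have /(ler_wpM2l l0) : X <= f - k * h0 + e * h0 by lra.
have -> : l * (f - k * h0 + e * h0) = l * f - k * (l * h0) + e * (l * h0) by ring.
lra.
Qed.

Section Evolution.
Context d (T : measurableType d) (R : realType).
Variables (mu : {sigma_finite_measure set T -> \bar R}) (K : T -> T -> R) (M p h0 : R).
Hypotheses (hK : symmetric_kernel mu K M) (p1 : 1 <= p).
Hypotheses (h00 : 0 < h0) (hM : h0 * M <= 2^-1).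
Implicit Types (u v : T -> R) (Phi rho s : R -> R) (t e : R).

Definition entr Phi u : \bar R := (\int[mu]_x (Phi (u x))%:E)%E.

Notation pint := (entr (fun a => `|a| `^ p)).

Lemma entr_ge0 Phi u : (forall a, 0 <= Phi a) -> (0 <= entr Phi u)%E.
Proof. by move=> P0; apply: integral_ge0 => x _; rewrite lee_fin. Qed.

Let pint_ge0 u : (0 <= pint u)%E.
Proof. by apply: entr_ge0 => a; exact: powR_ge0. Qed.

Let mp : measurable_fun setT (fun a : R => `|a| `^ p).
Proof. exact: (entropy_measurable (entropy_powR p1)). Qed.

Section OneEntropy.
Variables (Phi rho s : R -> R) (c : R).
Hypothesis ent : entropy p Phi rho s c.
Let Phi0 := entropy_ge0 ent.
Let mPhi := entropy_measurable ent.

Lemma entrD e : 0 < e -> exists2 C, 0 <= C & forall u r,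
  measurable_fun setT u -> measurable_fun setT r ->
  (entr Phi (fun x => (u x + r x)%R) <= entr Phi u + e%:E * pint u + C%:E * pint r)%E.
Proof.
move=> e0; have [C C0 hC] := entropy_growth ent e0; exists C => // u r mu_ mr.
have mPu : measurable_fun setT (fun x => Phi (u x)) := measurableT_comp mPhi mu_.
have mpu : measurable_fun setT (fun x => `|u x| `^ p) := measurableT_comp mp mu_.
have mpr : measurable_fun setT (fun x => `|r x| `^ p) := measurableT_comp mp mr.
have q0 x : 0 <= x `^ p := powR_ge0 _ _.
rewrite /entr -(ge0_intZ mu measurableT (ltW e0))// -(ge0_intZ mu measurableT C0)//.
rewrite -!ge0_intD//; do ?[by mf|by move=> x; rewrite ?addr_ge0 ?mulr_ge0 ?(ltW e0)].
apply: ge0_int_le => //; last by mf.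
by apply: (measurableT_comp mPhi); mf.
Qed.

(** The growth condition at a = 0 bounds Phi by a multiple of |.|^p. *)
Lemma entr_fin u : measurable_fun setT u -> (pint u < +oo)%E -> (entr Phi u < +oo)%E.
Proof.
move=> mu_ pu; have [C C0 hC] := entrD (@ltr01 R).
have := hC (cst 0) u (measurable_cst _) mu_.
have -> : (fun x => (cst 0 x + u x)%R) = u by apply/funext => x; rewrite /= add0r.
have -> : entr Phi (cst 0) = 0%E.
  by rewrite /entr; under eq_integral do rewrite /= (entropy0 ent); rewrite integral0.
have -> : pint (cst 0) = 0%E.
  rewrite /entr; under eq_integral do rewrite /= (entropy0 (entropy_powR p1)).
  by rewrite integral0.
rewrite mule0 !add0e => /le_lt_trans; apply.
by apply: lte_mul_pinfty => //; rewrite lee_fin.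
Qed.

Lemma entr_convex (l : R) u v : 0 <= l <= 1 ->
  measurable_fun setT u -> measurable_fun setT v ->
  (entr Phi (fun x => ((1 - l) * u x + l * v x)%R)
     <= (1 - l)%:E * entr Phi u + l%:E * entr Phi v)%E.
Proof.
move=> l01 mu_ mv; have /andP[l0 l1] := l01; have l1' : 0 <= 1 - l by rewrite subr_ge0.
have mPu : measurable_fun setT (fun x => Phi (u x)) := measurableT_comp mPhi mu_.
have mPv : measurable_fun setT (fun x => Phi (v x)) := measurableT_comp mPhi mv.
rewrite /entr -(ge0_intZ mu measurableT l1')// -(ge0_intZ mu measurableT l0)//.
rewrite -!ge0_intD//; [|by mf|by mf| |].
- apply: ge0_int_le => //; [by apply: (measurableT_comp mPhi); mf|by mf|].
  move=> x _.
  apply: (@convex_of_tangent _ Phi s) => // a b.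
  apply: le_trans (entropy_tangent ent a b); rewrite lerDl.
  by rewrite mulr_ge0 ?sqr_ge0// (entropy_dissipation_ge0 ent).
- by move=> x; rewrite mulr_ge0.
- by move=> x; rewrite mulr_ge0.
Qed.

Lemma entr_step u : measurable_fun setT u -> (pint u < +oo)%E ->
  (entr Phi (step mu K h0 u) + (c * h0 / 2)%:E * form mu K (rho \o u) <= entr Phi u)%E.
Proof.
move=> mu_ pu; apply: (jensen_step hK) => //.
- exact: (entropy_dissipation_ge0 ent).
- exact: (entropy_tangent ent).
- exact: (dissipation_measurable ent).
- exact: (kernel_integrable_powR hK p1).
Qed.

End OneEntropy.

Lemma pint_scale (k : R) u : measurable_fun setT u ->
  pint (fun x => (k * u x)%R) = ((`|k| `^ p)%:E * pint u)%E.
Proof.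
move=> mu_; rewrite /entr -ge0_intZ ?powR_ge0//.
- by apply: eq_integral => x _; rewrite normrM powRM.
- exact: (measurableT_comp mp mu_).
Qed.

Variable U : R -> T -> R.
Hypothesis evol : evolution mu K p U.
Let mU := evolution_measurable evol.
Let pU := evolution_fin evol.

(** Stated for an abstract functional so as to cover both the entropies and, for p = 2, the
    quadratic form. The perturbation bound is applied from U t to U r and back, so U r must be
    bounded uniformly for r near t. *)
Lemma functional_continuous (Psi : (T -> R) -> \bar R) :
  (forall u, 0 <= Psi u)%E ->
  (forall u, measurable_fun setT u -> pint u < +oo -> Psi u < +oo)%E ->
  (forall e, 0 < e -> exists2 C, 0 <= C & forall u v,
    measurable_fun setT u -> measurable_fun setT v ->
    (Psi (fun x => (u x + v x)%R) <= Psi u + e%:E * pint u + C%:E * pint v)%E) ->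
  forall t, 0 <= t -> forall e, 0 < e -> exists2 d0, 0 < d0 &
  forall r : R, 0 <= r -> `|r - t| < d0 ->
    `|fine (Psi (U r)) - fine (Psi (U t))| < e.
Proof.
move=> Psi0 Psifin PsiD t t0 e e0; pose F r := fine (Psi (U r)).
have FE r : 0 <= r -> Psi (U r) = (F r)%:E.
  by move=> r0; apply: ge0_fineE => //; apply: Psifin; [exact: mU|exact: pU].
rewrite -!/(F _).
pose P r := fine (pint (U r)).
have PE r : 0 <= r -> pint (U r) = (P r)%:E.
  by move=> r0; apply: ge0_fineE => //; exact: pU.
have P0 r : 0 <= P r by apply: fine_ge0.
have [C1 C10 hC1] := entrD (entropy_powR p1) (@ltr01 R).
(* This bounds [P r] as soon as the p-th power integral of U r - U t is at most 1. *)
pose B := 2 * P t + C1.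
have B0 : 0 <= B by rewrite addr_ge0// mulr_ge0.
have PB : P t <= B + 1 by have := P0 t; rewrite /B; lra.
pose e1 := e / 4 / (B + 1).
have e10 : 0 < e1 by rewrite !divr_gt0// ltr_wpDl.
have e1B : e1 * (B + 1) = e / 4 by rewrite /e1 divfK// gt_eqF// ltr_wpDl.
have [C C0 hC] := PsiD _ e10.
pose e2 := Num.min 1 (e / 4 / (C + 1)).
have e20 : 0 < e2 by rewrite lt_min ltr01 !divr_gt0// ltr_wpDl.
have e21 : e2 <= 1 by rewrite ge_min lexx.
have Ce2 : C * e2 <= e / 4.
  apply: (@le_trans _ _ ((C + 1) * e2)); first by rewrite ler_wpM2r ?(ltW e20)// lerDl.
  by rewrite mulrC -ler_pdivlMr ?ltr_wpDl// ge_min lexx orbT.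
have [d' d0 hd] := evolution_continuous evol t0 e20.
exists d' => // r r0 rt; have {}hd := hd r r0 rt.
have mD : measurable_fun setT (fun x => U r x - U t x).
  by have := mU r0; have := mU t0 => *; mf.
have mD' : measurable_fun setT (fun x => U t x - U r x).
  by have := mU r0; have := mU t0 => *; mf.
have sw : pint (fun x => U t x - U r x) = pint (fun x => U r x - U t x).
  by apply: eq_integral => x _; rewrite distrC.
have eD (a b : T -> R) : (fun x => a x + (b x - a x)) = b.
  by apply/funext => x; rewrite addrC subrK.
have [q qE] : exists q, pint (fun x => U r x - U t x) = q%:E.
  exists (fine (pint (fun x => U r x - U t x))); apply: ge0_fineE => //.
  by apply: (le_lt_trans hd); exact: ltry.
have q2 : q <= e2 by rewrite -lee_fin -qE.
have q0 : 0 <= q by rewrite -lee_fin -qE.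
have Cq : C * q <= e / 4 by apply: le_trans Ce2; rewrite ler_wpM2l.
have PrB : P r <= B.
  have := hC1 _ _ (mU t0) mD; rewrite eD qE !PE// -!EFinM -!EFinD lee_fin => h.
  have h1 : C1 * q <= C1 by rewrite -[X in _ <= X]mulr1 ler_wpM2l// (le_trans q2).
  apply: (le_trans h); by rewrite mul1r /B mulr_natl mulr2n lerD2l.
have h1 := hC _ _ (mU t0) mD.
rewrite eD qE PE// !FE// -!EFinM -!EFinD lee_fin in h1.
have h2 := hC _ _ (mU r0) mD'.
rewrite eD sw qE PE// !FE// -!EFinM -!EFinD lee_fin in h2.
have b1 : e1 * P t <= e1 * (B + 1) by rewrite ler_wpM2l// ltW.
have b2 : e1 * P r <= e1 * (B + 1).
  apply: ler_wpM2l; first exact: ltW.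
  by apply: (le_trans PrB); rewrite lerDl ler01.
rewrite e1B in b1 b2.
exact: (abs_diff_lt e0 h1 h2 b1 Cq b2 Cq).
Qed.

Section Decay.
Variables (Phi rho s : R -> R) (c : R).
Hypothesis ent : entropy p Phi rho s c.
Let Phi0 := entropy_ge0 ent.
Let F t := fine (entr Phi (U t)).

Let FE t : 0 <= t -> entr Phi (U t) = (F t)%:E.
Proof.
move=> t0; apply: ge0_fineE; first exact: entr_ge0.
exact: (entr_fin ent (mU t0) (pU t0)).
Qed.

Lemma entr_continuous t : 0 <= t -> forall e, 0 < e -> exists2 d0, 0 < d0 &
  forall r : R, 0 <= r -> `|r - t| < d0 -> `|F r - F t| < e.
Proof.
apply: functional_continuous; last exact: (entrD ent).
- by move=> u; exact: entr_ge0.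
- by move=> u; exact: (entr_fin ent).
Qed.

(* With r the error of the difference quotient, U (t + h) is the convex
   combination of U t and step h0 (U t) + h0 r with weights 1 - h/h0 and h/h0,
   so the decay over a fixed step h0 bounds the derivative at t. *)
Lemma entr_dini t (k : R) : 0 < t ->
  (k%:E <= (c / 2)%:E * form mu K (rho \o U t))%E ->
  forall e, 0 < e -> exists2 d, 0 < d &
    forall h : R, 0 < h < d -> F (t + h) <= F t - k * h + e * h.
Proof.
move=> t0 hk e e0; have t0' := ltW t0.
have mUt := mU t0'.
set S := step mu K h0 (U t).
have mS : measurable_fun setT S := measurable_step hK h0 mUt.
have Sp : (pint S < +oo)%E.
  have := entr_step (entropy_powR p1) mUt (pU t0') => h.
  apply: le_lt_trans (pU t0'); apply: le_trans h; rewrite leeDl// mule_ge0//.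
    rewrite lee_fin divr_ge0// mulr_ge0 ?(ltW h00)//.
    exact: (entropy_dissipation_ge0 (entropy_powR p1)).
  apply: integral_ge0 => x _; apply: integral_ge0 => y _.
  by rewrite lee_fin mulr_ge0 ?sqr_ge0// (sk_ge0 hK).
have PSE : pint S = (fine (pint S))%:E by exact: ge0_fineE.
set P := fine (pint S) in PSE.
have P0 : 0 <= P by rewrite -lee_fin -PSE.
have FSE : entr Phi S = (fine (entr Phi S))%:E.
  by apply: ge0_fineE; [exact: entr_ge0|exact: (entr_fin ent)].
set FS := fine _ in FSE.
have FSle : FS + k * h0 <= F t.
  rewrite -lee_fin EFinD -FSE -FE//.
  apply: le_trans (entr_step ent mUt (pU t0')); rewrite leeD2l//.
  rewrite (mulrC k) EFinM mulrAC mulrC EFinM -muleA.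
  by apply: lee_wpmul2l => //; rewrite lee_fin ltW.
pose e1 := e * h0 / 2 / (P + 1).
have e10 : 0 < e1 by rewrite !divr_gt0 ?mulr_gt0// ltr_wpDl.
have e1P : e1 * P <= e * h0 / 2.
  apply: (@le_trans _ _ (e1 * (P + 1))); first by rewrite ler_wpM2l ?(ltW e10)// lerDl.
  by rewrite /e1 divfK// gt_eqF// ltr_wpDl.
have [C C0 hC] := entrD ent e10.
pose C' := C * `|h0| `^ p.
have C'0 : 0 <= C' by rewrite mulr_ge0// powR_ge0.
pose e2 := e * h0 / 2 / (C' + 1).
have e20 : 0 < e2 by rewrite !divr_gt0 ?mulr_gt0// ltr_wpDl.
have Ce2 : C' * e2 <= e * h0 / 2.
  apply: (@le_trans _ _ ((C' + 1) * e2)); first by rewrite ler_wpM2r ?(ltW e20)// lerDl.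
  by rewrite mulrC /e2 divfK// gt_eqF// ltr_wpDl.
have [d' d0 hd] := evolution_derivative evol t0 e20.
(* h < h0 keeps the weight h / h0 of the convex combination below 1. *)
exists (Num.min d' h0); first by rewrite lt_min d0.
move=> h /andP[hp]; rewrite lt_min => /andP[hd' hh0].
have {}hd := hd h; rewrite hp hd' in hd; have {}hd := hd isT.
have th0 : 0 <= t + h by rewrite addr_ge0// ltW.
set r := (fun x => h^-1 * (U (t + h) x - U t x) - gen mu K (U t) x) in hd.
have mr : measurable_fun setT r.
  have := mU th0 => *; apply: measurable_funB; first by mf.
  exact: (measurable_gen hK measurableT mUt).
pose l := h / h0.
have l01 : 0 <= l <= 1.
  by rewrite divr_ge0 ?(ltW hp) ?(ltW h00)//= ler_pdivrMr// mul1r ltW.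
have mh0r : measurable_fun setT (fun x => h0 * r x) by mf.
have Ueq : U (t + h) = (fun x => (1 - l) * U t x + l * (S x + h0 * r x)).
  apply/funext => x; rewrite /l /S /r /step.
  by field; rewrite !gt_eqF.
have mSr : measurable_fun setT (fun x => S x + h0 * r x) by mf.
have rE : pint r = (fine (pint r))%:E.
  by apply: ge0_fineE; [exact: pint_ge0|apply: (le_lt_trans hd); exact: ltry].
set q := fine _ in rE.
have q0 : 0 <= q by rewrite -lee_fin -rE.
have qe : q <= e2 by rewrite -lee_fin -rE.
have hSr := hC S (fun x => h0 * r x) mS mh0r.
rewrite pint_scale// rE PSE FSE -!EFinM -!EFinD in hSr.
have FSr : entr Phi (fun x => S x + h0 * r x) =
    (fine (entr Phi (fun x => S x + h0 * r x)))%:E.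
  by apply: ge0_fineE; [exact: entr_ge0|apply: (le_lt_trans hSr); exact: ltry].
set FSr' := fine _ in FSr.
rewrite FSr lee_fin in hSr.
have := entr_convex ent l01 mUt mSr.
rewrite -Ueq FSr !FE// -!EFinM -!EFinD lee_fin => hF.
have Cq : C' * q <= e * h0 / 2 by apply: le_trans Ce2; rewrite ler_wpM2l.
rewrite mulrA -/C' in hSr; have /andP[l0 _] := l01.
apply: (dini_combine l0 _ hF hSr FSle e1P Cq).
by rewrite /l divfK// gt_eqF.
Qed.

Lemma entr_decay (a b k : R) : 0 <= a -> a <= b ->
  (forall t, a < t < b -> (k%:E <= (c / 2)%:E * form mu K (rho \o U t))%E) ->
  F b <= F a - k * (b - a).
Proof.
move=> a0 ab hk; apply: dini_le => //.
- move=> t /andP[at_ tb] e e0.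
  have [d' d0 hd] := entr_continuous (le_trans a0 at_) e0.
  by exists d' => // r /andP[ar _]; apply: hd; exact: le_trans ar.
- move=> t /andP[at_ tb] e e0; apply: entr_dini => //; first exact: le_lt_trans at_.
  by apply: hk; rewrite at_.
Qed.

Lemma entr_nonincreasing (a b : R) : 0 <= a -> a <= b ->
  (entr Phi (U b) <= entr Phi (U a))%E.
Proof.
move=> a0 ab; rewrite !FE//; last exact: le_trans ab.
have := @entr_decay a b 0 a0 ab; rewrite mul0r subr0 lee_fin; apply => t _.
rewrite mule_ge0 ?lee_fin ?divr_ge0 ?(entropy_dissipation_ge0 ent)//.
apply: integral_ge0 => x _; apply: integral_ge0 => y _.
by rewrite lee_fin mulr_ge0 ?sqr_ge0// (sk_ge0 hK).
Qed.

End Decay.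

(** The truncations at level 1 / (n + 1) increase to |U t|, so monotone convergence applies whether
    or not the L^1 norms are finite. *)
Lemma L1_nonincreasing t : 0 <= t ->
  (\int[mu]_x `|U t x|%:E <= \int[mu]_x `|U 0 x|%:E)%E.
Proof.
move=> t0; have mUt := mU t0; have mU0 := mU (lexx 0).
have k0 n : 0 < n.+1%:R^-1 :> R by rewrite invr_gt0.
pose f n x := (soft n.+1%:R^-1 (U t x))%:E.
have mf_ n : measurable_fun setT (f n).
  apply/measurable_EFinP; apply: (measurableT_comp _ mUt).
  exact: (entropy_measurable (entropy_soft p1 (k0 n))).
have -> : (\int[mu]_x `|U t x|%:E = \int[mu]_x limn (f ^~ x))%E.
  apply: eq_integral => x _; apply/esym/cvg_lim => //.
  apply: cvg_EFin; first exact: nearW.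
  apply: (@squeeze_cvgr _ _ _ _ (fun n : nat => `|U t x| - n.+1%:R^-1) (fun=> `|U t x|)).
  - apply: nearW => n; apply/andP; split; first by rewrite /= /soft le_max lexx.
    by rewrite ge_max normr_ge0 andbT lerBlDr lerDl ltW.
  - rewrite -[X in _ --> X]subr0.
    by apply: cvgB; [exact: cvg_cst | exact: cvg_harmonic].
  - exact: cvg_cst.
rewrite monotone_convergence//; last 2 first.
- by move=> n x _; rewrite lee_fin soft_ge0.
- move=> x _; apply/nondecreasing_seqP => n; rewrite lee_fin.
  rewrite /soft ge_max soft_ge0 andbT le_max lerD2l lerN2 lef_pV2 ?posrE//.
  by rewrite ler_nat leqnSn.
apply: lime_le.
  apply: ereal_nondecreasing_is_cvgn => m n mn; apply: ge0_le_integral => //.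
  - by move=> x _; rewrite lee_fin soft_ge0.
  - move=> x _; rewrite lee_fin /soft ge_max soft_ge0 andbT le_max lerD2l lerN2.
    by rewrite lef_pV2 ?posrE// ler_nat ltnS mn.
apply: nearW => n.
apply: (le_trans (entr_nonincreasing (entropy_soft p1 (k0 n)) (lexx 0) t0)).
apply: ge0_le_integral => //.
- by move=> x _; rewrite lee_fin soft_ge0.
- apply/measurable_EFinP; apply: (measurableT_comp _ mU0).
  exact: (entropy_measurable (entropy_soft p1 (k0 n))).
- by apply/measurable_EFinP; exact: (measurableT_comp (@normr_measurable _ _) mU0).
- move=> x _; rewrite lee_fin /soft ge_max normr_ge0 andbT lerBlDr lerDl.
  by rewrite ltW.
Qed.

End Evolution.

(** * Monotonicity of the quadratic form *)

Lemma mulr_le_sqrD (R : realFieldType) (a b : R) : a * b <= a ^+ 2 + b ^+ 2.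
Proof.
rewrite -subr_ge0 (_ : _ - _ = ((a - b) ^+ 2 + a ^+ 2 + b ^+ 2) / 2); last by field.
by rewrite divr_ge0// !addr_ge0// sqr_ge0.
Qed.

Section FormBounds.
Context d (T : measurableType d) (R : realType).
Variables (mu : {sigma_finite_measure set T -> \bar R}) (K : T -> T -> R) (M : R).
Hypothesis hK : symmetric_kernel mu K M.
Implicit Types (u v w : T -> R).

Let K0 := sk_ge0 hK.
Let mK := sk_measurable hK.

Lemma form_ge0 u : (0 <= form mu K u)%E.
Proof.
apply: integral_ge0 => x _; apply: integral_ge0 => y _.
by rewrite lee_fin mulr_ge0 ?sqr_ge0.
Qed.

Let mform u : measurable_fun setT u ->
  measurable_fun setT (fun z : T * T => K z.1 z.2 * (u z.1 - u z.2) ^+ 2).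
Proof.
move=> mu_; have := measurable_comp1 mu_; have := measurable_comp2 mu_ => *; by mf.
Qed.

Lemma form_prod u : measurable_fun setT u ->
  form mu K u = (\int[mu \x mu]_z (K z.1 z.2 * (u z.1 - u z.2) ^+ 2)%:E)%E.
Proof.
move=> mu_; rewrite fubini_tonelli1//.
  by apply/measurable_EFinP; exact: mform.
by move=> z; rewrite lee_fin mulr_ge0 ?sqr_ge0.
Qed.

Lemma formD (e : R) u v : 0 < e -> measurable_fun setT u -> measurable_fun setT v ->
  (form mu K (fun x => (u x + v x)%R) <=
    (1 + e)%:E * form mu K u + (1 + e^-1)%:E * form mu K v)%E.
Proof.
move=> e0 mu_ mv; have e1 : 0 <= 1 + e by rewrite addr_ge0// ltW.
have e2 : 0 <= 1 + e^-1 by rewrite addr_ge0// invr_ge0 ltW.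
have muv : measurable_fun setT (fun x => u x + v x) by mf.
rewrite !form_prod// -!ge0_intZ//; do ?[exact: mform|by move=> x; rewrite mulr_ge0 ?sqr_ge0].
have mu2 := mform mu_; have mv2 := mform mv; have muv2 := mform muv.
rewrite -ge0_intD//;
  do ?[by mf|by move=> x; rewrite mulr_ge0// mulr_ge0 ?sqr_ge0].
apply: ge0_int_le => //; do ?[by mf|by move=> x; rewrite mulr_ge0 ?sqr_ge0].
move=> z _; set a := u z.1 - u z.2; set b := v z.1 - v z.2.
have -> : u z.1 + v z.1 - (u z.2 + v z.2) = a + b by rewrite /a /b; ring.
rewrite !(mulrCA _ (K _ _)) -mulrDr ler_wpM2l// -subr_ge0.
have -> : (1 + e) * a ^+ 2 + (1 + e^-1) * b ^+ 2 - (a + b) ^+ 2 =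
  (e * a - b) ^+ 2 / e by field; rewrite gt_eqF.
by rewrite divr_ge0 ?sqr_ge0// ltW.
Qed.

(** From (a - b)^2 <= 2 a^2 + 2 b^2, each square contributing 2 M. The form is thus bounded on
    L^2. *)
Lemma form_le u : measurable_fun setT u ->
  (form mu K u <= (4 * M)%:E * \int[mu]_x (u x ^+ 2)%:E)%E.
Proof.
move=> mu_; have mu1 := measurable_comp1 mu_; have mu2 := measurable_comp2 mu_.
have s0 x : 0 <= u x ^+ 2 by exact: sqr_ge0.
have ms : measurable_fun setT (fun x => u x ^+ 2) by mf.
have H := integral_mass_le hK ms s0.
have k1 x y : 0 <= K x y * u x ^+ 2 by rewrite mulr_ge0.
have k2 x y : 0 <= K x y * u y ^+ 2 by rewrite mulr_ge0.
have H' : (\int[mu]_x \int[mu]_y (K x y * u x ^+ 2)%:E <=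
    M%:E * \int[mu]_x (u x ^+ 2)%:E)%E.
  rewrite integral_swap//; last by mf.
  by under eq_integral do under eq_integral do rewrite (sk_sym hK).
have m1 : measurable_fun setT (fun z : T * T => K z.1 z.2 * u z.1 ^+ 2) by mf.
have m2 : measurable_fun setT (fun z : T * T => K z.1 z.2 * u z.2 ^+ 2) by mf.
have E1 : (\int[mu \x mu]_z (K z.1 z.2 * u z.1 ^+ 2)%:E =
    \int[mu]_x \int[mu]_y (K x y * u x ^+ 2)%:E)%E.
  rewrite fubini_tonelli1//; first exact/measurable_EFinP.
  by move=> z; rewrite lee_fin.
have E2 : (\int[mu \x mu]_z (K z.1 z.2 * u z.2 ^+ 2)%:E =
    \int[mu]_x \int[mu]_y (K x y * u y ^+ 2)%:E)%E.
  rewrite fubini_tonelli1//; first exact/measurable_EFinP.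
  by move=> z; rewrite lee_fin.
rewrite form_prod//.
apply: (@le_trans _ _ (\int[mu \x mu]_z (2 * (K z.1 z.2 * u z.1 ^+ 2) +
    2 * (K z.1 z.2 * u z.2 ^+ 2))%:E)%E).
  apply: ge0_int_le => //; do ?[exact: mform|by mf].
    by move=> z; rewrite mulr_ge0 ?sqr_ge0.
  move=> z _; rewrite !(mulrCA 2 (K _ _)) -mulrDr ler_wpM2l// -subr_ge0.
  have -> : 2 * u z.1 ^+ 2 + 2 * u z.2 ^+ 2 - (u z.1 - u z.2) ^+ 2 =
    (u z.1 + u z.2) ^+ 2 by ring.
  exact: sqr_ge0.
rewrite ge0_intD; do ?[by mf|by move=> z; rewrite mulr_ge0|exact: measurableT].
rewrite !ge0_intZ//; [|by move=> z; rewrite mulr_ge0..].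
rewrite E1 E2.
have -> : ((4 * M)%:E * \int[mu]_x (u x ^+ 2)%:E =
    2%:E * (M%:E * \int[mu]_x (u x ^+ 2)%:E) +
    2%:E * (M%:E * \int[mu]_x (u x ^+ 2)%:E))%E.
  rewrite !muleA -EFinM -ge0_muleDl ?lee_fin ?mulr_ge0 ?(sk_bound_ge0 hK)//.
  by rewrite -EFinD; congr (_%:E * _)%E; ring.
by apply: leeD; apply: lee_wpmul2l => //; rewrite lee_fin.
Qed.

Let L2 u := (\int[mu]_x (u x ^+ 2)%:E)%E.

(** With w = [gen mu K u], symmetry turns the expansion of the form at u + h w into E(u) - 4 h
    ||w||^2 + h^2 E(w), and E(w) <= 4 M ||w||^2 makes the correction nonpositive. *)
Lemma form_step_le (h : R) u : 0 < h -> h * M <= 2^-1 ->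
  measurable_fun setT u -> (L2 u < +oo)%E -> kernel_integrable mu K u ->
  (L2 (gen mu K u) < +oo)%E ->
  (form mu K (step mu K h u) <= form mu K u)%E.
Proof.
move=> h0 hM mu_ u2 Ku.
have mg : measurable_fun setT (gen mu K u) := measurable_gen hK measurableT mu_.
rewrite /step; move wE : (gen mu K u) mg => w mw w2.
have mhw : measurable_fun setT (fun x => u x + h * w x) by mf.
have mu1 := measurable_comp1 mu_; have mu2 := measurable_comp2 mu_.
have mw1 := measurable_comp1 mw; have mw2 := measurable_comp2 mw.
have fin v : measurable_fun setT v -> (L2 v < +oo)%E -> (form mu K v < +oo)%E.
  move=> mv v2; apply: (le_lt_trans (form_le mv)).
  by rewrite lte_mul_pinfty// lee_fin mulr_ge0// (sk_bound_ge0 hK).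
have fint v : measurable_fun setT v -> (L2 v < +oo)%E ->
    (mu \x mu)%E.-integrable setT
      (EFin \o (fun z : T * T => K z.1 z.2 * (v z.1 - v z.2) ^+ 2)).
  move=> mv v2; apply: ge0_integrable; first exact: mform.
    by move=> z; rewrite mulr_ge0 ?sqr_ge0.
  by rewrite -form_prod//; exact: fin.
have s0 x : 0 <= w x ^+ 2 by exact: sqr_ge0.
have ms : measurable_fun setT (fun x => w x ^+ 2) by mf.
have mass_fin : (M%:E * L2 w < +oo)%E.
  by rewrite lte_mul_pinfty// lee_fin (sk_bound_ge0 hK).
have mass2 : (mu \x mu)%E.-integrable setT
    (EFin \o (fun z : T * T => K z.1 z.2 * w z.2 ^+ 2)).
  apply: ge0_integrable => //; [by mf|by move=> z; rewrite mulr_ge0|].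
  rewrite fubini_tonelli1//; last 2 first.
  - by apply/measurable_EFinP; mf.
  - by move=> z; rewrite lee_fin mulr_ge0.
  exact: (le_lt_trans (integral_mass_le hK ms s0)).
have mass1 : (mu \x mu)%E.-integrable setT
    (EFin \o (fun z : T * T => K z.1 z.2 * w z.1 ^+ 2)).
  apply: ge0_integrable => //; [by mf|by move=> z; rewrite mulr_ge0|].
  rewrite fubini_tonelli1//; last 2 first.
  - by apply/measurable_EFinP; mf.
  - by move=> z; rewrite lee_fin mulr_ge0.
  rewrite /fubini_F /= integral_swap//; [|by move=> x y; rewrite mulr_ge0|by mf].
  under eq_integral do under eq_integral do rewrite (sk_sym hK).
  exact: (le_lt_trans (integral_mass_le hK ms s0)).
have PIa (a : T * T -> R) : measurable_fun setT a ->
    (mu \x mu)%E.-integrable setT (EFin \o (fun z => K z.1 z.2 * a z ^+ 2)) ->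
    (mu \x mu)%E.-integrable setT
      (EFin \o (fun z => K z.1 z.2 * ((u z.1 - u z.2) * a z))).
  move=> ma aI; apply: (le_integrable measurableT _ _
    (integrableD measurableT (fint u mu_ u2) aI)).
    by apply/measurable_EFinP; mf.
  move=> z _; rewrite /= lee_fin -mulrDr !normrM !(ger0_norm (K0 _ _)).
  apply: ler_wpM2l => //; rewrite [X in _ <= X]ger0_norm ?addr_ge0 ?sqr_ge0//.
  rewrite -(real_normK (num_real (u z.1 - u z.2))) -(real_normK (num_real (a z))).
  exact: mulr_le_sqrD.
(* [P] and its mirror image [Q] split the cross term K (u x - u y) (w x - w y). Each integrates to -
   ||w||^2, by integrating first in the variable that w does not see. *)
pose P z := K z.1 z.2 * ((u z.1 - u z.2) * w z.1).
pose Q z := P (z.2, z.1).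
have PI : (mu \x mu)%E.-integrable setT (EFin \o P) := PIa _ mw1 mass1.
have QI : (mu \x mu)%E.-integrable setT (EFin \o Q).
  have := PIa (fun z => - w z.2) (measurable_funN mw2).
  have -> : (fun z => K z.1 z.2 * (- w z.2) ^+ 2) = (fun z => K z.1 z.2 * w z.2 ^+ 2).
    by apply/funext => z; rewrite sqrrN.
  have -> : (fun z => K z.1 z.2 * ((u z.1 - u z.2) * (- w z.2))) = Q.
    by apply/funext => z; rewrite /Q /P /= (sk_sym hK); ring.
  exact.
have genE x : mu.-integrable setT (fun y => (K x y * u y)%:E) ->
    (\int[mu]_y (P (x, y))%:E = (- (w x) ^+ 2)%:E)%E.
  move=> Kux; have Kl : mu.-integrable setT (EFin \o (fun y => K x y * (u y - u x))).
    apply: (eq_integrable measurableT _ _ _ (integrableD measurableT Kux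
      (integrableZl measurableT (- u x) (integrable_kernel hK x)))).
    by move=> y _ /=; rewrite -EFinD; congr EFin; ring.
  transitivity (\int[mu]_y ((- w x)%:E * (K x y * (u y - u x))%:E))%E.
    by apply: eq_integral => y _; rewrite -EFinM /P /=; congr EFin; ring.
  rewrite integralZl// -wE.
  have -> : (\int[mu]_y (K x y * (u y - u x))%:E = (gen mu K u x)%:E)%E.
    by rewrite /gen /Rintegral fineK// (integrable_fin_num measurableT Kl).
  by rewrite -EFinM; congr EFin; ring.
have PE : (\int[(mu \x mu)]_z (P z)%:E = - L2 w)%E.
  rewrite -(integral12_prod_meas1 PI) -integral_ge0N; last first.
    by move=> x _; rewrite lee_fin.
  apply: ae_eq_integral => //.
  - exact: (measurable_fubini_F PI).
  - by apply/measurable_EFinP; apply: measurable_funN.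
  - by apply: filterS Ku => x Kx _; rewrite /fubini_F /= genE.
have QE : (\int[(mu \x mu)]_z (Q z)%:E = - L2 w)%E.
  by rewrite -(integral21_prod_meas1 QI) -PE -(integral12_prod_meas1 PI).
have [a aE] : exists a, L2 w = a%:E.
  exists (fine (L2 w)); apply: ge0_fineE => //.
  by apply: integral_ge0 => x _; rewrite lee_fin.
have a0 : 0 <= a by rewrite -lee_fin -aE; apply: integral_ge0 => x _; rewrite lee_fin.
have [b bE] : exists b, form mu K u = b%:E.
  by exists (fine (form mu K u)); apply: ge0_fineE; [exact: form_ge0|exact: fin].
have [c cE] : exists c, form mu K w = c%:E.
  by exists (fine (form mu K w)); apply: ge0_fineE; [exact: form_ge0|exact: fin].
have ca : c <= 4 * M * a by have := form_le mw; rewrite -/(L2 w) aE cE -EFinM lee_fin.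
have -> : form mu K (fun x => u x + h * w x) =
  (\int[mu \x mu]_z ((K z.1 z.2 * (u z.1 - u z.2) ^+ 2)%:E +
     ((2 * h)%:E * ((P z)%:E + (Q z)%:E) +
     (h ^+ 2)%:E * (K z.1 z.2 * (w z.1 - w z.2) ^+ 2)%:E)))%E.
  rewrite form_prod//; apply: eq_integral => z _.
  rewrite -!EFinD; congr EFin; rewrite /Q /P /= (sk_sym hK z.2).
  by ring.
have uI := fint u mu_ u2; have wI := fint w mw w2.
have PQI := integrableD measurableT PI QI.
rewrite integralD//; last first.
  exact: (integrableD measurableT (integrableZl measurableT _ PQI) (integrableZl measurableT _ wI)).
rewrite integralD//; [|exact: integrableZl|exact: integrableZl].
rewrite !integralZl// integralD// PE QE aE -!form_prod// bE cE.
rewrite -!EFinN -!EFinD lee_fin -subr_ge0.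
have -> : b - (b + (2 * h * (- a + - a) + h ^+ 2 * c)) =
  h * (4 * a * (1 - h * M) + h * (4 * M * a - c)) by ring.
rewrite mulr_ge0 ?(ltW h0)// addr_ge0//; last by rewrite mulr_ge0 ?(ltW h0)// subr_ge0.
rewrite mulr_ge0 ?mulr_ge0// subr_ge0 (le_trans hM)//.
by rewrite invf_le1// ler1n.
Qed.

End FormBounds.

(** * Decay from a Nash inequality *)

(* For n optimal this is the usual multiplicative Nash inequality in dimension
   one for |u|^(p/2); the kernel has no small-scale smoothing, hence n >= 1. *)
Definition nash_inequality d (T : measurableType d) (R : realType)
    (mu : {sigma_finite_measure set T -> \bar R}) (K : T -> T -> R) (p C : R) :=
  forall (u : T -> R) (A : R) (n : nat), measurable_fun setT u -> 0 <= A -> (0 < n)%N ->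
    (\int[mu]_x `|u x|%:E <= A%:E)%E ->
    (\int[mu]_x (`|u x| `^ p)%:E <=
      (C * n%:R ^+ 2)%:E * form mu K (fun x => (`|u x| `^ (p / 2))%R)
      + (C * A `^ p * n%:R `^ (1 - p))%:E)%E.

Lemma integral_powR2 d (T : measurableType d) (R : realType)
    (mu : {measure set T -> \bar R}) (f : T -> R) :
  (\int[mu]_x (`|f x| `^ 2)%:E = \int[mu]_x (f x ^+ 2)%:E)%E.
Proof.
by apply: eq_integral => x _; rewrite powR_mulrn// real_normK ?num_real.
Qed.

(** Once f is at least twice the L^1 term b of Nash's inequality, b is absorbed in f / 2 and the
    form controls f. This is the source of the factor 2 in the threshold of [Lp_decay]. *)
Lemma decay_from_dissipation (R : realType) (c C n2 f b : R) (E : \bar R) : 0 < c -> 0 < C ->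
  0 < n2 -> 0 <= f -> (0 <= E)%E -> 2 * b <= f -> (f%:E <= (C * n2)%:E * E + b%:E)%E ->
  ((c * f / (4 * C * n2))%:E <= (c / 2)%:E * E)%E.
Proof.
move=> c0 C0 n0 f0; case: E => [E| |//] E0 bf fE; last first.
  by rewrite gt0_muley ?leey// lte_fin divr_gt0.
rewrite -EFinM lee_fin ler_pdivrMr ?mulr_gt0//.
rewrite -EFinM -EFinD lee_fin in fE.
have -> : c / 2 * E * (4 * C * n2) = c * (2 * (C * n2 * E)) by field.
rewrite ler_pM2l//; move: (C * n2 * E) fE => X; lra.
Qed.

Section LpDecay.
Context d (T : measurableType d) (R : realType).
Variables (mu : {sigma_finite_measure set T -> \bar R}) (K : T -> T -> R) (M : R).
Hypothesis hK : symmetric_kernel mu K M.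

Lemma small_step : exists2 h0 : R, 0 < h0 & h0 * M <= 2^-1.
Proof.
have M0 := sk_bound_ge0 hK; exists ((2 * (M + 1))^-1).
  by rewrite invr_gt0 mulr_gt0// ltr_wpDl.
rewrite invfM -mulrA ler_piMr ?invr_ge0// mulrC ler_pdivrMr ?ltr_wpDl//.
by rewrite mul1r lerDl.
Qed.

Theorem Lp_decay (p C : R) : 1 < p -> 0 < C -> nash_inequality mu K p C ->
  exists2 K0, 0 <= K0 & forall (U : R -> T -> R) (A : R), 0 <= A ->
    evolution mu K p U -> (\int[mu]_x `|U 0 x|%:E <= A%:E)%E ->
    forall t : R, 0 <= t -> (\int[mu]_x (`|U t x| `^ p)%:E <=
      (K0 * (A `^ p + fine (\int[mu]_x (`|U 0 x| `^ p)%:E))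
        * (1 + t) `^ (- ((p - 1) / 2)))%:E)%E.
Proof.
move=> p1 C0 nash; have [h0 h00 hM] := small_step; have p1' := ltW p1.
pose c := Num.min 1 (p - 1).
have c0 : 0 < c by rewrite lt_min ltr01 subr_gt0.
have b0 : 0 <= (p - 1) / 2 by rewrite divr_ge0 ?subr_ge0.
have k0 : 0 < c / (4 * C) by rewrite divr_gt0// mulr_gt0.
have [K0 K00 hK0] := decay_iteration b0 k0.
exists (K0 * (1 + 2 * C)); first by rewrite mulr_ge0// addr_ge0// mulr_ge0// ltW.
move=> U A A0 evol UA t t0.
pose F t := fine (\int[mu]_x (`|U t x| `^ p)%:E)%E.
have Ap0 : 0 <= A `^ p by exact: powR_ge0.
have F0 r : 0 <= F r.
  by apply: fine_ge0; apply: integral_ge0 => x _; rewrite lee_fin powR_ge0.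
have FE r : 0 <= r -> (\int[mu]_x (`|U r x| `^ p)%:E = (F r)%:E)%E.
  move=> r0; apply: ge0_fineE; last exact: (evolution_fin evol).
  by apply: integral_ge0 => x _; rewrite lee_fin powR_ge0.
have Fmon r s : 0 <= r <= s -> F s <= F r.
  move=> /andP[r0 rs]; rewrite -lee_fin -!FE//; last exact: le_trans rs.
  exact: (entr_nonincreasing hK p1' h00 hM evol (entropy_powR p1') r0 rs).
have Fdec r s (n : nat) : 0 <= r < s -> (0 < n)%N ->
    2 * (C * A `^ p) * n%:R `^ (- (2 * ((p - 1) / 2))) < F s ->
    F s * (1 + c / (4 * C) * (s - r) / n%:R ^+ 2) <= F r.
  move=> /andP[r0 rs] n0; have -> : - (2 * ((p - 1) / 2)) = 1 - p by field.
  set b := n%:R `^ _; rewrite -mulrA => Fb.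
  have nn : 0 < n%:R ^+ 2 :> R by rewrite exprn_gt0// ltr0n.
  have := entr_decay hK p1' h00 hM evol (entropy_powR p1') r0 (ltW rs).
  move=> /(_ (c * F s / (4 * C * n%:R ^+ 2))); rewrite -/(F s) -/(F r) => H.
  have {}H : F s <= F r - c * F s / (4 * C * n%:R ^+ 2) * (s - r).
    (* F is nonincreasing, so F q still exceeds the threshold and the dissipation rate at q is at
       least the one computed from F s. *)
    apply: H => q /andP[rq qs]; have q0 : 0 <= q := le_trans r0 (ltW rq).
    have sq : F s <= F q by apply: Fmon; rewrite q0 ltW.
    apply: (@le_trans _ _ (c * F q / (4 * C * n%:R ^+ 2))%:E).
      rewrite lee_fin ler_wpM2r ?invr_ge0 ?mulr_ge0 ?(ltW C0) ?(ltW nn)//.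
      by rewrite ler_wpM2l// ltW.
    apply: (decay_from_dissipation c0 C0 nn (F0 q)).
    - exact: (form_ge0 hK).
    - exact: (le_trans (ltW Fb)).
    - rewrite -FE//; apply: nash => //; first exact: (evolution_measurable evol).
      apply: le_trans UA; exact: (L1_nonincreasing hK p1' h00 hM evol).
  rewrite -[X in _ <= X](subrK (c * F s / (4 * C * n%:R ^+ 2) * (s - r))).
  rewrite (mulrDr (F s)) mulr1 lerD//.
  by rewrite le_eqVlt; apply/orP; left; apply/eqP; field; rewrite !gt_eqF ?ltr0n.
have B0 : 0 <= 2 * (C * A `^ p) by rewrite !mulr_ge0// ltW.
have := hK0 F _ B0 (fun r _ => F0 r) Fmon Fdec t t0.
rewrite FE// lee_fin -/(F 0) => /le_trans; apply.
rewrite ler_wpM2r ?powR_ge0// -mulrA ler_wpM2l//.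
rewrite -subr_ge0.
have -> : (1 + 2 * C) * (A `^ p + F 0) - (2 * (C * A `^ p) + F 0) =
  A `^ p + 2 * C * F 0 by ring.
by rewrite addr_ge0// mulr_ge0// mulr_ge0// ltW.
Qed.

Let M_ge0 := sk_bound_ge0 hK.

Section Energy.
Variable U : R -> T -> R.
Hypothesis evol : evolution mu K 2 U.
Let mU := evolution_measurable evol.
Let pU := evolution_fin evol.
Let p1 : 1 <= 2 :> R. Proof. by rewrite ler1n. Qed.
Let G t := fine (form mu K (U t)).

Lemma form_fin (u : T -> R) : measurable_fun setT u ->
  (\int[mu]_x (`|u x| `^ 2)%:E < +oo)%E -> (form mu K u < +oo)%E.
Proof.
move=> mu_; rewrite integral_powR2 => u2; apply: (le_lt_trans (form_le hK mu_)).
by rewrite lte_mul_pinfty// lee_fin mulr_ge0.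
Qed.

Let GE t : 0 <= t -> form mu K (U t) = (G t)%:E.
Proof.
move=> t0; apply: ge0_fineE; first exact: (form_ge0 hK).
exact: form_fin (mU t0) (pU t0).
Qed.

Lemma energy_continuous t : 0 <= t -> forall e, 0 < e -> exists2 d0, 0 < d0 &
  forall r : R, 0 <= r -> `|r - t| < d0 -> `|G r - G t| < e.
Proof.
apply: (functional_continuous (mu := mu) p1 evol) => [u|u mu_ pu|e e0].
- exact: (form_ge0 hK).
- exact: form_fin.
pose e1 := e / (4 * M + 1).
have M40 : 0 <= 4 * M by rewrite mulr_ge0.
have e10 : 0 < e1 by rewrite divr_gt0// ltr_wpDl.
have e1M : e1 * (4 * M) <= e.
  by rewrite /e1 mulrAC ler_pdivrMr ?ltr_wpDl// ler_pM2l// lerDl.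
have i0 : 0 <= 1 + e1^-1 by rewrite addr_ge0// invr_ge0 ltW.
exists ((1 + e1^-1) * (4 * M)); first by rewrite mulr_ge0.
move=> u v mu_ mv; apply: (le_trans (formD hK e10 mu_ mv)).
have L0 : (0 <= \int[mu]_x (u x ^+ 2)%:E)%E.
  by apply: integral_ge0 => x _; rewrite lee_fin sqr_ge0.
rewrite /entr !integral_powR2; apply: leeD.
  rewrite EFinD ge0_muleDl ?lee_fin ?(ltW e10)// mul1e leeD2l//.
  apply: (@le_trans _ _ (e1%:E * ((4 * M)%:E * \int[mu]_x (u x ^+ 2)%:E))%E).
    by apply: lee_wpmul2l; [rewrite lee_fin ltW|exact: form_le].
  by rewrite muleA -EFinM; apply: lee_wpmul2r; rewrite ?lee_fin.
rewrite EFinM -muleA; apply: lee_wpmul2l; last exact: form_le.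
by rewrite lee_fin.
Qed.

(** U (t + h) = step h (U t) + h r with r small in L^2. The step does not increase the form; [formD]
    with parameter h e1 costs h e1 G t on it, and multiplies the form of h r, which is of order h^2,
    by 1 + 1 / (h e1). Both errors are small multiples of h. *)
Lemma energy_nonincreasing (a b : R) : 0 <= a -> a <= b -> G b <= G a.
Proof.
move=> a0 ab; rewrite -[X in _ <= X]subr0 -(mul0r (b - a)); apply: dini_le => //.
  move=> t /andP[at_ tb] e e0.
  have [d' d0 hd] := energy_continuous (le_trans a0 at_) e0.
  by exists d' => // r /andP[ar _]; apply: hd; exact: le_trans ar.
move=> t /andP[at_ tb] e e0; have t0 : 0 < t := le_lt_trans a0 at_.
have t0' := ltW t0; have mUt := mU t0'; have [h0 h00 hM] := small_step.
have Gt0 : 0 <= G t by apply: fine_ge0; exact: (form_ge0 hK).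
have Ku : kernel_integrable mu K (U t) := kernel_integrable_powR hK p1 mUt (pU t0').
have U2 : (\int[mu]_x (U t x ^+ 2)%:E < +oo)%E by rewrite -integral_powR2; exact: pU.
have mg : measurable_fun setT (gen mu K (U t)) := measurable_gen hK measurableT mUt.
(* The generator is (step h0 (U t) - U t) / h0, and the averaging step does not increase the L^2
   norm. *)
have g2 : (\int[mu]_x (gen mu K (U t) x ^+ 2)%:E < +oo)%E.
  have ms := measurable_step hK h0 mUt.
  rewrite -integral_powR2.
  have -> : gen mu K (U t) = (fun x => h0^-1 * (step mu K h0 (U t) x + (-1) * U t x)).
    by apply/funext => x; rewrite /step; field; rewrite gt_eqF.
  have mu1 : measurable_fun setT (fun x => -1 * U t x) by mf.
  rewrite -/(entr mu (fun a => (`|a| `^ 2)%R) _) (pint_scale _ p1); last by mf.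
  rewrite lte_mul_pinfty// ?lee_fin ?powR_ge0//.
  have [C C0 hC] := entrD mu p1 (entropy_powR p1) (@ltr01 R).
  apply: (le_lt_trans (hC _ _ ms mu1)).
  have sfin : (entr mu (fun a => (`|a| `^ 2)%R) (step mu K h0 (U t)) < +oo)%E.
    have := entr_step hK p1 h00 hM (entropy_powR p1) mUt (pU t0') => h.
    apply: le_lt_trans (pU t0'); apply: le_trans h; rewrite leeDl// mule_ge0//.
      rewrite lee_fin divr_ge0// mulr_ge0 ?(ltW h00)//.
    exact: (form_ge0 hK).
  apply: lte_add_pinfty; first by apply: lte_add_pinfty => //; rewrite mul1e.
  rewrite (pint_scale _ p1)//; apply: lte_mul_pinfty; rewrite ?lee_fin//.
  have pUt := pU t0'; apply: lte_mul_pinfty; [|by []|exact: pUt].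
  by rewrite lee_fin; exact: powR_ge0.
pose e1 := e / 2 / (G t + 1).
have e10 : 0 < e1 by rewrite !divr_gt0// ltr_wpDl.
have e1G : e1 * G t <= e / 2.
  by rewrite /e1 mulrAC ler_pdivrMr ?ltr_wpDl// ler_pM2l ?divr_gt0// lerDl.
have M40 : 0 <= 4 * M by rewrite mulr_ge0.
have i0 : 0 <= 1 + e1^-1 by rewrite addr_ge0// invr_ge0 ltW.
pose D := (1 + e1^-1) * (4 * M); have D0 : 0 <= D by rewrite mulr_ge0.
pose e2 := e / 2 / (D + 1); have e20 : 0 < e2 by rewrite !divr_gt0// ltr_wpDl.
have De2 : D * e2 <= e / 2.
  by rewrite /e2 mulrCA ler_piMr ?divr_ge0 ?(ltW e0)// ler_pdivrMr ?ltr_wpDl// mul1r lerDl.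
have [d' d0 hd] := evolution_derivative evol t0 e20.
(* h < 1 bounds the factor h + 1 / e1 left in the error term; h < h0 makes h an admissible averaging
   step. *)
exists (Num.min d' (Num.min 1 h0)); first by rewrite !lt_min d0 ltr01.
move=> h /andP[hp]; rewrite !lt_min => /and3P[hd' h1 hh0].
have {}hd := hd h; rewrite hp hd' in hd; have {}hd := hd isT.
have th0 : 0 <= t + h by rewrite addr_ge0// ltW.
set r := (fun x => h^-1 * (U (t + h) x - U t x) - gen mu K (U t) x) in hd.
have mr : measurable_fun setT r.
  by have := mU th0 => *; apply: measurable_funB => //; mf.
have hhM : h * M <= 2^-1 by apply: le_trans hM; rewrite ler_wpM2r// ltW.
have ms : measurable_fun setT (step mu K h (U t)) := measurable_step hK h mUt.
have mhr : measurable_fun setT (fun x => h * r x) by mf.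
have Ueq : U (t + h) = (fun x => step mu K h (U t) x + h * r x).
  by apply/funext => x; rewrite /r /step; field; rewrite gt_eqF.
have he : 0 < h * e1 by rewrite mulr_gt0.
have i1 : 0 <= 1 + (h * e1)^-1 by rewrite addr_ge0// invr_ge0 ltW.
have H1 : (form mu K (step mu K h (U t)) <= (G t)%:E)%E.
  by rewrite -(GE t0'); apply: (form_step_le hK hp hhM mUt U2 Ku g2).
have H2 : (form mu K (fun x => h * r x)%R <= (4 * M * (h ^+ 2 * e2))%:E)%E.
  apply: (le_trans (form_le hK mhr)); rewrite [X in (_ <= X)%E]EFinM.
  apply: lee_wpmul2l; first by rewrite lee_fin.
  have -> : (\int[mu]_x ((h * r x) ^+ 2)%:E = \int[mu]_x (h ^+ 2 * r x ^+ 2)%:E)%E.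
    by apply: eq_integral => x _; rewrite exprMn.
  rewrite ge0_intZ ?sqr_ge0//; [|by mf|by move=> x; exact: sqr_ge0].
  rewrite [X in (_ <= X)%E]EFinM; apply: lee_wpmul2l.
    by rewrite lee_fin sqr_ge0.
  by rewrite -integral_powR2.
rewrite mul0r subr0 -lee_fin -GE// Ueq.
apply: (le_trans (formD hK he ms mhr)).
apply: (@le_trans _ _ ((1 + h * e1)%:E * (G t)%:E
   + (1 + (h * e1)^-1)%:E * (4 * M * (h ^+ 2 * e2))%:E)%E).
  apply: leeD; apply: lee_wpmul2l => //; rewrite lee_fin//.
  by rewrite addr_ge0// ltW.
rewrite -!EFinM -!EFinD lee_fin.
have -> : (1 + (h * e1)^-1) * (4 * M * (h ^+ 2 * e2)) = h * ((h + e1^-1) * (4 * M) * e2).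
  by field; rewrite !gt_eqF.
have -> : (1 + h * e1) * G t = G t + h * (e1 * G t) by ring.
rewrite -addrA lerD2l -mulrDr mulrC ler_pM2r//.
rewrite [X in _ <= X](splitr e) lerD//; apply: le_trans De2.
by rewrite ler_wpM2r ?(ltW e20)// ler_wpM2r// lerD2r ltW.
Qed.

Lemma energy_le_L2 t : 0 < t ->
  G t * t <= 4 * fine (\int[mu]_x (`|U (t / 2) x| `^ 2)%:E).
Proof.
move=> t0; have [h0 h00 hM] := small_step.
have a0 : 0 <= t / 2 by rewrite divr_ge0// ltW.
have ab : t / 2 <= t by rewrite ler_pdivrMr// mulr2n mulrDr mulr1 lerDl ltW.
have := entr_decay hK p1 h00 hM evol (entropy_sqr R) a0 ab.
(* On [t/2, t] the form is at least [G t] and is dissipated with coefficient 1/2; over a time t/2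
   this removes G t * t / 4. *)
move=> /(_ (2^-1 * G t)); rewrite /entr.
set F1 := fine _; set F2 := fine _ => H.
have F10 : 0 <= F1.
  by apply: fine_ge0; apply: integral_ge0 => x _; rewrite lee_fin powR_ge0.
have {}H : F1 <= F2 - 2^-1 * G t * (t - t / 2).
  apply: H => s /andP[ts st]; have s0 : 0 <= s := le_trans a0 (ltW ts).
  rewrite EFinM div1r; apply: lee_wpmul2l; first by rewrite lee_fin invr_ge0.
  have -> : id \o U s = U s by [].
  by rewrite GE// lee_fin; apply: energy_nonincreasing => //; exact: ltW.
have E : 2^-1 * G t * (t - t / 2) = G t * t / 4 by field.
rewrite E in H; move: (G t * t) H => X H; lra.
Qed.

End Energy.

Theorem energy_decay (C : R) : 0 < C -> nash_inequality mu K 2 C ->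
  exists2 K0, 0 <= K0 & forall (U : R -> T -> R) (A : R), 0 <= A ->
    evolution mu K 2 U -> (\int[mu]_x `|U 0 x|%:E <= A%:E)%E ->
    forall t : R, 0 < t -> (form mu K (U t) <=
      (K0 * (A `^ 2 + fine (\int[mu]_x (`|U 0 x| `^ 2)%:E))
        * t `^ (- (3 / 2)))%:E)%E.
Proof.
move=> C0 nash; have p1 : 1 < 2 :> R by rewrite ltr1n.
have [K0 K00 hK0] := Lp_decay p1 C0 nash.
exists (4 * 2 `^ (2^-1) * K0); first by rewrite !mulr_ge0// powR_ge0.
move=> U A A0 evol UA t t0.
have th0 : 0 <= t / 2 by rewrite divr_ge0// ltW.
have := hK0 U A A0 evol UA _ th0.
have G0 : 0 <= fine (\int[mu]_x (`|U 0 x| `^ 2)%:E).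
  by apply: fine_ge0; apply: integral_ge0 => x _; rewrite lee_fin powR_ge0.
set B := A `^ 2 + _; have B0 : 0 <= B by rewrite addr_ge0// powR_ge0.
have FE : (\int[mu]_x (`|U (t / 2) x| `^ 2)%:E =
    (fine (\int[mu]_x (`|U (t / 2) x| `^ 2)%:E))%:E)%E.
  apply: ge0_fineE; last exact: (evolution_fin evol).
  by apply: integral_ge0 => x _; rewrite lee_fin powR_ge0.
have -> : (2 - 1) / 2 = 2^-1 :> R by field.
have : fine (form mu K (U t)) * t <= _ := energy_le_L2 evol t0.
rewrite FE lee_fin; set F := fine (integral _ _ _); set g := fine (form _ _ _) => gF FB.
have -> : form mu K (U t) = g%:E.
  apply: ge0_fineE; first exact: (form_ge0 hK).
  apply: form_fin; first exact: (evolution_measurable evol (ltW t0)).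
  exact: (evolution_fin evol (ltW t0)).
rewrite lee_fin -(ler_pM2r t0); apply: (le_trans gF).
have dec : (1 + t / 2) `^ (- 2^-1) <= 2 `^ (2^-1) * t `^ (- 2^-1).
  have -> : 2 `^ (2^-1) * t `^ (- 2^-1) = (t / 2) `^ (- 2^-1).
    rewrite powRM ?invr_ge0 ?(ltW t0)// mulrC -[2^-1 `^ _]/(_ `^ _).
    by rewrite -powR_inv1// -powRrM mulN1r opprK.
  rewrite !powRN lef_pV2 ?posrE ?powR_gt0 ?divr_gt0//; last first.
    by rewrite addr_gt0// divr_gt0.
  by rewrite ge0_ler_powR ?nnegrE ?invr_ge0 ?addr_ge0// lerDr.
have tt : t `^ (- (3 / 2)) * t = t `^ (- 2^-1).
  rewrite mulrC -[X in X * _](powRr1 (ltW t0)) -powRD; last by rewrite (gt_eqF t0) implybT.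
  by congr (_ `^ _); field.
rewrite -[X in _ <= X]mulrA tt.
have : F <= K0 * B * (2 `^ (2^-1) * t `^ (- 2^-1)).
  by apply: (le_trans FB); rewrite ler_wpM2l// mulr_ge0.
have -> : 4 * 2 `^ (2^-1) * K0 * B * t `^ (- 2^-1) =
  4 * (K0 * B * (2 `^ (2^-1) * t `^ (- 2^-1))) by ring.
by rewrite ler_pM2l.
Qed.

End LpDecay.

(** * Graph distance *)

Section GraphDistance.
Context (R : realType) (G : metric_graph R).
Hypothesis hG : graph_axioms G.
Implicit Types (e f : edge G) (x y z : gpoint G) (s t l : R).

Local Notation inG x := (x.2 \in edge_itv x.1).

Lemma edge_itvP e t : t \in edge_itv e <->
  0 <= t /\ (forall v l, term e = Some (v, l) -> t <= l).
Proof.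
rewrite /edge_itv; case: (term e) => [[v l]|].
  rewrite inE /= in_itv /=; split=> [/andP[t0 tl]|[t0 h]].
    by split=> // _ _ [_ <-].
  by rewrite t0 (h v).
rewrite inE /= in_itv /= andbT; split=> [t0|[]//].
by split.
Qed.

Lemma edge_itv0 e : (0 : R) \in edge_itv e.
Proof.
by apply/edge_itvP; split=> // v l /(length_gt0 hG)/ltW.
Qed.

Lemma edge_itv_term e v l : term e = Some (v, l) -> l \in edge_itv e.
Proof.
move=> h; apply/edge_itvP; split; first exact/ltW/(length_gt0 hG h).
by move=> w m; rewrite h => -[_ ->].
Qed.

Lemma at_vertex_in x v : at_vertex x v -> inG x.
Proof.
case: x => e s [/= [-> _]|/= /edge_itv_term//]; exact: edge_itv0.
Qed.

Lemma path_length_ge0 x y l : path_length x y l -> 0 <= l.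
Proof. by elim => // *; rewrite addr_ge0. Qed.

Lemma path_length_cat x y z l m :
  path_length x y l -> path_length y z m -> path_length x z (l + m).
Proof.
move=> xy; elim: xy m => {x y l} [x _ m|e s t y l se te _ IH m yz|x x' v y l xv xv' _ IH m yz].
- by rewrite add0r.
- by rewrite -addrA; apply: path_segment => //; exact: IH.
- by apply: path_vertex xv xv' _; exact: IH.
Qed.

Lemma path_length_segment e s t : s \in edge_itv e -> t \in edge_itv e ->
  path_length (e, s) (e, t) `|s - t|.
Proof.
by move=> se te; rewrite -[X in path_length _ _ X]addr0; apply: path_segment => //; exact: path_nil.
Qed.

Lemma path_length_vertex x y v : at_vertex x v -> at_vertex y v -> path_length x y 0.
Proof. by move=> xv yv; apply: (path_vertex xv yv); apply: path_nil; exact: at_vertex_in yv. Qed.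

Lemma path_length_sym x y l : path_length x y l -> path_length y x l.
Proof.
elim => {x y l} [x xG|e s t y l se te _ IH|x x' v y l xv xv' _ IH].
- exact: path_nil.
- by rewrite addrC distrC; apply: path_length_cat IH _; exact: path_length_segment.
- by rewrite -[l]addr0; apply: path_length_cat IH _; exact: path_length_vertex xv' xv.
Qed.

Lemma path_exists x y : inG x -> inG y -> exists l, path_length x y l.
Proof.
have to_orig e s : s \in edge_itv e -> exists l, path_length (e, s) (e, 0) l.
  by move=> se; eexists; apply: path_length_segment => //; exact: edge_itv0.
have vert v w : connect (@Defs.adjacent R G) v w ->
    forall x y, at_vertex x v -> at_vertex y w -> exists l, path_length x y l.
  move=> /connectP[p]; elim: p v => [v _ ->|u p IH v /= /andP[vu up] wE] x0 y0 xv yw.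
    by exists 0; exact: path_length_vertex xv yw.
  move: vu => /existsP[e]; rewrite /ends_at.
  case te : (term e) => [[b l]|]; last by rewrite !andbF.
  have ea : at_vertex (e, 0) (orig e) by left.
  have eb : at_vertex (e, l) b by right.
  have seg := path_length_segment (edge_itv0 e) (edge_itv_term te).
  case/orP => /andP[/eqP oe /eqP bE].
    have [m hm] := IH u up wE (e, l) y0 ltac:(by rewrite -bE) yw.
    exists (0 + (`|0 - l| + m)); apply: path_length_cat (path_length_cat seg hm).
    by apply: path_length_vertex xv _; rewrite -oe.
  have [m hm] := IH u up wE (e, 0) y0 ltac:(by rewrite -oe) yw.
  exists (0 + (`|0 - l| + m)).
  apply: path_length_cat (path_length_cat (path_length_sym seg) hm).
  by apply: path_length_vertex xv _; rewrite -bE.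
case: x y => [e s] [f t] /= se tf.
have [l hl] := to_orig _ _ se; have [m hm] := to_orig _ _ tf.
have [k hk] := vert _ _ (graph_connected hG (orig e) (orig f)) (e, 0) (f, 0)
  ltac:(by left) ltac:(by left).
exists (l + (k + m)); apply: path_length_cat hl (path_length_cat hk _).
exact: path_length_sym.
Qed.

Lemma gdist_le_path x y l : path_length x y l -> gdist x y <= l.
Proof.
by move=> xy; apply: ge_inf => //; exists 0 => m; exact: path_length_ge0.
Qed.

Lemma gdist_ge x y c : inG x -> inG y ->
  (forall l, path_length x y l -> c <= l) -> c <= gdist x y.
Proof.
by move=> xG yG h; apply: lb_le_inf => //; exact: path_exists.
Qed.

Lemma gdist_ge0 x y : inG x -> inG y -> 0 <= gdist x y.
Proof. by move=> xG yG; apply: gdist_ge => // l; exact: path_length_ge0. Qed.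

Lemma gdist_sym x y : gdist x y = gdist y x.
Proof.
by rewrite /gdist; congr inf; apply/seteqP; split=> l /=; exact: path_length_sym.
Qed.

Lemma gdist_triangle x y z : inG x -> inG y -> inG z ->
  gdist x z <= gdist x y + gdist y z.
Proof.
move=> xG yG zG; rewrite -lerBlDr; apply: gdist_ge => // l xy.
rewrite lerBlDl -lerBlDr; apply: gdist_ge => // m yz.
by rewrite lerBlDl; apply: gdist_le_path; exact: path_length_cat xy yz.
Qed.

Lemma gdist_segment e s t : s \in edge_itv e -> t \in edge_itv e ->
  gdist (e, s) (e, t) <= `|s - t|.
Proof. by move=> se te; apply: gdist_le_path; exact: path_length_segment. Qed.

Lemma gdist_vertex x y v : at_vertex x v -> at_vertex y v -> gdist x y <= 0.
Proof. by move=> xv yv; apply: gdist_le_path; exact: path_length_vertex xv yv. Qed.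

(* Distance from coordinate [t] of [f] to the nearest end of [f]; any path
   that reaches [(f, t)] from another edge is at least that long. *)
Definition end_dist f t : R :=
  if term f is Some (_, l) then Num.min t (l - t) else t.

(** The second alternative can fail to propagate only at a vertex switch. If the path after the
    switch stays in f, the switch lands on an end of f, and the remaining length is already at least
    [end_dist f t]. *)
Lemma path_length_end_dist x f t l : path_length x (f, t) l ->
  end_dist f t <= l \/ (x.1 = f /\ `|x.2 - t| <= l).
Proof.
move=> p; have : forall y, path_length x y l -> y = (f, t) ->
  end_dist f t <= l \/ (x.1 = f /\ `|x.2 - t| <= l); last by apply; first exact: p.
move=> y; elim => {x y l p} [x xG ->|e s s' y l se te p IH yE|x x' v y l xv xv' p IH yE] /=.
- by right; rewrite subrr normr0.
- have [h|/= [<- h]] := IH yE; first by left; rewrite (le_trans h)// lerDr.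
  right; split=> //; rewrite -(subrK s' s) -addrA (le_trans (ler_normD _ _))//.
  by rewrite subrK lerD2l.
- have [h|[x'f h]] := IH yE; first by left.
  left; apply: le_trans h; case: x' x'f xv' {p IH} => f' s' /= -> [/= [-> _]|/= tE].
    rewrite sub0r normrN; apply: le_trans (ler_norm _); rewrite /end_dist.
    by case: (term f) => [[w m]|//]; rewrite ge_min lexx.
  by rewrite /end_dist tE; apply: le_trans (ler_norm _); rewrite ge_min lexx orbT.
Qed.

(** Projection of the real line onto the edge interval. It is 1-Lipschitz, so it extends the
    distance to all real coordinates while keeping it Lipschitz, hence measurable. *)
Definition clamp e s : R :=
  if term e is Some (_, l) then Num.max 0 (Num.min s l) else Num.max 0 s.

Lemma clamp_in e s : clamp e s \in edge_itv e.
Proof.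
apply/edge_itvP; rewrite /clamp.
case te : (term e) => [[v l]|]; split; rewrite ?le_max ?lexx// => w m [_ <-].
by rewrite ge_max (ltW (length_gt0 hG te)) ge_min lexx orbT.
Qed.

Lemma clamp_id e s : s \in edge_itv e -> clamp e s = s.
Proof.
move=> /edge_itvP[s0 sl]; rewrite /clamp.
case te : (term e) => [[v l]|]; last by rewrite max_r.
by rewrite (min_l (sl v l te)) max_r.
Qed.

Lemma max0_lip (a b : R) : `|Num.max 0 a - Num.max 0 b| <= `|a - b|.
Proof.
have := ler_norm (a - b); have := ler_norm (b - a); rewrite (distrC b).
move: (`|a - b|) => n; rewrite ler_norml.
by have [a0|a0] := leP 0 a; have [b0|b0] := leP 0 b => h1 h2; apply/andP; split; lra.
Qed.

Lemma clamp_lip e s t : `|clamp e s - clamp e t| <= `|s - t|.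
Proof.
rewrite /clamp; case: (term e) => [[v l]|]; last exact: max0_lip.
apply: (le_trans (max0_lip _ _)).
have minE (a : R) : Num.min a l = l - Num.max 0 (l - a).
  have [al|al] := leP a l; have [h|h] := leP 0 (l - a); lra.
rewrite !minE opprB addrC addrA subrK.
apply: (le_trans (max0_lip _ _)).
by rewrite opprB addrC addrA subrK.
Qed.

Definition cpoint x : gpoint G := (x.1, clamp x.1 x.2).

Lemma cpoint_in x : inG (cpoint x). Proof. exact: clamp_in. Qed.

Lemma gdist_lip e f s s' t t' :
  gdist (cpoint (e, s)) (cpoint (f, t)) <=
    gdist (cpoint (e, s')) (cpoint (f, t')) + `|s - s'| + `|t - t'|.
Proof.
have i := cpoint_in.
have h1 := gdist_triangle (i (e, s)) (i (e, s')) (i (f, t)).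
have h2 := gdist_triangle (i (e, s')) (i (f, t')) (i (f, t)).
have h3 : gdist (cpoint (e, s)) (cpoint (e, s')) <= `|s - s'|.
  exact: (le_trans (gdist_segment (clamp_in _ _) (clamp_in _ _)) (clamp_lip _ _ _)).
have h4 : gdist (cpoint (f, t')) (cpoint (f, t)) <= `|t - t'|.
  rewrite distrC.
  exact: (le_trans (gdist_segment (clamp_in _ _) (clamp_in _ _)) (clamp_lip _ _ _)).
apply: (le_trans h1); apply: (le_trans (lerD h3 h2)).
by rewrite addrC -!addrA lerD2l addrC lerD2l.
Qed.

End GraphDistance.

(** A sublevel set is a countable union of squares with rational centre and radius, on which the
    Lipschitz bound keeps D below the level; squares are measurable for the product
    sigma-algebra. *)
Lemma measurable_lipschitz2 (R : realType) (D : R * R -> R) :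
  (forall s s' t t', D (s, t) <= D (s', t') + `|s - s'| + `|t - t'|) ->
  measurable_fun setT D.
Proof.
move=> lip.
apply: (measurability _ (RGenInftyO.measurableE R)) => //.
move=> _ [_ [c ->] <-]; rewrite setTI.
have -> : D @^-1` `]-oo, c[%classic = \bigcup_(q : rat * rat * rat)
   [set z | `|z.1 - ratr q.1.1| < ratr q.2 /\ `|z.2 - ratr q.1.2| < ratr q.2 /\
            D (ratr q.1.1, ratr q.1.2) + 2 * ratr q.2 < c].
  apply/seteqP; split=> [[s t] /=|[s t] [q _] [/= h1 [h2 h3]]]; rewrite in_itv/=.
    move=> Dc; have r0 : 0 < (c - D (s, t)) / 4 by rewrite divr_gt0// subr_gt0.
    have [r] := rat_in_itvoo r0; rewrite in_itv/= => /andP[{}r0 rD].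
    have rat_near (x : R) : exists q : rat, `|x - ratr q| < ratr r.
      have : x < x + ratr r by rewrite ltrDl.
      move=> /rat_in_itvoo[q]; rewrite in_itv/= => /andP[xq qx].
      by exists q; rewrite ltr0_norm ?subr_lt0// opprB ltrBlDl.
    have [a sa] := rat_near s; have [b tb] := rat_near t.
    exists (a, b, r) => //=; split=> //; split=> //.
    have := lip (ratr a) s (ratr b) t; rewrite !(distrC (ratr _)).
    by move: sa tb rD; lra.
  by apply: (le_lt_trans (lip s (ratr q.1.1) t (ratr q.1.2))); lra.
apply: countable_bigcupT_measurable; first exact: countableP.
move=> q; have ms (x r : R) : measurable [set y : R | `|y - x| < r].
  rewrite [X in measurable X](_ : _ = ball x r); first exact: measurable_ball.
  by apply/seteqP; split=> y /=; rewrite /ball/= distrC.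
have [h|h] := pselect (D (ratr q.1.1, ratr q.1.2) + 2 * ratr q.2 < c); last first.
  by rewrite [X in measurable X](_ : _ = set0)//; apply/seteqP; split=> // z [_ []].
rewrite [X in measurable X](_ : _ = [set y : R | `|y - ratr q.1.1| < ratr q.2] `*`
    [set y : R | `|y - ratr q.1.2| < ratr q.2]); first exact: measurableX.
by apply/seteqP; split=> z /= [h1]; [case|].
Qed.

(** * The graph as a measure space *)

Lemma integral_mrestr d (T : measurableType d) (R : realType)
    (mu : {measure set T -> \bar R}) (A D : set T) (mA : measurable A) (g : T -> \bar R) :
  measurable D -> measurable_fun D g -> (forall x, 0 <= g x)%E ->
  (\int[mrestr mu mA]_(x in D) g x = \int[mu]_(x in A `&` D) g x)%E.
Proof.
move=> mD mg g0; have A0 : mrestr mu mA (~` A) = 0%E by rewrite /mrestr setICl measure0.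
rewrite (ge0_negligible_integral (measurableC mA) mD mg (fun x _ => g0 x) A0).
rewrite setDE setCK setIC; apply: eq_measure_integral => B mB BA /=.
by rewrite /mrestr setIidl// => x /BA[].
Qed.

(* The base edge [e0] only serves to make the type pointed. *)
Definition gspace (R : realType) (G : metric_graph R) (e0 : edge G) : Type :=
  (edge G * R)%type.

Section GraphSpace.
Context (R : realType) (G : metric_graph R) (e0 : edge G).
Local Notation T := (gspace e0).

HB.instance Definition _ := Choice.copy T (edge G * R)%type.
HB.instance Definition _ := isPointed.Build T (e0, 0).

(** Sigma-algebra of the disjoint union of copies of the real line, one for each edge. *)
Definition gmeasurable : set (set T) :=
  [set A | forall e, measurable [set s : R | A (e, s)]].

Let gmeasurable0 : gmeasurable set0.
Proof. by move=> e; exact: measurable0. Qed.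

Let gmeasurableC A : gmeasurable A -> gmeasurable (~` A).
Proof. by move=> mA e; exact: (measurableC (mA e)). Qed.

Let gmeasurable_bigcup (F : (set T)^nat) :
  (forall i, gmeasurable (F i)) -> gmeasurable (\bigcup_i F i).
Proof.
move=> mF e; rewrite [X in measurable X](_ : _ = \bigcup_i [set s | F i (e, s)]).
  by apply: bigcupT_measurable => i; exact: mF.
by apply/seteqP; split=> s [i _ Fi]; exists i.
Qed.

HB.instance Definition _ := @isMeasurable.Build default_measure_display T
  gmeasurable gmeasurable0 gmeasurableC gmeasurable_bigcup.

Lemma gmeasurable_funP d (Y : measurableType d) (g : T -> Y) :
  measurable_fun setT g <-> forall e, measurable_fun setT (fun s : R => g (e, s)).
Proof.
split=> [mg e _ B mB|mg _ B mB]; first exact: (mg measurableT B mB e).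
exact: (fun e => mg e measurableT B mB).
Qed.

(** The product sigma-algebra on [T * T] is not given by sections over pairs of edges, so the
    preimage is rebuilt as a union over these pairs of a rectangle met with a preimage under the
    coordinate map. *)
Lemma gmeasurable_fun2 d (Y : measurableType d) (g : T * T -> Y) :
  (forall e f, measurable_fun setT (fun z : R * R => g ((e, z.1), (f, z.2)))) ->
  measurable_fun setT g.
Proof.
move=> mg _ B mB; rewrite setTI.
have m2 : measurable_fun setT (fun x : T => x.2).
  by apply/gmeasurable_funP => e; exact: measurable_id.
have mpi : measurable_fun setT (fun z : T * T => (z.1.2, z.2.2)).
  by apply: measurable_fun_pair; [exact: (measurableT_comp m2 measurable_fst)|
                                  exact: (measurableT_comp m2 measurable_snd)].
have me e : measurable [set x : T | x.1 = e].
  move=> f; have [->|fe] := eqVneq f e.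
    by rewrite [X in measurable X](_ : _ = setT)//; apply/seteqP; split.
  rewrite [X in measurable X](_ : _ = set0)//.
  by apply/seteqP; split=> // s /= /eqP; rewrite (negPf fe).
rewrite [X in measurable X](_ : _ = \bigcup_(ef : edge G * edge G)
   (([set x : T | x.1 = ef.1] `*` [set x : T | x.1 = ef.2]) `&`
    (fun z : T * T => (z.1.2, z.2.2)) @^-1`
      ((fun z : R * R => g ((ef.1, z.1), (ef.2, z.2))) @^-1` B))).
  apply: countable_bigcupT_measurable => [|ef]; first exact: countableP.
  apply: measurableI; first exact: measurableX.
  by rewrite -[X in measurable X]setTI; apply: mpi => //; rewrite -[X in measurable X]setTI; exact: mg.
apply/seteqP; split=> [[[e s] [f t]] /= Bg|[[e s] [f t]] [ef _] [[/= -> ->]] //].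
by exists (e, f).
Qed.

Let emb (e : edge G) : R -> T := fun s => (e, s).

Let memb e : measurable_fun setT (emb e).
Proof. by move=> _ A mA; rewrite setTI; exact: (mA e). Qed.

Let mI (e : edge G) : measurable (edge_itv e).
Proof. by rewrite /edge_itv; case: (term e) => [[v l]|]. Qed.

Let piece e : {measure set T -> \bar R} :=
  measure_function_pushforward__canonical__measure_function_Measure
    (mrestr (@lebesgue_measure R) (mI e)) (memb e).

Let nthe (n : nat) := nth e0 (enum (edge G)) n.

(** The measure is restricted to the edge intervals, not the type: coordinates outside them are
    null, and so are vertices, of which each incident edge has its own copy. *)
Definition gmeasure : set T -> \bar R := msum (fun n => piece (nthe n)) #|edge G|.

HB.instance Definition _ := Measure.on gmeasure.

Let sum_edges (F : edge G -> \bar R) :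
  (\sum_(n < #|edge G|) F (nthe n) = \sum_(e : edge G) F e)%E.
Proof.
rewrite (reindex_onto (@enum_rank (edge G)) (@enum_val _ _)) /=; last first.
  by move=> i _; rewrite enum_valK.
by apply: eq_big => [e|e _]; rewrite ?enum_rankK ?eqxx// /nthe nth_enum_rank.
Qed.

Lemma gmeasureE A : gmeasure A =
  (\sum_(e : edge G) (@lebesgue_measure R) ([set s | A (e, s)] `&` edge_itv e))%E.
Proof. by rewrite -sum_edges. Qed.

Let gmeasure_sigma_finite : sigma_finite setT gmeasure.
Proof.
exists (fun n => [set x : T | `|x.2| <= n%:R]).
  apply/esym/seteqP; split=> // x _; exists (Num.truncn `|x.2|).+1 => //=.
  by have /andP[_ /ltW] := truncn_itv (normr_ge0 x.2).
move=> n; have mn : measurable [set s : R | `|s| <= n%:R].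
  rewrite [X in measurable X](_ : _ = `[- n%:R, n%:R]%classic)//.
  by apply/seteqP; split=> s /=; rewrite in_itv/= ler_norml.
split; first by move=> e.
rewrite gmeasureE; apply: lte_sum_pinfty => e _.
apply: (@le_lt_trans _ _ ((@lebesgue_measure R) `[- n%:R, n%:R]%classic)).
  apply: le_measure; rewrite ?inE; [exact: (measurableI _ _ mn (mI e))|exact: measurable_itv|].
  by move=> s /= []; rewrite in_itv/= ler_norml.
by rewrite lebesgue_measure_itv/=; case: ifP => _; rewrite ?ltry// -EFinB ltry.
Qed.

HB.instance Definition _ := @Measure_isSigmaFinite.Build _ _ _ gmeasure gmeasure_sigma_finite.

Lemma integral_gmeasure (D : set T) (g : T -> \bar R) : measurable D ->
  measurable_fun setT g -> (forall x, 0 <= g x)%E ->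
  (\int[gmeasure]_(x in D) g x =
   \sum_(e : edge G) \int[@lebesgue_measure R]_(s in edge_itv e `&` [set s | D (e, s)])
      g (e, s))%E.
Proof.
move=> mD mg g0.
rewrite (ge0_integral_measure_sum _ mD)//; last exact: measurable_funTS.
rewrite -sum_edges; apply: eq_bigr => n _; set e := nthe n.
rewrite ge0_integral_pushforward//; last exact: measurable_funTS.
rewrite integral_mrestr//.
- exact: (mD e).
- by have /gmeasurable_funP mge := mg; apply: measurable_funTS; exact: mge.
- by move=> s; exact: g0.
- exact: memb.
Qed.

End GraphSpace.

(** * The kernel on the graph *)

Section LebesgueShift.
Context {R : realType}.
Local Notation leb := (@lebesgue_measure R).

Let shift (c : R) : measurableTypeR R -> measurableTypeR R := fun x => (x : R) + c.

Let mshift c : measurable_fun setT (shift c).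
Proof. by apply: measurable_funD => //; exact: measurable_id. Qed.

Lemma lebesgue_measure_shift (c : R) (A : set R) : measurable A ->
  pushforward leb (shift c) A = leb A.
Proof.
move=> mA; apply/esym.
apply: (lebesgue_measure_unique (mu := measure_function_pushforward__canonical__measure_function_Measure leb (mshift c))) => //= _ [[a b]] _ <-.
rewrite /pushforward /=.
have -> : shift c @^-1` [set` `]a, b]] = [set` `](a - c), (b - c)]].
  by apply/seteqP; split=> x /=; rewrite !in_itv/= /shift ltrBlDr lerBrDr.
rewrite !lebesgue_measure_itv/= !lte_fin ltrD2r.
by case: ifP => // _; rewrite -!EFinB; congr EFin; ring.
Qed.

Lemma ge0_integral_shift (c : R) (f : R -> \bar R) :
  measurable_fun setT f -> (forall x, 0 <= f x)%E ->
  (\int[leb]_x f (x + c)%R = \int[leb]_x f x)%E.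
Proof.
move=> mf_ f0.
have := @ge0_integral_pushforward _ _ _ _ R (shift c) (mshift c) leb setT f
  measurableT mf_ (fun x _ => f0 x).
rewrite preimage_setT => <-.
by apply: eq_measure_integral => A mA _; exact: lebesgue_measure_shift.
Qed.

End LebesgueShift.

Section GraphKernel.
Context (R : realType) (G : metric_graph R) (e0 : edge G) (J : R -> R).
Hypotheses (hG : graph_axioms G) (hJ : kernel_axioms J).
Local Notation T := (gspace e0).
Local Notation leb := (@lebesgue_measure R).

Definition gkernel (x y : T) : R := J (gdist (cpoint x) (cpoint y)).

Let J0 := kernel_ge0 hJ.

Let mJ : measurable_fun setT J.
Proof. by apply/measurable_EFinP; exact: (measurable_int _ (kernel_L1 hJ)). Qed.

Lemma measurable_gkernel : measurable_fun setT (fun z : T * T => gkernel z.1 z.2).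
Proof.
apply: gmeasurable_fun2 => e f; apply: (measurableT_comp mJ).
apply: measurable_lipschitz2 => s s' t t'; exact: (gdist_lip hG).
Qed.

Let JL1 : (0 <= \int[leb]_t (J t)%:E < +oo)%E.
Proof.
have /integrableP[_] := kernel_L1 hJ.
under eq_integral do rewrite /= ger0_norm//.
by move=> ->; rewrite andbT; apply: integral_ge0 => t _; rewrite lee_fin.
Qed.

Lemma mem_edge_itv (e : edge G) (t : R) : edge_itv e t -> t \in edge_itv e.
Proof. by move=> h; rewrite inE. Qed.

(** The distance to (f, t) is at least |x.2 - t| or the distance of t to an end of f, and J
    decreases; summing the possible values leaves translates of J, integrable in t uniformly in x.
    On a ray, w = 0 repeats its only end. The excluded t form a null set: J 0 is not assumed to
    dominate the other values of J. *)
Lemma kernel_edge_bound (x : gpoint G) (f : edge G) (t : R)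
    (w := if term f is Some (_, l) then l else 0) :
  x.2 \in edge_itv x.1 -> t \in edge_itv f ->
  t != 0 -> t != w -> t != x.2 ->
  J (gdist x (f, t)) <= J t + (J (t - w) + J (t - x.2)).
Proof.
move=> xG tf t0 tw tx.
have JN (a : R) : J `|a| = J a by case: ger0P => // _; rewrite (kernel_sym hJ).
have Jle (a d : R) : a != 0 -> `|a| <= d -> J d <= J a.
  by move=> an ad; rewrite -(JN a); apply: (kernel_nonincreasing hJ) => //; rewrite normr_gt0.
have /edge_itvP[tge0 tle] := tf.
have t0' : 0 < t by rewrite lt_neqAle eq_sym t0.
pose c := Num.min (end_dist f t) `|x.2 - t|.
have cd : c <= gdist x (f, t).
  apply: gdist_ge => // l /path_length_end_dist[h|[_ h]].
    by rewrite ge_min h.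
  by rewrite ge_min h orbT.
have [h|h] := leP `|x.2 - t| (end_dist f t).
  rewrite addrA; apply: le_trans (Jle (t - x.2) _ _ _) _.
  - by rewrite subr_eq0.
  - by rewrite distrC; move: cd; rewrite /c min_r.
  - by rewrite lerDr addr_ge0.
rewrite /c min_l ?(ltW h)// in cd.
rewrite /end_dist /w in cd tw *; case te : (term f) cd tw => [[v l]|] cd tw.
  have [tl|tl] := leP t (l - t).
    rewrite min_l// in cd; apply: le_trans (Jle t _ _ _) _ => //.
      by rewrite ger0_norm// ltW.
    by rewrite lerDl addr_ge0.
  rewrite min_r ?(ltW tl)// in cd; apply: le_trans (Jle (t - l) _ _ _) _.
  - by rewrite subr_eq0.
  - by rewrite ler0_norm ?opprB// subr_le0 (tle v).
  - by rewrite addrCA lerDl addr_ge0.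
apply: le_trans (Jle t _ _ _) _ => //; first by rewrite ger0_norm// ltW.
by rewrite lerDl addr_ge0.
Qed.

Lemma symmetric_gkernel : symmetric_kernel (gmeasure (e0 := e0)) gkernel
  (3 * fine (\int[leb]_t (J t)%:E) * #|edge G|%:R).
Proof.
have /andP[JL0 JLy] := JL1; have JLE := ge0_fineE JL0 JLy.
split.
- by rewrite !mulr_ge0// fine_ge0.
- by move=> x y; exact: J0.
- by move=> x y; rewrite /gkernel gdist_sym.
- exact: measurable_gkernel.
move=> x.
have mg : measurable_fun setT (fun y : T => gkernel x y).
  exact: (measurable_section x measurable_gkernel).
rewrite integral_gmeasure//; last 2 first.
- exact/measurable_EFinP.
- by move=> y; rewrite lee_fin; exact: J0.
apply: (@le_trans _ _ (\sum_(f : edge G) (3 * fine (\int[leb]_t (J t)%:E))%:E)%E); last first.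
  by rewrite sumEFin sumr_const mulr_natr lexx.
apply: lee_sum => f _; set D := _ `&` _.
have -> : D = edge_itv f by rewrite /D; apply/seteqP; split=> [t []|t].
pose w := if term f is Some (_, l) then l else 0.
set s := clamp x.1 x.2.
have mJs (c : R) : measurable_fun setT (fun t : R => J (t - c)).
  by apply: (measurableT_comp mJ); apply: measurable_funB.
have mB : measurable_fun setT (fun t : R => J t + (J (t - w) + J (t - s))) by mf.
have mI : measurable (edge_itv f) by rewrite /edge_itv; case: (term f) => [[v l]|].
have B0 t : 0 <= J t + (J (t - w) + J (t - s)) by rewrite !addr_ge0.
apply: (@le_trans _ _ (\int[leb]_(t in edge_itv f) (J t + (J (t - w) + J (t - s)))%:E)%E).
  apply: ae_ge0_le_integral => //.
  - by move=> t _; rewrite lee_fin; exact: J0.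
  - apply: measurable_funTS; apply/measurable_EFinP.
    by have /gmeasurable_funP := mg; exact.
  - by move=> t _; rewrite lee_fin.
  - by apply: measurable_funTS; exact/measurable_EFinP.
  exists ([set 0] `|` ([set w] `|` [set s])); split.
  - by apply: measurableU => //; apply: measurableU.
  - apply: countable_lebesgue_measure0; apply: finite_set_countable.
    by rewrite !finite_setU; split; [|split]; exact: finite_set1.
  - move=> t /= /not_implyP[tf]; rewrite lee_fin => /negP; rewrite -ltNge.
    move=> h; apply: contrapT => /not_orP[/eqP t0 /not_orP[/eqP tw /eqP ts]].
    move: h; rewrite ltNge => /negP; apply.
    have tf' := mem_edge_itv tf; rewrite /gkernel /cpoint /= (clamp_id tf').
    by apply: (@kernel_edge_bound (x.1, s)) => //=; exact: clamp_in.
apply: (@le_trans _ _ (\int[leb]_t (J t + (J (t - w) + J (t - s)))%:E)%E).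
  by apply: ge0_subset_integral => //; [exact/measurable_EFinP|move=> t _; rewrite lee_fin].
have mJ2 : measurable_fun setT (fun t : R => J (t - w) + J (t - s)) by mf.
rewrite ge0_intD//; last by move=> t; rewrite addr_ge0.
rewrite ge0_intD//; [|exact: mJs..].
have sh (c : R) : (\int[leb]_t (J (t - c))%:E = \int[leb]_t (J t)%:E)%E.
  apply: (ge0_integral_shift (- c) (f := EFin \o J)); first exact/measurable_EFinP.
  by move=> t; rewrite lee_fin.
rewrite !sh JLE -!EFinD lee_fin; set j := fine _.
by have -> : 3 * j = j + (j + j) by ring.
Qed.

End GraphKernel.

(** * Chains of cells *)

Lemma ge0_int_lin d (T : measurableType d) (R : realType)
    (mu : {measure set T -> \bar R}) (D : set T) (a b : R) (F H : T -> \bar R) :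
  measurable D -> 0 <= a -> 0 <= b ->
  measurable_fun setT F -> measurable_fun setT H ->
  (forall x, 0 <= F x)%E -> (forall x, 0 <= H x)%E ->
  (\int[mu]_(x in D) (a%:E * F x + b%:E * H x) =
   a%:E * \int[mu]_(x in D) F x + b%:E * \int[mu]_(x in D) H x)%E.
Proof.
move=> mD a0 b0 mF mH F0 H0.
have mFD : measurable_fun D F by exact: measurable_funTS.
have mHD : measurable_fun D H by exact: measurable_funTS.
rewrite ge0_integralD//; last 4 first.
- by move=> x _; rewrite mule_ge0 ?lee_fin.
- exact: measurable_funeM.
- by move=> x _; rewrite mule_ge0 ?lee_fin.
- exact: measurable_funeM.
by rewrite !ge0_integralZl.
Qed.

(** Here 2 A' / N is the Markov level on a piece of measure N and mass A'. Only p - 1 of the factors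
    A' are replaced with A; the one that is kept can be summed over pieces. *)
Lemma powR_mean_le (R : realType) (p A A' N : R) :
  1 <= p -> 0 < A' -> A' <= A -> 0 < N ->
  2 * ((2 * A' / N) `^ p * N) <= 2 * 2 `^ p * N `^ (1 - p) * A `^ (p - 1) * A'.
Proof.
move=> p1 A'0 A'A N0; rewrite -!mulrA ler_pM2l//.
have [A'1 N1] := (ltW A'0, ltW N0).
rewrite !powRM ?mulr_ge0 ?invr_ge0//.
have -> : A' `^ p = A' `^ (p - 1) * A'.
  have := @powRD _ A' (p - 1) 1; rewrite subrK powRr1 ?ltW// => -> //.
  by rewrite (gt_eqF A'0) implybT.
have -> : N `^ (1 - p) = N^-1 `^ p * N.
  have := @powRD _ N (- p) 1; rewrite powRr1 ?(ltW N0)// addrC => ->.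
    by rewrite -(powR_inv1 (ltW N0)) -powRrM mulN1r.
  by rewrite (gt_eqF N0) implybT.
rewrite -!mulrA ler_wpM2l ?powR_ge0//.
rewrite [leRHS](_ : _ = A `^ (p - 1) * (A' * (N^-1 `^ p * N))); last by ring.
by rewrite ler_wpM2r ?ge0_ler_powR ?nnegrE ?mulr_ge0 ?powR_ge0 ?subr_ge0// (le_trans A'1).
Qed.

Section Pieces.
Context d (T : measurableType d) (R : realType).
Variables (mu : {sigma_finite_measure set T -> \bar R}) (K : T -> T -> R) (M : R).
Hypothesis hK : symmetric_kernel mu K M.
Implicit Types (u v : T -> R) (S P Q : set T).

Lemma integral_indicE S (f : T -> R) : measurable S ->
  (\int[mu]_(x in S) (f x)%:E = \int[mu]_x (\1_S x * f x)%:E)%E.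
Proof.
move=> mS; rewrite integral_mkcond; apply: eq_integral => x _.
by rewrite patchE indicE; case: (x \in S); rewrite ?mul1r ?mul0r.
Qed.

Lemma measurable_integral_in (g : T -> T -> R) S : measurable S ->
  (forall x y, 0 <= g x y) -> measurable_fun setT (fun z : T * T => g z.1 z.2) ->
  measurable_fun setT (fun x => \int[mu]_(y in S) (g x y)%:E)%E.
Proof.
move=> mS g0 mg.
have E x : (\int[mu]_(y in S) (g x y)%:E = \int[mu]_y (\1_S y * g x y)%:E)%E.
  exact: integral_indicE.
apply: (eq_measurable_fun _ (fun x _ => esym (E x))).
apply: measurable_integral_snd => [x y|]; first by rewrite mulr_ge0.
by apply: measurable_funM => //; apply: (measurable_comp2 (measurable_indic mS)).
Qed.

Lemma integral_in_swap (g : T -> T -> R) S S' : measurable S -> measurable S' ->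
  (forall x y, 0 <= g x y) -> measurable_fun setT (fun z : T * T => g z.1 z.2) ->
  (\int[mu]_(x in S) \int[mu]_(y in S') (g x y)%:E =
   \int[mu]_(y in S') \int[mu]_(x in S) (g x y)%:E)%E.
Proof.
move=> mS mS' g0 mg.
have E (A B : set T) (f : T -> T -> R) : measurable A -> measurable B ->
    (forall x y, 0 <= f x y) -> measurable_fun setT (fun z : T * T => f z.1 z.2) ->
    (\int[mu]_(x in A) \int[mu]_(y in B) (f x y)%:E =
     \int[mu]_x \int[mu]_y (\1_A x * \1_B y * f x y)%:E)%E.
  move=> mA mB f0 mf_; rewrite integral_mkcond; apply: eq_integral => x _.
  rewrite patchE indicE; case: (x \in A).
    by rewrite integral_indicE//; apply: eq_integral => y _; rewrite mul1r.
  by rewrite integral0_eq// => y _; rewrite !mul0r.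
have mg' : measurable_fun setT (fun z : T * T => g z.2 z.1).
  exact: (measurableT_comp mg (@measurable_swap _ _ _ _)).
rewrite (E S S' g mS mS' g0 mg) (E S' S (fun y x => g x y) mS' mS (fun y x => g0 x y) mg').
rewrite integral_swap.
- by apply: eq_integral => x _; apply: eq_integral => y _; rewrite (mulrC (\1_S y)).
- by move=> x y; rewrite !mulr_ge0.
- apply: measurable_funM => //; apply: measurable_funM.
    exact: (measurable_comp1 (measurable_indic mS)).
  exact: (measurable_comp2 (measurable_indic mS')).
Qed.

Lemma integral_cst_in S (s : R) (r : \bar R) : measurable S -> mu S = s%:E ->
  (\int[mu]_(x in S) (cst r x) = s%:E * r)%E.
Proof. by move=> mS h; rewrite integral_cst// muleC; congr (_ * _)%E. Qed.

Definition dbl v S S' : \bar R :=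
  (\int[mu]_(x in S) \int[mu]_(y in S') ((v x - v y) ^+ 2)%:E)%E.

Let mdiff v : measurable_fun setT v ->
  measurable_fun setT (fun z : T * T => (v z.1 - v z.2) ^+ 2).
Proof.
move=> mv; have := measurable_comp1 mv; have := measurable_comp2 mv => *; by mf.
Qed.

Lemma dbl_sym v S S' : measurable S -> measurable S' -> measurable_fun setT v ->
  dbl v S S' = dbl v S' S.
Proof.
move=> mS mS' mv; rewrite /dbl.
rewrite (integral_in_swap mS mS' (fun x y => sqr_ge0 (v x - v y)) (mdiff mv)).
apply: eq_integral => x _; apply: eq_integral => y _; congr EFin.
by rewrite -sqrrN opprB.
Qed.

(** The bound v(y)^2 <= (1 + th) v(x)^2 + (1 + 1/th) (v(x) - v(y))^2, integrated over S x S'. A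
    small [th] is needed along a chain, to keep the product of the factors 1 + th under control. *)
Lemma two_sets (th s s' : R) v S S' : 0 < th -> measurable S -> measurable S' ->
  mu S = s%:E -> mu S' = s'%:E -> measurable_fun setT v ->
  (s%:E * \int[mu]_(y in S') (v y ^+ 2)%:E <=
   (1 + th)%:E * (s'%:E * \int[mu]_(x in S) (v x ^+ 2)%:E) +
   (1 + th^-1)%:E * dbl v S S')%E.
Proof.
move=> th0 mS mS' Ss Ss' mv.
have s0 : 0 <= s by rewrite -lee_fin -Ss.
have s0' : 0 <= s' by rewrite -lee_fin -Ss'.
have t0 : 0 <= 1 + th by rewrite addr_ge0// ltW.
have t1 : 0 <= 1 + th^-1 by rewrite addr_ge0// invr_ge0 ltW.
have q0 x : 0 <= v x ^+ 2 by exact: sqr_ge0.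
have mq : measurable_fun setT (EFin \o (fun x => v x ^+ 2)).
  by apply/measurable_EFinP; mf.
have md x : measurable_fun setT (EFin \o (fun y => (v x - v y) ^+ 2)).
  by apply/measurable_EFinP; exact: (measurable_section (g := fun x y => (v x - v y) ^+ 2) x (mdiff mv)).
set B := (X in (s%:E * X)%E); pose D x := (\int[mu]_(y in S') ((v x - v y) ^+ 2)%:E)%E.
have mD : measurable_fun setT D.
  by apply: measurable_integral_in => //; [move=> *; exact: sqr_ge0|exact: mdiff].
have D0 x : (0 <= D x)%E by apply: integral_ge0 => y _; rewrite lee_fin sqr_ge0.
have pw x : (B <= ((1 + th) * s')%:E * (v x ^+ 2)%:E + (1 + th^-1)%:E * D x)%E.
  have -> : (((1 + th) * s')%:E * (v x ^+ 2)%:E =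
      (1 + th)%:E * \int[mu]_(y in S') (cst (v x ^+ 2)%:E y))%E.
    by rewrite (integral_cst_in _ mS' Ss') -!EFinM; congr EFin; ring.
  rewrite -ge0_int_lin//; last 3 first.
  - exact: md.
  - by move=> y; rewrite /= lee_fin.
  - by move=> y; rewrite lee_fin sqr_ge0.
  apply: ge0_le_integral => //.
  - by move=> y _; rewrite lee_fin.
  - exact: measurable_funTS.
  - apply: measurable_funTS; apply: emeasurable_funD; apply: measurable_funeM => //.
    exact: md.
  - move=> y _; rewrite -!EFinM -EFinD lee_fin /= -subr_ge0.
    have -> : (1 + th) * v x ^+ 2 + (1 + th^-1) * (v x - v y) ^+ 2 - v y ^+ 2 =
      ((1 + th) * v x - v y) ^+ 2 / th by field; rewrite gt_eqF.
    by rewrite divr_ge0 ?sqr_ge0// ltW.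
have -> : (s%:E * B = \int[mu]_(x in S) (cst B x))%E.
  by rewrite (integral_cst_in _ mS Ss).
rewrite muleA -EFinM -ge0_int_lin ?mulr_ge0//.
apply: ge0_le_integral => //.
- by move=> x _; apply: integral_ge0 => y _; rewrite lee_fin.
- apply: measurable_funTS; apply: emeasurable_funD; apply: measurable_funeM => //.
Qed.

Definition dissipation v x : \bar R :=
  (\int[mu]_y (K x y * (v x - v y) ^+ 2)%:E)%E.

Let K0 := sk_ge0 hK.

Lemma dissipation_ge0 v x : (0 <= dissipation v x)%E.
Proof. by apply: integral_ge0 => y _; rewrite lee_fin mulr_ge0 ?sqr_ge0. Qed.

Let mKd v : measurable_fun setT v ->
  measurable_fun setT (fun z : T * T => K z.1 z.2 * (v z.1 - v z.2) ^+ 2).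
Proof. by move=> mv; apply: measurable_funM; [exact: (sk_measurable hK)|exact: mdiff]. Qed.

Lemma measurable_dissipation v : measurable_fun setT v ->
  measurable_fun setT (dissipation v).
Proof.
move=> mv; apply: measurable_integral_snd => [x y|]; last exact: mKd.
by rewrite mulr_ge0 ?sqr_ge0.
Qed.

Lemma dbl_le_dissipation (c : R) v S S' : 0 < c -> measurable S -> measurable S' ->
  measurable_fun setT v -> (forall x y, S x -> S' y -> c <= K x y) ->
  (dbl v S S' <= (c^-1)%:E * \int[mu]_(x in S) dissipation v x)%E.
Proof.
move=> c0 mS mS' mv cK; rewrite -ge0_integralZl//; last 3 first.
- by apply: measurable_funTS; exact: measurable_dissipation.
- by move=> x _; exact: dissipation_ge0.
- by rewrite lee_fin invr_ge0 ltW.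
apply: ge0_le_integral => //.
- by move=> x _; apply: integral_ge0 => y _; rewrite lee_fin sqr_ge0.
- apply: measurable_funTS; apply: measurable_integral_in => //.
    by move=> *; exact: sqr_ge0.
  exact: mdiff.
- by apply: measurable_funTS; apply: measurable_funeM; exact: measurable_dissipation.
move=> x Sx.
have md : measurable_fun setT (fun y => (v x - v y) ^+ 2).
  exact: (measurable_section (g := fun x y => (v x - v y) ^+ 2) x (mdiff mv)).
have mk : measurable_fun setT (fun y => K x y * (v x - v y) ^+ 2).
  exact: (measurable_section (g := fun x y => K x y * (v x - v y) ^+ 2) x (mKd mv)).
have k0 y : 0 <= K x y * (v x - v y) ^+ 2 by rewrite mulr_ge0 ?sqr_ge0.
have i0 : 0 <= c^-1 by rewrite invr_ge0 ltW.
apply: (@le_trans _ _ ((c^-1)%:E * \int[mu]_(y in S') (K x y * (v x - v y) ^+ 2)%:E)%E).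
  rewrite -ge0_intZ//; last exact: measurable_funTS.
  apply: ge0_int_le => //.
  - exact: measurable_funTS.
  - by apply: measurable_funTS; mf.
  - by move=> y; exact: sqr_ge0.
  - by move=> y Sy; rewrite mulrA ler_peMl ?sqr_ge0// mulrC ler_pdivlMr// mul1r cK.
apply: lee_wpmul2l; first by rewrite lee_fin.
apply: ge0_subset_integral => //; first exact/measurable_EFinP.
by move=> y _; rewrite lee_fin.
Qed.

Section Chain.
Variables (Cl : nat -> set T) (a c : R).
Hypotheses (a0 : 0 < a) (c0 : 0 < c) (mC : forall i, measurable (Cl i)).
Hypotheses (muC : forall i, mu (Cl i) = a%:E) (tC : trivIset setT Cl).
Hypothesis Kdiag : forall i x y, Cl i x -> Cl i y -> c <= K x y.
Hypothesis Knext : forall i x y, Cl i x -> Cl i.+1 y -> c <= K x y.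

Let dbl_ge0 v S S' : (0 <= dbl v S S')%E.
Proof.
apply: integral_ge0 => x _; apply: integral_ge0 => y _.
by rewrite lee_fin sqr_ge0.
Qed.

Let var v i (t : R) : \bar R := (\int[mu]_(y in Cl i) ((v y - t) ^+ 2)%:E)%E.

Let var_ge0 v i t : (0 <= var v i t)%E.
Proof. by apply: integral_ge0 => y _; rewrite lee_fin sqr_ge0. Qed.

(** Taking th = 1 / (m + 1) at step m makes the factors telescope, (1 + 1 / (m + 1)) (m + 1) = m +
    2, so the cost of m steps is linear in m. *)
Lemma chain_var v i m t : measurable_fun setT v ->
  (var v (i + m) t <= m.+1%:R%:E * (var v i t +
     (a^-1)%:E * \sum_(k < m) dbl v (Cl (i + k)) (Cl (i + k).+1)))%E.
Proof.
move=> mv; elim: m => [|m IH]; first by rewrite addn0 big_ord0 mule0 adde0 mul1e.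
have mvt : measurable_fun setT (fun y => v y - t) by mf.
have th0 : 0 < m.+1%:R^-1 :> R by rewrite invr_gt0.
have := two_sets th0 (mC (i + m)) (mC (i + m).+1) (muC _) (muC _) mvt.
rewrite invrK addnS.
have -> : dbl (fun y => v y - t) (Cl (i + m)) (Cl (i + m).+1) =
    dbl v (Cl (i + m)) (Cl (i + m).+1).
  apply: eq_integral => x _; apply: eq_integral => y _.
  by rewrite opprB addrA subrK.
rewrite -/(var v (i + m) t) -/(var v (i + m).+1 t) => h.
have ai0 : 0 <= a^-1 by rewrite invr_ge0 ltW.
have {}h : (var v (i + m).+1 t <= (1 + m.+1%:R^-1)%:E * var v (i + m) t +
    (1 + m.+1%:R)%:E * ((a^-1)%:E * dbl v (Cl (i + m)) (Cl (i + m).+1)))%E.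
  have := lee_wpmul2l (ai0 : (0 <= (a^-1)%:E)%E) h.
  rewrite muleA -EFinM mulVf ?gt_eqF// mul1e => /le_trans; apply.
  rewrite ge0_muleDr; last 2 first.
  - rewrite mule_ge0 ?mule_ge0 ?lee_fin ?addr_ge0 ?(ltW th0) ?(ltW a0)//.
  - by rewrite mule_ge0 ?lee_fin ?addr_ge0.
  rewrite !muleA -!EFinM; apply: leeD; apply: lee_wpmul2r => //.
    rewrite lee_fin le_eqVlt; apply/orP; left; apply/eqP.
    by move: (m.+1%:R^-1) => q; field; rewrite gt_eqF.
  by rewrite lee_fin mulrC.
apply: (le_trans h); rewrite big_ord_recr /=.
set S := (\sum_(k < m) _)%E in IH *; set D := dbl _ _ _.
have S0 : (0 <= S)%E by apply: sume_ge0 => k _.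
have h1 : (0 <= (1 + m.+1%:R^-1)%:E :> \bar R)%E by rewrite lee_fin addr_ge0// ltW.
apply: (le_trans (leeD (lee_wpmul2l h1 IH) (lexx _))).
rewrite muleA -EFinM.
have -> : (1 + m.+1%:R^-1) * m.+1%:R = m.+2%:R :> R.
  by rewrite mulrDl mul1r mulVf// natr1.
have -> : 1 + m.+1%:R = m.+2%:R :> R by rewrite nat1r.
have D0 : (0 <= D)%E by exact: dbl_ge0.
have ai : (0 <= (a^-1)%:E :> \bar R)%E by rewrite lee_fin.
have VS0 : (0 <= var v i t + (a^-1)%:E * S)%E by rewrite adde_ge0// mule_ge0.
have aD0 : (0 <= (a^-1)%:E * D)%E by rewrite mule_ge0.
by rewrite (ge0_muleDr _ S0 D0) (addeA (var v i t)) (ge0_muleDr _ VS0 aD0).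
Qed.

Let W i v : \bar R := (\int[mu]_(x in Cl i) dissipation v x)%E.

Let W_ge0 i v : (0 <= W i v)%E.
Proof. by apply: integral_ge0 => x _; exact: dissipation_ge0. Qed.

(** [chain_var] with t = v x, integrated over x in the first cell, whose measure a cancels the
    factor 1/a. *)
Lemma chain_dbl v i m : measurable_fun setT v ->
  (dbl v (Cl i) (Cl (i + m)) <=
    (m.+1%:R * c^-1)%:E * (W i v + \sum_(k < m) W (i + k) v))%E.
Proof.
move=> mv; set S := (\sum_(k < m) dbl v (Cl (i + k)) (Cl (i + k).+1))%E.
have S0 : (0 <= S)%E by apply: sume_ge0 => k _.
have ai0 : 0 <= a^-1 by rewrite invr_ge0 ltW.
have ci0 : 0 <= c^-1 by rewrite invr_ge0 ltW.
have m0 : (0 <= m.+1%:R%:E :> \bar R)%E by rewrite lee_fin.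
have mvar j : measurable_fun setT (fun x => var v j (v x)).
  apply: (eq_measurable_fun (fun x => \int[mu]_(y in Cl j) ((v x - v y) ^+ 2)%:E)%E).
    by move=> x _; apply: eq_integral => y _; rewrite -sqrrN opprB.
  by apply: measurable_integral_in => //; [move=> *; exact: sqr_ge0|exact: mdiff].
have dE j : dbl v (Cl i) (Cl j) = (\int[mu]_(x in Cl i) var v j (v x))%E.
  by apply: eq_integral => x _; apply: eq_integral => y _; rewrite -sqrrN opprB.
have aS0 : (0 <= (a^-1)%:E * S)%E by rewrite mule_ge0 ?lee_fin.
apply: (@le_trans _ _ (m.+1%:R%:E * (dbl v (Cl i) (Cl i) + S))%E).
  rewrite dE; apply: (@le_trans _ _ (\int[mu]_(x in Cl i)
      (m.+1%:R%:E * var v i (v x) + m.+1%:R%:E * (cst ((a^-1)%:E * S) x)))%E).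
    apply: ge0_le_integral => //.
    - exact: measurable_funTS.
    - apply: measurable_funTS; apply: emeasurable_funD; exact: measurable_funeM.
    - move=> x _ /=; rewrite -ge0_muleDr//; exact: chain_var.
  rewrite ge0_int_lin// (integral_cst_in _ (mC i) (muC i)) -dE.
  by rewrite (muleA a%:E) -EFinM mulfV ?gt_eqF// mul1e -ge0_muleDr.
rewrite EFinM -muleA; apply: lee_wpmul2l => //.
have dW (S1 S2 : set T) : measurable S1 -> measurable S2 ->
    (forall x y, S1 x -> S2 y -> c <= K x y) ->
    (dbl v S1 S2 <= (c^-1)%:E * \int[mu]_(x in S1) dissipation v x)%E.
  by move=> m1 m2; exact: dbl_le_dissipation.
have SW0 : (0 <= \sum_(k < m) W (i + k) v)%E.
  by apply: sume_ge0 => k _; exact: W_ge0.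
rewrite (ge0_muleDr _ (W_ge0 i v) SW0).
apply: leeD; first by apply: dW => //; exact: Kdiag.
rewrite ge0_sume_distrr; last by move=> k _.
by apply: lee_sum => k _; apply: dW => //; exact: Knext.
Qed.

Section Piece.
Variable n : nat.
Hypothesis n0 : (0 < n)%N.
Let P : set T := \big[setU/set0]_(i <- index_iota 0 n) Cl i.

Lemma mpiece : measurable P. Proof. exact: bigsetU_measurable. Qed.

Lemma integral_piece (F : T -> \bar R) : measurable_fun setT F ->
  (forall x, 0 <= F x)%E ->
  (\int[mu]_(x in P) F x = \sum_(0 <= i < n) \int[mu]_(x in Cl i) F x)%E.
Proof.
move=> mF F0; apply: ge0_integral_bigsetU => //.
- exact: iota_uniq.
- exact: sub_trivIset tC.
- exact: measurable_funTS.
Qed.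

Lemma mu_piece : mu P = (n%:R * a)%:E.
Proof.
rewrite -[LHS]mul1e -(integral_cst mu mpiece 1%E) integral_piece//.
under eq_bigr do rewrite (integral_cst_in _ (mC _) (muC _)) mule1.
by rewrite big_mkord sumEFin sumr_const card_ord mulr_natl.
Qed.

Let WP v : \bar R := (\int[mu]_(x in P) dissipation v x)%E.

Lemma WPE v : measurable_fun setT v -> WP v = (\sum_(0 <= i < n) W i v)%E.
Proof.
move=> mv; apply: integral_piece; first exact: measurable_dissipation.
exact: dissipation_ge0.
Qed.

Lemma WP0 v : (0 <= WP v)%E.
Proof. by apply: integral_ge0 => x _; exact: dissipation_ge0. Qed.

Lemma dbl_cells v i j : measurable_fun setT v -> (i < n)%N -> (j < n)%N ->
  (dbl v (Cl i) (Cl j) <= (n%:R * c^-1 * 2)%:E * WP v)%E.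
Proof.
move=> mv; wlog ij : i j / (i <= j)%N => [H ilt jlt|ilt jlt].
  by have [ij|/ltnW ij] := leqP i j; [|rewrite dbl_sym//]; exact: H.
have -> : j = (i + (j - i))%N by rewrite subnKC.
apply: (le_trans (chain_dbl _ _ mv)).
have ci0 : 0 <= c^-1 by rewrite invr_ge0 ltW.
have W1 : (W i v <= WP v)%E.
  rewrite WPE// big_mkord (bigD1 (Ordinal ilt))//= leeDl//.
  by apply: sume_ge0 => k _; exact: W_ge0.
have W2 : (\sum_(k < j - i) W (i + k) v <= WP v)%E.
  rewrite WPE//.
  have -> : (\sum_(k < j - i) W (i + k) v = \sum_(i <= k < j) W k v)%E.
    have -> : (\sum_(i <= k < j) W k v = \sum_(0 <= k < j - i) W (k + i) v)%E.
      by rewrite -{1}[i]add0n big_addn.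
    by rewrite big_mkord; apply: eq_bigr => k _; rewrite addnC.
  apply: (@le_trans _ _ (\sum_(0 <= k < j) W k v)%E).
    by apply: (lee_sum_nneg_natl (fun k => W k v) xpredT j) => // k _ _; exact: W_ge0.
  by apply: (lee_sum_nneg_natr (fun k => W k v) xpredT 0%N) (ltnW jlt) => k _ _; exact: W_ge0.
have jn : (j - i < n)%N by rewrite (leq_ltn_trans (leq_subr _ _)).
(* Cell i may occur both in the diagonal term and in the sum, hence the factor 2. *)
apply: (@le_trans _ _ ((n%:R * c^-1)%:E * (WP v + WP v))%E); last first.
  by rewrite ge0_muleDr ?WP0// mulr_natr mulr2n EFinD ge0_muleDl ?lee_fin ?mulr_ge0.
apply: (@le_trans _ _ ((n%:R * c^-1)%:E * (W i v + \sum_(k < j - i) W (i + k) v))%E).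
  apply: lee_wpmul2r; last by rewrite lee_fin ler_wpM2r// ler_nat.
  by rewrite adde_ge0//; apply: sume_ge0 => k _; exact: W_ge0.
by apply: lee_wpmul2l; [rewrite lee_fin mulr_ge0|exact: leeD].
Qed.

(** There are n^2 pairs of cells, each with a cost proportional to n. *)
Lemma dbl_piece v : measurable_fun setT v ->
  (dbl v P P <= (n%:R ^+ 3 * c^-1 * 2)%:E * WP v)%E.
Proof.
move=> mv.
have mdb (S : set T) : measurable S ->
    measurable_fun setT (fun x => \int[mu]_(y in S) ((v x - v y) ^+ 2)%:E)%E.
  by move=> mS; apply: measurable_integral_in => //;
    [move=> *; exact: sqr_ge0|exact: mdiff].
have db0 (S : set T) x : (0 <= \int[mu]_(y in S) ((v x - v y) ^+ 2)%:E)%E.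
  by apply: integral_ge0 => y _; rewrite lee_fin sqr_ge0.
have E (S : set T) : measurable S -> dbl v P S = (\sum_(0 <= i < n) dbl v (Cl i) S)%E.
  by move=> mS; apply: integral_piece; [exact: mdb|exact: db0].
have c1 : (dbl v P P <= \sum_(0 <= i < n) \sum_(0 <= j < n)
    ((n%:R * c^-1 * 2)%:E * WP v))%E.
  rewrite (E _ mpiece) !big_mkord; apply: lee_sum => i _.
  rewrite (dbl_sym (mC i) mpiece mv) (E _ (mC i)) !big_mkord; apply: lee_sum => j _.
  exact: dbl_cells.
have cst_sum (X : \bar R) : (\sum_(0 <= i < n) X = n%:R%:E * X)%E.
  rewrite big_mkord; elim: (n) => [|m IH]; first by rewrite big_ord0 mul0e.
  by rewrite big_ord_recr/= IH -natr1 EFinD ge0_muleDl ?lee_fin ?mul1e.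
apply: (le_trans c1); rewrite !cst_sum !muleA -!EFinM lee_wpmul2r ?WP0// lee_fin.
by rewrite le_eqVlt; apply/orP; left; apply/eqP; ring.
Qed.

(** Nash's inequality on one piece of n cells. The factor n^3 of [dbl_piece] is divided by a set of
    measure at least n a / 2, leaving n^2. The last term keeps one power of the local mass, so that
    summing over pieces does not count A^p once for each piece. *)
Lemma piece_bound (p A : R) (u : T -> R) : 1 <= p -> 0 <= A -> measurable_fun setT u ->
  (\int[mu]_(x in P) `|u x|%:E <= A%:E)%E ->
  (\int[mu]_(x in P) (`|u x| `^ p)%:E <=
    (8 * n%:R ^+ 2 * (a * c)^-1)%:E *
      \int[mu]_(x in P) dissipation (fun x => (`|u x| `^ (p / 2))%R) x +
    (2 * 2 `^ p * (n%:R * a) `^ (1 - p) * A `^ (p - 1))%:E *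
      \int[mu]_(x in P) `|u x|%:E)%E.
Proof.
move=> p1 A0 mu_ uA; set v := fun x => `|u x| `^ (p / 2).
have p0 : 0 < p by rewrite (lt_le_trans ltr01).
have mau : measurable_fun setT (fun x => `|u x|).
  exact: (measurableT_comp (@normr_measurable _ _) mu_).
have mv : measurable_fun setT v := measurableT_comp (measurable_powR (p / 2)) mau.
have mPu : measurable_fun P (EFin \o u) by apply: measurable_funTS; exact/measurable_EFinP.
have v2 x : v x ^+ 2 = `|u x| `^ p.
  by rewrite /v -powR_mulrn ?powR_ge0// -powRrM mulfVK.
have Iu0 : (0 <= \int[mu]_(x in P) `|u x|%:E)%E.
  by apply: integral_ge0 => x _; rewrite lee_fin.
have IuE : (\int[mu]_(x in P) `|u x|%:E = (fine (\int[mu]_(x in P) `|u x|%:E))%:E)%E.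
  by apply: ge0_fineE => //; apply: (le_lt_trans uA); exact: ltry.
move: IuE Iu0 uA; set A' := fine _ => IuE; rewrite IuE !lee_fin => A'0 A'A.
have na : 0 < n%:R * a by rewrite mulr_gt0// ltr0n.
have k0' : 0 <= 8 * n%:R ^+ 2 * (a * c)^-1.
  by rewrite mulr_ge0 ?invr_ge0 ?mulr_ge0 ?exprn_ge0// ltW.
(* Zero mass on P would make the Markov level 0; u then vanishes almost everywhere on P. *)
move: A'0; rewrite le_eqVlt => /predU1P[A'E|A'0].
  have : ae_eq mu P (EFin \o u) (cst 0%E).
    by apply/(ae_eq_integral_abs _ mpiece mPu); rewrite [RHS](congr1 EFin A'E) -IuE; apply: eq_integral.
  move=> uae; rewrite (_ : (\int[mu]_(x in P) (`|u x| `^ p)%:E)%E = 0%E).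
    rewrite -A'E mule0 adde0 mule_ge0 ?lee_fin//; exact: WP0.
  rewrite -(integral0 mu P); apply: ae_eq_integral => //; first exact: mpiece.
    apply: measurable_funTS; apply/measurable_EFinP.
    exact: (measurableT_comp (measurable_powR p) mau).
  apply: filterS uae => x h Px; move: (h Px) => /= [->].
  by rewrite normr0 powR0// gt_eqF.
(* By Markov's inequality the points of P where |u| <= k fill at least half
   of P; comparing v y with v x for such x controls v y by differences. *)
pose k := 2 * A' / (n%:R * a).
have k0 : 0 < k by rewrite divr_gt0// mulr_gt0.
pose B := [set x | `|u x| <= k].
pose Z := P `&` B.
have mZ' : measurable B.
  rewrite [X in measurable X](_ : _ = setT `&` (fun x => `|u x|) @^-1` `]-oo, k]%classic).
    by apply: mau => //; exact: measurable_itv.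
  by apply/seteqP; split=> x /=; rewrite in_itv/=; [split|case].
have mZ : measurable Z by apply: measurableI => //; exact: mpiece.
have muZ : (mu Z < +oo)%E.
  by apply: (@le_lt_trans _ _ (mu P)); [apply: le_measure; rewrite ?inE//; [exact: mpiece|apply: subIsetl]|rewrite mu_piece ltry].
have ZE : mu Z = (fine (mu Z))%:E by apply: ge0_fineE.
set z := fine _ in ZE.
have zn : z <= n%:R * a.
  by rewrite -lee_fin -ZE -mu_piece; apply: le_measure; rewrite ?inE//; [exact: mpiece|apply: subIsetl].
have zh : n%:R * a / 2 <= z.
  have mPZ : measurable (P `\` B).
    by apply: measurableD => //; exact: mpiece.
  have [y yE] : exists y, mu (P `\` B) = y%:E.
    exists (fine (mu (P `\` B))); apply: ge0_fineE => //.
    apply: (@le_lt_trans _ _ (mu P)); last by rewrite mu_piece ltry.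
    by apply: le_measure; rewrite ?inE//; exact: mpiece.
  have : (mu P = mu (P `\` B)%classic + mu Z)%E.
    exact: (measureDI mu mpiece mZ').
  rewrite mu_piece yE ZE -EFinD => -[nE].
  have : (\int[mu]_(x in P `\` B) (cst k%:E x) <= A'%:E)%E.
    rewrite -IuE; apply: (@le_trans _ _ (\int[mu]_(x in P `\` B) `|u x|%:E)%E).
      apply: ge0_le_integral => //.
      - by move=> x _; rewrite lee_fin ltW.
      - by apply: measurable_funTS; exact/measurable_EFinP.
      - by move=> x [_ /= /negP]; rewrite -ltNge lee_fin => /ltW.
    apply: ge0_subset_integral => //.
    - exact: mpiece.
    - by apply: measurable_funTS; exact/measurable_EFinP.
  rewrite (integral_cst_in _ mPZ yE) -EFinM lee_fin => yk.
  have : y * (2 * A') <= A' * (n%:R * a) by rewrite -ler_pdivrMr// -mulrA.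
  rewrite mulrA -[A' * _]mulrC ler_pM2r//; move: nE; move: (n%:R * a) => N; lra.
have z0 : 0 < z by apply: lt_le_trans zh; rewrite divr_gt0.
set X := (X in (X <= _)%E).
have mdx x : measurable_fun setT (fun y => (v x - v y) ^+ 2).
  exact: (measurable_section (g := fun x y => (v x - v y) ^+ 2) x (mdiff mv)).
pose D x := (\int[mu]_(y in P) ((v x - v y) ^+ 2)%:E)%E.
have mD : measurable_fun setT D.
  by apply: measurable_integral_in => //; [exact: mpiece|move=> *; exact: sqr_ge0|exact: mdiff].
have D0 x : (0 <= D x)%E by apply: integral_ge0 => y _; rewrite lee_fin sqr_ge0.
have kp0 : 0 <= k `^ p by exact: powR_ge0.
have pw x : Z x -> (X <= 2%:E * D x + 2%:E * (cst (k `^ p * (n%:R * a))%:E x))%E.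
  move=> [Px uxk]; rewrite /B /= in uxk.
  have -> : (cst (k `^ p * (n%:R * a))%:E x = \int[mu]_(y in P) (cst (k `^ p)%:E y))%E.
    by rewrite (integral_cst_in _ mpiece mu_piece) -EFinM mulrC.
  have mP := mpiece.
  rewrite -ge0_int_lin//; last 2 first.
  - exact/measurable_EFinP.
  - by move=> y; rewrite /= lee_fin ?sqr_ge0.
  apply: ge0_le_integral => //.
  - apply: measurable_funTS; apply/measurable_EFinP.
    exact: (measurableT_comp (measurable_powR p) mau).
  - apply: measurable_funTS; apply: emeasurable_funD; apply: measurable_funeM => //.
    exact/measurable_EFinP.
  move=> y _; rewrite -!EFinM -EFinD lee_fin /= -v2.
  have vx : v x ^+ 2 <= k `^ p.
    by rewrite v2 ge0_ler_powR ?nnegrE// ltW.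
  have := sqr_ge0 (v y - 2 * v x).
  have -> : (v y - 2 * v x) ^+ 2 = 2 * (v x - v y) ^+ 2 + 2 * v x ^+ 2 - v y ^+ 2 by ring.
  move: ((v x - v y) ^+ 2) (v x ^+ 2) (v y ^+ 2) (k `^ p) vx => *; lra.
have zX : (z%:E * X <= 2%:E * dbl v P P + 2%:E * (z%:E * (k `^ p * (n%:R * a))%:E))%E.
  rewrite -(integral_cst_in X mZ ZE).
  apply: (@le_trans _ _ (\int[mu]_(x in Z)
      (2%:E * D x + 2%:E * (cst (k `^ p * (n%:R * a))%:E x)))%E).
    apply: ge0_le_integral => //.
    - by move=> x _; apply: integral_ge0 => y _; rewrite lee_fin powR_ge0.
    - by apply: measurable_funTS; apply: emeasurable_funD; apply: measurable_funeM.
  rewrite ge0_int_lin//; last by move=> x; rewrite /= lee_fin mulr_ge0// ltW.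
  rewrite (integral_cst_in _ mZ ZE); apply: leeD => //; apply: lee_wpmul2l => //.
  apply: ge0_subset_integral => //; [exact: mpiece|exact: measurable_funTS|exact: subIsetl].
have ac0 : 0 < a * c by rewrite mulr_gt0.
have dc0 : (0 <= dbl v P P)%E by exact: dbl_ge0.
have Xle : (X <= (2 * z^-1)%:E * dbl v P P + (2 * (k `^ p * (n%:R * a)))%:E)%E.
  have zi0 : (0 <= (z^-1)%:E :> \bar R)%E by rewrite lee_fin invr_ge0 ltW.
  have := lee_wpmul2l zi0 zX.
  rewrite muleA -EFinM mulVf ?gt_eqF// mul1e => /le_trans; apply.
  rewrite ge0_muleDr; last 2 first.
  - by rewrite mule_ge0.
  - by rewrite !mule_ge0 ?lee_fin ?mulr_ge0// ltW.
  rewrite muleA -!EFinM (mulrC z^-1); apply: leeD => //.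
  by rewrite lee_fin mulrCA (mulrA z^-1) mulVf ?gt_eqF// mul1r.
apply: (le_trans Xle); apply: leeD; last first.
  by rewrite -EFinM lee_fin; exact: powR_mean_le.
apply: (@le_trans _ _ ((2 * z^-1)%:E * ((n%:R ^+ 3 * c^-1 * 2)%:E * WP v))%E).
  by apply: lee_wpmul2l; [rewrite lee_fin mulr_ge0// invr_ge0 ltW|exact: dbl_piece].
rewrite muleA -EFinM; apply: lee_wpmul2r; first exact: WP0.
have nR : 0 < n%:R :> R by rewrite ltr0n.
rewrite lee_fin; apply: (@le_trans _ _ (2 * (n%:R * a / 2)^-1 * (n%:R ^+ 3 * c^-1 * 2))).
  apply: ler_wpM2r; first by rewrite !mulr_ge0 ?exprn_ge0 ?invr_ge0// ltW.
  by rewrite ler_wpM2l// lef_pV2// posrE// divr_gt0.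
rewrite le_eqVlt; apply/orP; left; apply/eqP.
by move: (n%:R : R) nR => N N0; field; rewrite !gt_eqF.
Qed.

End Piece.
End Chain.
End Pieces.

(** * Nash's inequality on the graph *)

Section ChainUnion.
Context d (T : measurableType d) (R : realType).
Variables (mu : {sigma_finite_measure set T -> \bar R}) (K : T -> T -> R) (M : R).
Hypothesis hK : symmetric_kernel mu K M.
Variables (Cl : nat -> set T) (a c : R).
Hypotheses (a0 : 0 < a) (c0 : 0 < c) (mC : forall i, measurable (Cl i)).
Hypotheses (muC : forall i, mu (Cl i) = a%:E) (tC : trivIset setT Cl).
Hypothesis Kdiag : forall i x y, Cl i x -> Cl i y -> c <= K x y.
Hypothesis Knext : forall i x y, Cl i x -> Cl i.+1 y -> c <= K x y.

(** Euclidean division of the index by n groups the cells into disjoint pieces; both terms of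
    [piece_bound] add up over them. *)
Lemma chain_bound (n : nat) (p A : R) (u : T -> R) : (0 < n)%N -> 1 <= p -> 0 <= A ->
  measurable_fun setT u -> (\int[mu]_(x in \bigcup_i Cl i) `|u x|%:E <= A%:E)%E ->
  (\int[mu]_(x in \bigcup_i Cl i) (`|u x| `^ p)%:E <=
    (8 * n%:R ^+ 2 * (a * c)^-1)%:E *
      \int[mu]_(x in \bigcup_i Cl i) dissipation mu K (fun x => (`|u x| `^ (p / 2))%R) x +
    (2 * 2 `^ p * (n%:R * a) `^ (1 - p) * A `^ (p - 1))%:E *
      \int[mu]_(x in \bigcup_i Cl i) `|u x|%:E)%E.
Proof.
move=> n0 p1 A0 mu_; pose P k := \big[setU/set0]_(i <- index_iota 0 n) Cl (k * n + i)%N.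
have PE k x : P k x <-> exists2 i, (i < n)%N & Cl (k * n + i)%N x.
  rewrite /P -bigcup_seq; split=> [[i /=]|[i ilt Ci]].
    by rewrite mem_index_iota /= => ilt Ci; exists i.
  by exists i => //=; rewrite mem_index_iota.
have UE : \bigcup_i Cl i = \bigcup_k P k.
  apply/seteqP; split=> x [j _ h].
    by exists (j %/ n)%N => //; apply/PE; exists (j %% n)%N; rewrite ?ltn_mod// -divn_eq.
  by move/PE: h => [i _ h]; exists (j * n + i)%N.
have tP : trivIset setT P.
  move=> k l _ _ [x [/PE[i ilt Ci] /PE[j jlt Cj]]].
  have := tC I I (ex_intro _ x (conj Ci Cj)) => /(congr1 (fun m => m %/ n)%N).
  by rewrite !divnMDl// !divn_small// !addn0.
have mP k : measurable (P k) by apply: bigsetU_measurable => i _; exact: mC.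
rewrite UE => uA.
have mau : measurable_fun setT (fun x => `|u x|).
  exact: (measurableT_comp (@normr_measurable _ _) mu_).
have mUP : measurable (\bigcup_k P k) by exact: bigcupT_measurable.
have split_int (F : T -> \bar R) : measurable_fun setT F -> (forall x, 0 <= F x)%E ->
    (\int[mu]_(x in \bigcup_k P k) F x = \sum_(k <oo) \int[mu]_(x in P k) F x)%E.
  by move=> mF F0; apply: ge0_integral_bigcup => //; exact: measurable_funTS.
set v := fun x => `|u x| `^ (p / 2).
have mv : measurable_fun setT v := measurableT_comp (measurable_powR (p / 2)) mau.
have mD := measurable_dissipation hK mv.
have D0 := dissipation_ge0 hK v.
rewrite !split_int//; last 2 first.
- exact/measurable_EFinP.
- by apply/measurable_EFinP; exact: (measurableT_comp (measurable_powR p) mau).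
have uP k : (\int[mu]_(x in P k) `|u x|%:E <= A%:E)%E.
  apply: le_trans uA; apply: ge0_subset_integral => //.
  - by apply: measurable_funTS; exact/measurable_EFinP.
  - by move=> x Px; exists k.
have I0 k : (0 <= \int[mu]_(x in P k) `|u x|%:E)%E.
  by apply: integral_ge0 => x _; rewrite lee_fin.
have J0 k : (0 <= \int[mu]_(x in P k) dissipation mu K v x)%E.
  by apply: integral_ge0 => x _; exact: D0.
have k1 : (0 <= (8 * n%:R ^+ 2 * (a * c)^-1)%:E :> \bar R)%E.
  by rewrite lee_fin mulr_ge0 ?invr_ge0 ?mulr_ge0 ?exprn_ge0// ltW.
have k2 : (0 <= (2 * 2 `^ p * (n%:R * a) `^ (1 - p) * A `^ (p - 1))%:E :> \bar R)%E.
  by rewrite lee_fin !mulr_ge0 ?powR_ge0.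
rewrite -!nneseriesZl// -nneseriesD; last 2 first.
- by move=> k _ _; rewrite mule_ge0.
- by move=> k _ _; rewrite mule_ge0.
apply: lee_nneseries => [k _ _|k _]; first by apply: integral_ge0 => x _; rewrite lee_fin powR_ge0.
apply: (piece_bound hK a0 c0) => //.
- move=> i j _ _ h; have /(congr1 (fun m => (m - k * n)%N)) := tC I I h.
  by rewrite !addKn.
- by move=> i x y; exact: Kdiag.
- by move=> i x y; rewrite addnS; exact: Knext.
- exact: uP.
Qed.

End ChainUnion.

Section GraphNash.
Context (R : realType) (G : metric_graph R) (e0 : edge G) (J : R -> R).
Hypotheses (hG : graph_axioms G) (hJ : kernel_axioms J) (he0 : term e0 = None).
Local Notation T := (gspace e0).
Local Notation leb := (@lebesgue_measure R).
Local Notation mu := (gmeasure (e0 := e0)).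
Local Notation K := (gkernel J).

Let hK : symmetric_kernel mu K _ := symmetric_gkernel e0 hG hJ.

(** The radius 3 a accommodates neighbouring cells of length a, and points within a of two centres
    at mutual distance at most a. *)
Lemma gkernel_lower : exists2 a, 0 < a & exists2 c, 0 < c &
  forall x y : T, gdist (cpoint x) (cpoint y) <= 3 * a -> c <= K x y.
Proof.
have /nbhs_ballP[r /= r0 rJ] := kernel_gt0_near0 hJ.
have J00 : 0 < J 0 by apply: rJ; rewrite -ball_normE /= subrr normr0.
have Jr : 0 < J (r / 2).
  by apply: rJ; rewrite -ball_normE /= sub0r normrN gtr0_norm ?divr_gt0// ltr_pdivrMr// ltr_pMr// ltr1n.
exists (r / 6); first by rewrite divr_gt0.
(* Monotonicity of J is known for positive arguments only, so [J 0] enters separately. *)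
exists (Num.min (J 0) (J (r / 2))); first by rewrite lt_min J00.
move=> x y; rewrite /gkernel; have := gdist_ge0 hG (cpoint_in hG x) (cpoint_in hG y).
move: (gdist _ _) => z; rewrite le_eqVlt => /predU1P[<- _|z0 zr].
  by rewrite ge_min lexx.
rewrite ge_min; apply/orP; right; apply: (kernel_nonincreasing hJ) => //.
by move: zr; have -> : 3 * (r / 6) = r / 2 by field.
Qed.

Definition eset (e : edge G) (S : set R) : set T := [set y | y.1 = e /\ S y.2].

Lemma eset_section e S f : [set s | eset e S (f, s)] = if f == e then S else set0.
Proof.
case: eqVneq => [->|/eqP ne]; apply/seteqP; split=> s //=; first by case.
by case.
Qed.

Lemma measurable_eset e S : measurable S -> measurable (eset e S).
Proof.
move=> mS; have h f : measurable [set s | eset e S (f, s)].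
  by rewrite eset_section; case: ifP.
exact: h.
Qed.

Lemma measurable_edge_itv e : measurable (edge_itv (G := G) e).
Proof. by rewrite /edge_itv; case: (term e) => [[v l]|]. Qed.

Lemma gmeasure_eset e S : measurable S -> mu (eset e S) = leb (S `&` edge_itv e).
Proof.
move=> mS; rewrite gmeasureE (bigD1 e)//= eset_section eqxx big1 ?adde0// => f /negPf fe.
by rewrite eset_section fe set0I measure0.
Qed.

Lemma integral_eset e S (g : T -> \bar R) : measurable S ->
  measurable_fun setT g -> (forall x, 0 <= g x)%E ->
  (\int[mu]_(x in eset e S) g x = \int[leb]_(s in edge_itv e `&` S) g (e, s))%E.
Proof.
move=> mS mg g0; rewrite integral_gmeasure//; last exact: measurable_eset.
rewrite (bigD1 e)//= eset_section eqxx big1 ?adde0// => f /negPf fe.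
by rewrite eset_section fe setI0 integral_set0.
Qed.

Lemma integral_edges (g : T -> \bar R) : measurable_fun setT g -> (forall x, 0 <= g x)%E ->
  (\int[mu]_x g x = \sum_(e : edge G) \int[mu]_(x in eset e (edge_itv e)) g x)%E.
Proof.
move=> mg g0; rewrite integral_gmeasure//; apply: eq_bigr => e _.
rewrite integral_eset//; last exact: measurable_edge_itv.
congr integral; apply/seteqP; split=> s /=; first by case.
by case.
Qed.

Lemma dissipation_form_le S (v : T -> R) : measurable S -> measurable_fun setT v ->
  (\int[mu]_(x in S) dissipation mu K v x <= form mu K v)%E.
Proof.
move=> mS mv; apply: ge0_subset_integral => //.
- exact: (measurable_dissipation hK).
- by move=> x _; exact: (dissipation_ge0 hK).
Qed.

Section Scale.
Variables (a c : R).
Hypotheses (a0 : 0 < a) (c0 : 0 < c).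
Hypothesis cK : forall x y : T, gdist (cpoint x) (cpoint y) <= 3 * a -> c <= K x y.

Lemma cpoint_id (x : gpoint G) : x.2 \in edge_itv x.1 -> cpoint x = x.
Proof. by case: x => e s /= se; rewrite /cpoint /= clamp_id. Qed.

Let cell e i := eset e `[i%:R * a, i.+1%:R * a[.

Lemma cell_cover e : term e = None -> \bigcup_i cell e i = eset e (edge_itv e).
Proof.
move=> te; rewrite /edge_itv te; apply/seteqP; split=> [[f s] [i _ [/= -> ]]|[f s] [/= ->]].
  rewrite /= !in_itv/= ?andbT => /andP[h _]; split=> //; rewrite /= in_itv/= andbT; apply: le_trans h.
  by rewrite mulr_ge0// ltW.
rewrite /= in_itv/= andbT => s0; exists (Num.truncn (s / a)) => //; split=> //=.
have := @truncn_itv _ (s / a); rewrite divr_ge0 ?(ltW a0)// => /(_ isT) /andP[h1 h2].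
by rewrite in_itv/= -ler_pdivlMr// h1 -ltr_pdivrMr.
Qed.

Lemma ray_bound e (n : nat) (p A : R) (u : T -> R) : term e = None ->
  (0 < n)%N -> 1 <= p -> 0 <= A -> measurable_fun setT u ->
  (\int[mu]_x `|u x|%:E <= A%:E)%E ->
  (\int[mu]_(x in eset e (edge_itv e)) (`|u x| `^ p)%:E <=
    (8 * (a * c)^-1 * n%:R ^+ 2)%:E * form mu K (fun x => (`|u x| `^ (p / 2))%R) +
    (2 * 2 `^ p * a `^ (1 - p) * A `^ p * n%:R `^ (1 - p))%:E)%E.
Proof.
move=> te n0 p1 A0 mu_ uA.
have mE : measurable (eset e (edge_itv e)).
  by apply: measurable_eset; exact: measurable_edge_itv.
have mau : measurable_fun setT (fun x => `|u x|).
  exact: (measurableT_comp (@normr_measurable _ _) mu_).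
have mv : measurable_fun setT (fun x => `|u x| `^ (p / 2)).
  exact: (measurableT_comp (measurable_powR (p / 2)) mau).
have uA' : (\int[mu]_(x in eset e (edge_itv e)) `|u x|%:E <= A%:E)%E.
  apply: le_trans uA; apply: ge0_subset_integral => //; exact/measurable_EFinP.
have cellin i x : cell e i x -> cpoint x = x /\ i%:R * a <= x.2 /\ x.2 < i.+1%:R * a /\ x.1 = e.
  move=> [xe]; rewrite /= in_itv/= => /andP[h1 h2]; split=> //; apply: cpoint_id.
  apply/edge_itvP; split; last by move=> v l; rewrite xe te.
  by apply: le_trans h1; rewrite mulr_ge0// ltW.
have near i j x y : cell e i x -> cell e j y -> `|x.2 - y.2| <= 3 * a -> c <= K x y.
  move=> /cellin[xx [_ [_ xe]]] /cellin[yy [_ [_ ye]]] h; apply: cK.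
  have := cpoint_in hG x; have := cpoint_in hG y; rewrite xx yy.
  move: x y xe ye h {xx yy} => [f s] [f' t] /= -> -> h tG sG.
  exact: le_trans (gdist_segment sG tG) h.
rewrite -(cell_cover te) in uA' mE *.
have h := @chain_bound _ _ _ mu K _ hK (cell e) a c a0 c0 _ _ _ _ _ n p A u n0 p1 A0 mu_ uA'.
apply: (le_trans (h _ _ _ _ _)).
- by move=> i; apply: measurable_eset.
- move=> i; apply: etrans (gmeasure_eset _ _) _; first exact: measurable_itv.
  rewrite setIidl; last first.
    move=> s /=; rewrite /edge_itv te /= !in_itv/= andbT => /andP[h1 _].
    by apply: le_trans h1; rewrite mulr_ge0// ltW.
  rewrite lebesgue_measure_itv/= lte_fin ltr_pM2r// ltr_nat ltnSn -EFinB -mulrBl.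
  by rewrite -natr1 (addrC i%:R) addrK mul1r.
- move=> i j _ _ [x [/cellin[_ [h1 [h2 _]]] /cellin[_ [h3 [h4 _]]]]].
  have lt_trans_nat (k l : nat) : k%:R * a <= x.2 -> x.2 < l.+1%:R * a -> (k <= l)%N.
    by move=> k1 k2; have := le_lt_trans k1 k2; rewrite ltr_pM2r// ltr_nat.
  by apply/eqP; rewrite eqn_leq !lt_trans_nat.
- move=> i x y xi yi; apply: (near _ _ _ _ xi yi).
  move: xi yi => /cellin[_ [h1 [h2 _]]] /cellin[_ [h3 [h4 _]]].
  move: h1 h2 h3 h4; rewrite -natr1; move: (i%:R : R) => I h1 h2 h3 h4.
  by rewrite ler_norml; apply/andP; split; lra.
- move=> i x y xi yi; apply: (near _ _ _ _ xi yi).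
  move: xi yi => /cellin[_ [h1 [h2 _]]] /cellin[_ [h3 [h4 _]]].
  move: h1 h2 h3 h4; rewrite -!natr1; move: (i%:R : R) => I h1 h2 h3 h4.
  by rewrite ler_norml; apply/andP; split; lra.
apply: leeD.
  have -> : 8 * n%:R ^+ 2 * (a * c)^-1 = 8 * (a * c)^-1 * n%:R ^+ 2 :> R by ring.
  apply: lee_wpmul2l; last exact: dissipation_form_le.
  by rewrite lee_fin !mulr_ge0 ?invr_ge0 ?mulr_ge0 ?exprn_ge0// ltW.
have k0 : 0 <= 2 * 2 `^ p * (n%:R * a) `^ (1 - p) * A `^ (p - 1).
  by rewrite !mulr_ge0 ?powR_ge0.
apply: (le_trans (lee_wpmul2l (k0 : (0 <= _%:E)%E) uA')).
rewrite -EFinM lee_fin powRM ?(ltW a0)//.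
have -> : A `^ p = A `^ (p - 1) * A.
  move: A0; rewrite le_eqVlt => /predU1P[<-|A0].
    by rewrite mulr0 powR0// gt_eqF// (lt_le_trans ltr01).
  have := @powRD _ A (p - 1) 1; rewrite subrK powRr1 ?(ltW A0)// => -> //.
  by rewrite (gt_eqF A0) implybT.
by rewrite le_eqVlt; apply/orP; left; apply/eqP; ring.
Qed.

(** Not the metric ball: it stays inside one edge and never crosses a vertex. *)
Let gball (x : gpoint G) : set T := eset x.1 (edge_itv x.1 `&` `[x.2 - a, x.2 + a]).

Let mgball x : measurable (gball x).
Proof.
by apply: measurable_eset; apply: measurableI => //; exact: measurable_edge_itv.
Qed.

Lemma gball_measure x : x.2 \in edge_itv x.1 -> exists2 m, 0 < m & mu (gball x) = m%:E.
Proof.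
move=> xG; have mI : measurable (edge_itv x.1 `&` `[x.2 - a, x.2 + a]).
  by apply: measurableI => //; exact: measurable_edge_itv.
have upper : (mu (gball x) <= (2 * a)%:E)%E.
  apply: le_trans (_ : (leb `[(x.2 - a)%R, (x.2 + a)%R] <= _)%E).
    rewrite gmeasure_eset//; apply: le_measure; rewrite ?inE//.
      by apply: measurableI => //; exact: measurable_edge_itv.
    by move=> s [[]].
  rewrite lebesgue_measure_itv/=; case: ifP => _; last by rewrite lee_fin mulr_ge0// ltW.
  by rewrite -EFinB lee_fin le_eqVlt; apply/orP; left; apply/eqP; ring.
have lower (s t : R) : s < t -> s \in edge_itv x.1 -> t \in edge_itv x.1 ->
    x.2 - a <= s -> t <= x.2 + a -> (0 < mu (gball x))%E.
  move=> st /edge_itvP[s0 _] /edge_itvP[_ tl] xs tx.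
  apply: (@lt_le_trans _ _ (leb `[s, t])).
    by rewrite lebesgue_measure_itv/= lte_fin st -EFinB lte_fin subr_gt0.
  rewrite gmeasure_eset//; apply: le_measure; rewrite ?inE//.
    by apply: measurableI => //; exact: measurable_edge_itv.
  move=> r /=; rewrite !in_itv/= => /andP[sr rt].
  have rE : edge_itv x.1 r.
    by apply/set_mem/edge_itvP; split=> [|v l /tl]; [exact: le_trans sr|exact: le_trans rt].
  by split=> //; split=> //; rewrite (le_trans xs sr) (le_trans rt tx).
have fin : mu (gball x) = (fine (mu (gball x)))%:E.
  by apply: ge0_fineE => //; apply: le_lt_trans upper _; rewrite ltry.
have pos : (0 < mu (gball x))%E.
  case te : (term x.1) => [[v l]|]; last first.
    have /edge_itvP[x0 _] := xG.
    apply: (lower x.2 (x.2 + a)) => //; rewrite ?ltrDl ?gerBl ?(ltW a0)//.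
    by apply/edge_itvP; split=> [|v l]; [rewrite addr_ge0// ltW|rewrite te].
  have l0 := length_gt0 hG te; have /edge_itvP[x0 /(_ _ _ te) xl] := xG.
  have inE_ t : 0 <= t -> t <= l -> t \in edge_itv x.1.
    by move=> t0 tl; apply/edge_itvP; split=> // w m; rewrite te => -[_ <-].
  (* The ball may be cut by an end of the edge, but towards the farther end at least half the edge
     remains. *)
  have [xl2|xl2] := leP x.2 (l / 2).
    have m0 : 0 < Num.min a (l / 2) by rewrite lt_min a0 divr_gt0.
    have ma : Num.min a (l / 2) <= a by rewrite ge_min lexx.
    have ml : Num.min a (l / 2) <= l / 2 by rewrite ge_min lexx orbT.
    by apply: (lower x.2 (x.2 + Num.min a (l / 2))) => //; [lra|apply: inE_; lra|lra|lra].
  have m0 : 0 < Num.min a (l / 2) by rewrite lt_min a0 divr_gt0.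
  have ma : Num.min a (l / 2) <= a by rewrite ge_min lexx.
  have ml : Num.min a (l / 2) <= l / 2 by rewrite ge_min lexx orbT.
  by apply: (lower (x.2 - Num.min a (l / 2)) x.2) => //; [lra|apply: inE_; lra|lra|lra].
by exists (fine (mu (gball x))) => //; rewrite -lte_fin -fin.
Qed.

Let Q := gball (e0, 0).

Let sq_int S (v : T -> R) : \bar R := (\int[mu]_(x in S) (v x ^+ 2)%:E)%E.

Let sq_int0 S v : (0 <= sq_int S v)%E.
Proof. by apply: integral_ge0 => x _; rewrite lee_fin sqr_ge0. Qed.

Let msq (v : T -> R) : measurable_fun setT v ->
  measurable_fun setT (fun x => (v x ^+ 2)%:E).
Proof. by move=> mv; apply/measurable_EFinP; exact: measurable_funX. Qed.

(* Connectedness enters here: control passes from a ball to any ball whose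
   centre is within distance a, hence along paths from the ray e0. *)
Let controlled S := measurable S /\ exists2 C, 0 <= C &
  forall v, measurable_fun setT v -> (sq_int S v <= C%:E * (form mu K v + sq_int Q v))%E.

Lemma controlled_sub S S' : measurable S' -> S' `<=` S -> controlled S -> controlled S'.
Proof.
move=> mS' SS' [mS [C C0 hC]]; split=> //; exists C => // v mv.
apply: le_trans (hC v mv); apply: ge0_subset_integral => //.
  by apply: measurable_funTS; exact: msq.
by move=> x _; rewrite lee_fin sqr_ge0.
Qed.

Lemma controlledU S S' : controlled S -> controlled S' -> controlled (S `|` S').
Proof.
move=> [mS [C C0 hC]] [mS' [C' C'0 hC']]; split; first exact: measurableU.
exists (C + C'); first exact: addr_ge0.
move=> v mv; apply: (@le_trans _ _ (sq_int S v + sq_int S' v)%E); last first.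
  by rewrite EFinD ge0_muleDl ?lee_fin//; apply: leeD; [exact: hC|exact: hC'].
have -> : S `|` S' = S `|` (S' `\` S).
  apply/seteqP; split=> x [h|h]; [by left| |by left|by case: h; right].
  by have [k|k] := pselect (S x); [left|right].
rewrite /sq_int ge0_integral_setU//; last 4 first.
- exact: measurableD.
- by apply: measurable_funTS; exact: msq.
- by move=> x _; rewrite lee_fin sqr_ge0.
- by apply/disj_setPS => x [h [_ k]].
apply: leeD => //; apply: ge0_subset_integral => //.
- exact: measurableD.
- by apply: measurable_funTS; exact: msq.
- by move=> x _; rewrite lee_fin sqr_ge0.
Qed.

(** Points of the two balls are at distance at most 3 a, where K >= c; [two_sets] with th = 1 then
    transfers the bound, the double integral being paid by the form. *)
Lemma controlled_link x y : x.2 \in edge_itv x.1 -> y.2 \in edge_itv y.1 ->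
  gdist x y <= a -> controlled (gball x) -> controlled (gball y).
Proof.
move=> xG yG xy [mS [C C0 hC]]; split=> //.
have [m m0 mE] := gball_measure xG; have [m' m'0 m'E] := gball_measure yG.
have Kc x' y' : gball x x' -> gball y y' -> c <= K x' y'.
  case: x x' y y' xG yG xy {mS hC mE m'E} => [e s] [e' s'] [f t] [f' t'] /= sG tG st.
  move=> [/= -> [/mem_edge_itv s'G]] + [/= -> [/mem_edge_itv t'G]].
  rewrite /= !in_itv/= => /andP[h1 h2] /andP[h3 h4].
  apply: cK; rewrite !cpoint_id//.
  have ss : `|s' - s| <= a by rewrite ler_norml; apply/andP; split; lra.
  have tt : `|t - t'| <= a by rewrite ler_norml; apply/andP; split; lra.
  have d1 := gdist_segment s'G sG; have d2 := gdist_segment tG t'G.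
  have d3 := @gdist_triangle _ _ hG (e, s') (e, s) (f, t') s'G sG t'G.
  have d4 := @gdist_triangle _ _ hG (e, s) (f, t) (f, t') sG tG t'G.
  lra.
exists (m^-1 * (2 * m' * C + 2 * c^-1)).
  by rewrite mulr_ge0 ?invr_ge0 ?addr_ge0 ?mulr_ge0 ?invr_ge0// ltW.
move=> v mv; set X := (form mu K v + sq_int Q v)%E.
have mi0 : 0 <= m^-1 by rewrite invr_ge0 ltW.
have h := two_sets ltr01 (mgball x) (mgball y) mE m'E mv.
have -> : (sq_int (gball y) v = (m^-1)%:E * (m%:E * sq_int (gball y) v))%E.
  by rewrite muleA -EFinM mulVf ?gt_eqF// mul1e.
rewrite EFinM -muleA; apply: lee_wpmul2l; first by rewrite lee_fin.
apply: (le_trans h); rewrite invr1.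
have c20 : 0 <= 2 * c^-1 by rewrite mulr_ge0// invr_ge0 ltW.
have c10 : 0 <= 2 * m' * C by rewrite !mulr_ge0// ltW.
have -> : 1 + 1 = 2 :> R by [].
rewrite (EFinD (2 * m' * C)) ge0_muleDl ?lee_fin//; apply: leeD.
  rewrite muleA -EFinM (EFinM (2 * m')) -muleA; apply: lee_wpmul2l; last exact: hC.
  by rewrite lee_fin mulr_ge0// ltW.
rewrite EFinM -muleA; apply: lee_wpmul2l => //.
apply: (le_trans (dbl_le_dissipation hK c0 (mgball x) (mgball y) mv Kc)).
apply: lee_wpmul2l; first by rewrite lee_fin invr_ge0 ltW.
by apply: (le_trans (dissipation_form_le (mgball x) mv)); rewrite leeDl// sq_int0.
Qed.

Lemma controlled_segment n e s t : s \in edge_itv e -> t \in edge_itv e ->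
  `|s - t| <= n%:R * a -> controlled (gball (e, s)) -> controlled (gball (e, t)).
Proof.
elim: n s => [|n IH] s sG tG st cs.
  move: st; rewrite mul0r normr_le0 subr_eq0 => /eqP <-; exact: cs.
have [sta|sta] := leP `|s - t| a.
  by apply: controlled_link cs => //; exact: le_trans (gdist_segment sG tG) sta.
have /edge_itvP[s0 sl] := sG; have /edge_itvP[t0 tl] := tG.
pose s' := if s < t then s + a else s - a.
have s'G : s' \in edge_itv e.
  apply/edge_itvP; split=> [|v l tel].
    move: sta; rewrite /s'; case: (ltrP s t) => h.
      by move=> _; rewrite addr_ge0// ltW.
    lra.
  have := sl v l tel; have := tl v l tel; move: sta; rewrite /s'; case: (ltrP s t) => h h1 h2 h3.
    by apply: le_trans h2; rewrite -lerBrDl ltW.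
  by apply: le_trans h3; rewrite gerBl ltW.
apply: (IH s') => //.
  move: st sta; rewrite -natr1 mulrDl mul1r; move: (n%:R * a) => na.
  rewrite /s'; case: (ltrP s t) => h.
    by move=> h1 h2; rewrite ler_norml; apply/andP; split; lra.
  by move=> h1 h2; rewrite ler_norml; apply/andP; split; lra.
apply: controlled_link cs => //; apply: le_trans (gdist_segment sG s'G) _.
rewrite /s'; case: ifP => _.
  by rewrite opprD addrA subrr sub0r normrN gtr0_norm.
by rewrite opprB addrC subrK gtr0_norm.
Qed.

(** Follows a path from the start of [e0]: a segment is cut into links of length at most a, and a
    vertex switch is one link of length 0. *)
Lemma controlled_gball x : x.2 \in edge_itv x.1 -> controlled (gball x).
Proof.
move=> xG; have [l] := @path_exists _ _ hG (e0, 0) x (edge_itv0 hG e0) xG.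
have cQ : controlled Q.
  split; first exact: mgball.
  by exists 1 => // v mv; rewrite mul1e leeDr//; exact: (form_ge0 hK).
move=> p; have : controlled (gball (e0, 0)) -> controlled (gball x); last by apply.
elim: p => {x xG l} [//|e s t y l sG tG _ IH cs|x x' v y l xv x'v _ IH cx].
  apply: IH; apply: (@controlled_segment (Num.truncn (`|s - t| / a)).+1 _ s) => //.
  by rewrite -ler_pdivrMr// ltW//; have /andP[] := truncn_itv (divr_ge0 (normr_ge0 (s - t)) (ltW a0)).
apply: IH; apply: controlled_link cx; [exact: at_vertex_in xv|exact: at_vertex_in x'v|].
exact: le_trans (gdist_vertex hG xv x'v) (ltW a0).
Qed.

Lemma controlled_initial e n : controlled (eset e (edge_itv e `&` `[0, n%:R * a])).
Proof.
have mI k : measurable (eset e (edge_itv e `&` `[0, k%:R * a])).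
  by apply: measurable_eset; apply: measurableI => //; exact: measurable_edge_itv.
elim: n => [|n IH].
  apply: (controlled_sub (mI 0%N) _ (@controlled_gball (e, 0) (edge_itv0 hG e))).
  move=> [f s] [/= -> [sG]]; rewrite /= in_itv/= mul0r => /andP[s0 s1]; split=> //.
  by split=> //; rewrite /= in_itv/=; apply/andP; split; move: a0; lra.
have [nG|nG] := pselect (n%:R * a \in edge_itv e).
  apply: (controlled_sub (mI n.+1) _ (controlledU IH (@controlled_gball (e, n%:R * a) nG))).
  move=> [f s] [/= -> [sG]]; rewrite /= in_itv/= -natr1 mulrDl mul1r => /andP[s0 s1].
  have [sn|sn] := leP s (n%:R * a); [left|right].
    by split=> //; split=> //=; rewrite in_itv/= s0.
  split=> //; split=> //=; rewrite in_itv/= s1 andbT.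
  by move: a0; lra.
(* If n a is not a coordinate of the edge, the edge is shorter than n a and the set has stopped
   growing. *)
apply: (controlled_sub (mI n.+1) _ IH) => -[f s] [/= -> [sG]]; rewrite /= in_itv/= => /andP[s0 s1].
split=> //; split=> //=; rewrite in_itv/= s0 /= leNgt; apply/negP => ns; apply: nG.
apply/edge_itvP; split; first by rewrite mulr_ge0// ltW.
by move=> v l te; have /edge_itvP[_ /(_ _ _ te)] := mem_edge_itv sG; apply: le_trans; exact: ltW.
Qed.

Lemma controlled_edge e : term e <> None -> controlled (eset e (edge_itv e)).
Proof.
case te : (term e) => [[v l]|//] _; have l0 := length_gt0 hG te.
have := controlled_initial e (Num.truncn (l / a)).+1.
apply: controlled_sub; first by apply: measurable_eset; exact: measurable_edge_itv.
move=> [f s] [/= -> sG]; split=> //; split=> //=.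
have /edge_itvP[s0 /(_ _ _ te) sl] := mem_edge_itv sG.
rewrite in_itv/= s0 /= (le_trans sl)// -ler_pdivrMr// ltW//.
by have /andP[] := truncn_itv (divr_ge0 (ltW l0) (ltW a0)).
Qed.

(** A finite edge is controlled by the form and by [Q]. As n >= 1, the form is absorbed in n^2 times
    itself; as [Q] lies on the ray [e0], its contribution obeys the bound for rays. *)
Lemma edge_bound e (p : R) : 1 <= p -> exists2 C, 0 <= C &
  forall (u : T -> R) (A : R) (n : nat), measurable_fun setT u -> 0 <= A -> (0 < n)%N ->
    (\int[mu]_x `|u x|%:E <= A%:E)%E ->
    (\int[mu]_(x in eset e (edge_itv e)) (`|u x| `^ p)%:E <=
      C%:E * ((n%:R ^+ 2)%:E * form mu K (fun x => (`|u x| `^ (p / 2))%R)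
        + (A `^ p * n%:R `^ (1 - p))%:E))%E.
Proof.
move=> p1; pose C1 := 8 * (a * c)^-1; pose C2 := 2 * 2 `^ p * a `^ (1 - p).
have C10 : 0 <= C1 by rewrite mulr_ge0 ?invr_ge0 ?mulr_ge0// ltW.
have C20 : 0 <= C2 by rewrite !mulr_ge0 ?powR_ge0.
have Z0 (u : T -> R) (n : nat) : (0 <= (n%:R ^+ 2)%:E * form mu K u)%E.
  by rewrite mule_ge0 ?lee_fin ?exprn_ge0// (form_ge0 hK).
have ray f : term f = None -> forall (u : T -> R) (A : R) (n : nat),
    measurable_fun setT u -> 0 <= A -> (0 < n)%N ->
    (\int[mu]_x `|u x|%:E <= A%:E)%E ->
    (\int[mu]_(x in eset f (edge_itv f)) (`|u x| `^ p)%:E <=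
      (C1 + C2)%:E * ((n%:R ^+ 2)%:E * form mu K (fun x => (`|u x| `^ (p / 2))%R)
        + (A `^ p * n%:R `^ (1 - p))%:E))%E.
  move=> tf u A n mu_ A0 n0 uA; apply: (le_trans (ray_bound tf n0 p1 A0 mu_ uA)).
  have t0 : (0 <= (A `^ p * n%:R `^ (1 - p))%:E)%E by rewrite lee_fin mulr_ge0 ?powR_ge0.
  rewrite (ge0_muleDr _ (Z0 _ n) t0); apply: leeD.
    rewrite EFinM -muleA; apply: lee_wpmul2r; first exact: Z0.
    by rewrite lee_fin lerDl.
  rewrite -EFinM lee_fin -mulrA; apply: ler_wpM2r; first by rewrite mulr_ge0 ?powR_ge0.
  by rewrite lerDr.
case te : (term e) => [vl|]; last first.
  by exists (C1 + C2); [rewrite addr_ge0|exact: ray].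
have [|_ [C C0 hC]] := @controlled_edge e; first by rewrite te.
exists (C * (1 + (C1 + C2))); first by rewrite mulr_ge0 ?addr_ge0.
move=> u A n mu_ A0 n0 uA; set v := fun x => `|u x| `^ (p / 2).
have mau : measurable_fun setT (fun x => `|u x|).
  exact: (measurableT_comp (@normr_measurable _ _) mu_).
have mv : measurable_fun setT v := measurableT_comp (measurable_powR (p / 2)) mau.
have v2 x : v x ^+ 2 = `|u x| `^ p.
  by rewrite /v -powR_mulrn ?powR_ge0// -powRrM mulfVK.
set E := ((n%:R ^+ 2)%:E * form mu K v + (A `^ p * n%:R `^ (1 - p))%:E)%E.
have t0 : (0 <= (A `^ p * n%:R `^ (1 - p))%:E)%E by rewrite lee_fin mulr_ge0 ?powR_ge0.
have E0 : (0 <= E)%E by rewrite adde_ge0.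
have -> : (\int[mu]_(x in eset e (edge_itv e)) (`|u x| `^ p)%:E =
    sq_int (eset e (edge_itv e)) v)%E by apply: eq_integral => x _; rewrite v2.
apply: (le_trans (hC v mv)); rewrite EFinM -muleA; apply: lee_wpmul2l => //.
rewrite EFinD ge0_muleDl ?lee_fin ?addr_ge0// mul1e; apply: leeD.
  apply: (@le_trans _ _ ((n%:R ^+ 2)%:E * form mu K v)%E); last by rewrite leeDl.
  rewrite -[leLHS]mul1e; apply: lee_wpmul2r; first exact: (form_ge0 hK).
  by rewrite lee_fin exprn_ege1// ler1n.
apply: le_trans (ray e0 he0 u A n mu_ A0 n0 uA); rewrite /sq_int.
rewrite (eq_integral (fun x => (`|u x| `^ p)%:E)); last by move=> x _; rewrite v2.
apply: ge0_subset_integral => //.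
- exact: mgball.
- by apply: measurable_eset; exact: measurable_edge_itv.
- apply: measurable_funTS; apply/measurable_EFinP.
  exact: (measurableT_comp (measurable_powR p) mau).
- by move=> x [xe [xI _]].
Qed.

End Scale.

Theorem graph_nash (p : R) : 1 <= p -> exists2 C, 0 < C & nash_inequality mu K p C.
Proof.
move=> p1; have [a a0 [c c0 cK]] := gkernel_lower.
have ex e := @edge_bound a c a0 c0 cK e p p1.
have /choice[C hC] : forall e, exists C, 0 <= C /\ (forall (u : T -> R) (A : R) (n : nat),
    measurable_fun setT u -> 0 <= A -> (0 < n)%N ->
    (\int[mu]_x `|u x|%:E <= A%:E)%E ->
    (\int[mu]_(x in eset e (edge_itv e)) (`|u x| `^ p)%:E <=
      C%:E * ((n%:R ^+ 2)%:E * form mu K (fun x => (`|u x| `^ (p / 2))%R)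
        + (A `^ p * n%:R `^ (1 - p))%:E))%E).
  by move=> e; have [C C0 h] := ex e; exists C.
have S0 : 0 <= \sum_e C e by apply: sumr_ge0 => e _; exact: (hC e).1.
exists (1 + \sum_e C e); first by rewrite ltr_wpDr.
move=> u A n mu_ A0 n0 uA.
have mau : measurable_fun setT (fun x => `|u x|).
  exact: (measurableT_comp (@normr_measurable _ _) mu_).
set F := form _ _ _; have F0 : (0 <= F)%E by exact: (form_ge0 hK).
set t := A `^ p * n%:R `^ (1 - p); have t0 : 0 <= t by rewrite mulr_ge0 ?powR_ge0.
have E0 : (0 <= (n%:R ^+ 2)%:E * F + t%:E)%E.
  by rewrite adde_ge0 ?lee_fin// mule_ge0 ?lee_fin ?exprn_ge0.
rewrite integral_edges; last 2 first.
- by apply/measurable_EFinP; exact: (measurableT_comp (measurable_powR p) mau).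
- by move=> x; rewrite lee_fin powR_ge0.
apply: (@le_trans _ _ (\sum_(e : edge G) (C e)%:E * ((n%:R ^+ 2)%:E * F + t%:E))%E).
  by apply: lee_sum => e _; exact: (hC e).2.
rewrite -ge0_sume_distrl; last by move=> e _; rewrite lee_fin; exact: (hC e).1.
rewrite sumEFin; set S := \sum_e C e in S0 *.
have nF0 : (0 <= (n%:R ^+ 2)%:E * F)%E by rewrite mule_ge0 ?lee_fin ?exprn_ge0.
apply: (@le_trans _ _ ((1 + S)%:E * ((n%:R ^+ 2)%:E * F + t%:E))%E).
  by apply: lee_wpmul2r => //; rewrite lee_fin lerDr.
by rewrite (ge0_muleDr _ nF0) ?lee_fin// muleA -!EFinM /t [X in X%:E]mulrA (mulrA (1 + S)).
Qed.

End GraphNash.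

(** * From families of functions to functions on the graph *)

Section Transfer.
Context (R : realType) (G : metric_graph R) (e0 : edge G).
Local Notation T := (gspace e0).
Local Notation leb := (@lebesgue_measure R).
Local Notation mu := (gmeasure (e0 := e0)).
Implicit Types (w : gfun G).

Definition lift w : T -> R := fun x => restr w x.1 x.2.

Lemma restrE w e s : s \in edge_itv e -> restr w e s = w e s.
Proof. by move=> h; rewrite /restr patchE h. Qed.

Lemma restr_out w e s : s \notin edge_itv e -> restr w e s = 0.
Proof. by move=> /negPf h; rewrite /restr patchE h. Qed.

Lemma measurable_lift w : (forall e, measurable_fun setT (restr w e)) ->
  measurable_fun setT (lift w).
Proof. by move=> mw; apply/gmeasurable_funP. Qed.

Lemma in_Lp_measurable (p : R) w : in_Lp p w -> forall e, measurable_fun setT (restr w e).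
Proof. by move=> h e; have := sub_Lfun_mfun (h e); rewrite inE. Qed.

Lemma Lp_norm_lift (p : R) w : 0 < p -> (forall e, measurable_fun setT (restr w e)) ->
  Lp_norm p w = ((\int[mu]_x (`|lift w x| `^ p)%:E) `^ p^-1)%E.
Proof.
move=> p0 mw; rewrite /Lp_norm; congr (_ `^ _)%E.
have mp : measurable_fun setT (fun x : T => `|lift w x| `^ p).
  apply: (measurableT_comp (measurable_powR p)).
  by apply: (measurableT_comp (@normr_measurable _ _)); exact: measurable_lift.
rewrite integral_gmeasure//; last first.
  exact/measurable_EFinP.
apply: eq_bigr => e _; rewrite poweR_Lnorm ?gt_eqF//.
have -> : edge_itv e `&` [set s | [set: T] (e, s)] = edge_itv e.
  by apply/seteqP; split=> s // [].
rewrite [RHS]integral_mkcond; apply: eq_integral => s _; rewrite patchE /lift /=.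
by case: ifPn => // h; rewrite restr_out// normr0 powR0// gt_eqF.
Qed.

Lemma Lp_norm_ae (p : R) w w' : 0 < p ->
  (forall e, measurable_fun setT (restr w e)) -> (forall e, measurable_fun setT (restr w' e)) ->
  (forall e, ae_eq leb (edge_itv e) (w e) (w' e)) -> Lp_norm p w = Lp_norm p w'.
Proof.
move=> p0 mw mw' ww'; rewrite /Lp_norm; congr (_ `^ _)%E; apply: eq_bigr => e _.
have pn0 : p != 0 by rewrite gt_eqF.
rewrite !(poweR_Lnorm _ _ pn0).
have mp (f : R -> R) : measurable_fun setT f ->
    measurable_fun setT (fun s => (`|(EFin \o f) s| `^ p)%E).
  move=> mf_; apply/measurable_EFinP; apply: (measurableT_comp (measurable_powR p)).
  exact: (measurableT_comp (@normr_measurable _ _) mf_).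
apply: ae_eq_integral => //; [exact: mp|exact: mp|].
apply: filterS (ww' e) => s h _ /=.
have [sI|sI] := boolP (s \in edge_itv e); last by rewrite !restr_out.
by rewrite !restrE// h//; exact: set_mem.
Qed.

Lemma Lp_norm_fin (p : R) w : 0 < p -> in_Lp p w -> (Lp_norm p w < +oo)%E.
Proof.
move=> p0 h; rewrite /Lp_norm; apply: poweR_lty; apply: lte_sum_pinfty => e _.
by apply: poweR_lty; have := sub_Lfun_finLfun (h e); rewrite inE.
Qed.

Lemma Lp_norm_ge0 (p : R) w : (0 <= Lp_norm p w)%E.
Proof. exact: poweR_ge0. Qed.

Lemma int_le_of_Lp_norm (p e : R) (X : \bar R) : 0 < p -> 0 <= e -> (0 <= X)%E ->
  (X `^ p^-1 <= (e `^ p^-1)%:E)%E -> (X <= e%:E)%E.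
Proof.
move=> p0 ee X0 h.
move: h; case: X X0 => [x| |//]; last by rewrite poweRyr ?invr_eq0 ?gt_eqF.
rewrite poweR_EFin !lee_fin => x0 h.
have := ge0_ler_powR (ltW p0) _ _ h; rewrite !nnegrE !powR_ge0 => /(_ isT isT).
by rewrite -!powRrM mulVf ?gt_eqF// !powRr1.
Qed.

Lemma Rintegral_eset e S (g : T -> R) : measurable S -> measurable_fun setT g ->
  (\int[mu]_(x in eset e S) g x = \int[leb]_(s in edge_itv e `&` S) g (e, s))%R.
Proof.
move=> mS mg; rewrite /Rintegral; congr fine; rewrite integralE [RHS]integralE.
have mg' : measurable_fun setT (EFin \o g) by exact/measurable_EFinP.
have mp := measurable_funepos mg'; have mn := measurable_funeneg mg'.
rewrite (integral_eset e mS mp) ?(integral_eset e mS mn)//.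
by congr (_ - _)%E; apply: eq_integral => s _; rewrite ?funeposE ?funenegE.
Qed.

(** A signed integral splits over edges only if no part is infinite; otherwise real integrals would
    take default values. *)
Lemma Rintegral_edges (g : T -> R) : mu.-integrable setT (EFin \o g) ->
  (\int[mu]_x g x = \sum_(e : edge G) \int[mu]_(x in eset e (edge_itv e)) g x)%R.
Proof.
move=> ig; have mg := measurable_int _ ig.
have mE e : measurable (eset (e0 := e0) e (edge_itv e)).
  by apply: measurable_eset; exact: measurable_edge_itv.
have fin (D : set T) : measurable D -> (\int[mu]_(x in D) (g x)%:E = (\int[mu]_(x in D) g x)%:E)%E.
  move=> mD; rewrite /Rintegral fineK//; apply: integrable_fin_num => //.
  exact: integrableS ig.
apply: EFin_inj; rewrite -fin// -sumEFin (eq_bigr _ (fun e _ => esym (fin _ (mE e)))).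
rewrite integralE integral_edges; last 2 first.
- exact: measurable_funepos.
- by move=> x; exact: funepos_ge0.
rewrite integral_edges; last 2 first.
- exact: measurable_funeneg.
- by move=> x; exact: funeneg_ge0.
rewrite [RHS](eq_bigr _ (fun e _ => integralE _ _ _)).
have ifin (D : set T) (f : T -> \bar R) : measurable D -> mu.-integrable setT f ->
    (\int[mu]_(x in D) f x)%E \is a fin_num.
  by move=> mD i; apply: integrable_fin_num => //; exact: integrableS i.
have ip := integrable_funepos measurableT ig; have in_ := integrable_funeneg measurableT ig.
rewrite (eq_bigr (fun e => (fine (\int[mu]_(x in eset e (edge_itv e)) (EFin \o g)^\+ x))%:E)%E); last first.
  by move=> e _; rewrite fineK// ifin.
rewrite [X in (_ - X)%E](eq_bigr (fun e => (fine (\int[mu]_(x in eset e (edge_itv e)) (EFin \o g)^\- x))%:E)%E); last first.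
  by move=> e _; rewrite fineK// ifin.
rewrite !sumEFin -EFinB -sumrB -sumEFin; apply: eq_bigr => e _.
by rewrite EFinB !fineK// ifin.
Qed.

End Transfer.

(** * Solutions on the graph as abstract evolutions *)

Section GraphEvolution.
Context (R : realType) (G : metric_graph R) (e0 : edge G) (J : R -> R).
Hypotheses (hG : graph_axioms G) (hJ : kernel_axioms J).
Local Notation T := (gspace e0).
Local Notation leb := (@lebesgue_measure R).
Local Notation mu := (gmeasure (e0 := e0)).
Local Notation K := (gkernel J).
Local Notation lift := (lift (e0 := e0)).
Implicit Types (w : gfun G).

Let hK : symmetric_kernel mu K _ := symmetric_gkernel e0 hG hJ.

Lemma nonlocal_opE w e s : (forall f, measurable_fun setT (restr w f)) -> s \in edge_itv e ->
  nonlocal_op J w e s =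
  \sum_(f : edge G) (\int[mu]_(y in eset f (edge_itv f))
     (K (e, s) y * (lift w y - lift w (e, s))))%R.
Proof.
move=> mw sI; apply: eq_bigr => f _.
have mlw := measurable_lift (e0 := e0) mw.
pose x0 : T := (e, s).
have mk : measurable_fun setT (fun y => K x0 y).
  exact: (measurable_section x0 (sk_measurable hK)).
rewrite Rintegral_eset; last 2 first.
- exact: measurable_edge_itv.
- by apply: measurable_funM => //; apply: measurable_funB.
rewrite setIid; apply: eq_Rintegral => t tI; rewrite /lift /= !restrE//.
by rewrite /gkernel /cpoint /= !clamp_id.
Qed.

Lemma measurable_nonlocal_op w e : (forall f, measurable_fun setT (restr w f)) ->
  measurable_fun setT (restr (nonlocal_op J w) e).
Proof.
move=> mw; have mlw := measurable_lift (e0 := e0) mw.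
have mI : measurable (edge_itv e) by exact: measurable_edge_itv.
pose g (x : T) := \sum_(f : edge G) (\int[mu]_(y in eset f (edge_itv f))
     (K x y * (lift w y - lift w x)))%R.
have mg : measurable_fun setT g.
  apply: measurable_sum => f; apply: (measurable_gen hK) => //.
  by apply: measurable_eset; exact: measurable_edge_itv.
apply: (eq_measurable_fun (fun s => \1_(edge_itv e) s * g (e, s))).
  move=> s _; rewrite /restr patchE indicE; case: ifPn => sI; last by rewrite mul0r.
  by rewrite mul1r (nonlocal_opE mw sI).
apply: measurable_funM; first exact: measurable_indic.
by have /gmeasurable_funP := mg; exact.
Qed.

(** Equality holds where x lies in its edge interval and K(x, .) times the lifted function is
    integrable, hence almost everywhere; this suffices inside L^p norms. *)
Lemma gen_lift_ae (p : R) w : 1 <= p -> (forall f, measurable_fun setT (restr w f)) ->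
  (\int[mu]_x (`|lift w x| `^ p)%:E < +oo)%E ->
  {ae mu, forall x, lift (nonlocal_op J w) x = gen mu K (lift w) x}.
Proof.
move=> p1 mw wp; have mlw := measurable_lift (e0 := e0) mw.
have aeI : {ae mu, forall x : T, x.2 \in edge_itv x.1}.
  have E e : [set s | (~` [set x : T | x.2 \in edge_itv x.1]) (e, s)] = ~` edge_itv e.
    by apply/seteqP; split=> s /= h k; apply: h; [rewrite inE|exact: set_mem].
  have mN : measurable (~` [set x : T | x.2 \in edge_itv x.1]).
    have h e : measurable [set s | (~` [set x : T | x.2 \in edge_itv x.1]) (e, s)].
      by rewrite E; apply: measurableC; exact: measurable_edge_itv.
    exact: h.
  exists (~` [set x : T | x.2 \in edge_itv x.1]); split=> //.
  by rewrite gmeasureE big1// => e _; rewrite E setICl measure0.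
have aeK := kernel_integrable_powR hK p1 mlw wp.
apply: filterS2 aeI aeK => -[e s] /= sI iK.
rewrite {1}/lift /= restrE// nonlocal_opE// /gen Rintegral_edges//.
rewrite (_ : _ \o _ = (fun y => (K (e, s) y * lift w y)%:E - (lift w (e, s))%:E * (K (e, s) y)%:E)%E).
  apply: integrableB => //; apply: integrableZl => //; exact: (integrable_kernel hK).
by apply/funext => y /=; congr EFin; ring.
Qed.

Lemma lift_sub w w' x : lift (fun e s => w e s - w' e s) x = lift w x - lift w' x.
Proof.
have [h|h] := boolP (x.2 \in edge_itv x.1); rewrite /lift.
  by rewrite !restrE.
by rewrite !restr_out// subr0.
Qed.

Lemma lift_scale (a : R) w x : lift (fun e s => a * w e s) x = a * lift w x.
Proof.
have [h|h] := boolP (x.2 \in edge_itv x.1); rewrite /lift.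
  by rewrite !restrE.
by rewrite !restr_out// mulr0.
Qed.

Lemma measurable_restr_lift w : measurable_fun setT (lift w) ->
  forall e, measurable_fun setT (restr w e).
Proof. by move=> /gmeasurable_funP. Qed.

Lemma solution_evolution (p : R) (u0 : gfun G) (u : R -> gfun G) : 1 <= p ->
  solution p J u0 u -> evolution mu K p (fun t => lift (u t)).
Proof.
move=> p1 sol; have p0 : 0 < p by rewrite (lt_le_trans ltr01).
have mr t : 0 <= t -> forall e, measurable_fun setT (restr (u t) e).
  by move=> t0; exact: in_Lp_measurable (solution_Lp sol t0).
have ml t : 0 <= t -> measurable_fun setT (lift (u t)).
  by move=> t0; apply: measurable_lift; exact: mr.
have fin t : 0 <= t -> (\int[mu]_x (`|lift (u t) x| `^ p)%:E < +oo)%E.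
  move=> t0; have := Lp_norm_fin p0 (solution_Lp sol t0).
  by rewrite (Lp_norm_lift e0 p0 (mr t t0)); apply: lty_poweRy; rewrite invr_eq0 gt_eqF.
have int0 (f : T -> R) : (0 <= \int[mu]_x (`|f x| `^ p)%:E)%E.
  by apply: integral_ge0 => x _; rewrite lee_fin powR_ge0.
have ep0 (e : R) : 0 < e -> (0 < (e `^ p^-1)%:E)%E by move=> ?; rewrite lte_fin powR_gt0.
split.
- exact: ml.
- exact: fin.
- move=> t t0 e ee0; have := solution_continuous sol t0.
  move=> /(_ _ (open_ereal_lt' (ep0 e ee0))) /nbhs_ballP[d d0 hd].
  exists d => // s s0 st; apply: (int_le_of_Lp_norm p0 (ltW ee0) (int0 _)).
  have sI : `[0, +oo[%classic s by rewrite /= in_itv/= s0.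
  have := hd s; rewrite -ball_normE /= distrC => /(_ st sI) /ltW.
  have dE : lift (fun e0 x => u s e0 x - u t e0 x) = fun x => lift (u s) x - lift (u t) x.
    by apply/funext => x; exact: lift_sub.
  have md : measurable_fun setT (lift (fun e0 x => u s e0 x - u t e0 x)).
    by rewrite dE; apply: measurable_funB; exact: ml.
  by rewrite (Lp_norm_lift e0 p0 (measurable_restr_lift md)) dE.
- move=> t t0 e ee0; have := solution_equation sol t0.
  move=> /(_ _ (open_ereal_lt' (ep0 e ee0))) /nbhs_ballP[d d0 hd].
  exists d => // h /andP[h0 hlt]; apply: (int_le_of_Lp_norm p0 (ltW ee0) (int0 _)).
  have hn0 : h != 0 by rewrite gt_eqF.
  have := hd h; rewrite -ball_normE /= sub0r normrN gtr0_norm// => /(_ hlt hn0) /ltW.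
  have th0 : 0 <= t + h by rewrite addr_ge0// ltW.
  have mN : measurable_fun setT (lift (nonlocal_op J (u t))).
    by apply: measurable_lift => f; apply: measurable_nonlocal_op; apply: mr; exact: ltW.
  set w := (X in Lp_norm p X).
  have dE : lift w = fun x => h^-1 * (lift (u (t + h)) x - lift (u t) x) - lift (nonlocal_op J (u t)) x.
    by apply/funext => x; rewrite lift_sub lift_scale lift_sub.
  have mD : measurable_fun setT (fun x => h^-1 * (lift (u (t + h)) x - lift (u t) x)).
    by apply: measurable_funM => //; apply: measurable_funB; apply: ml => //; exact: ltW.
  have md : measurable_fun setT (lift w) by rewrite dE; exact: measurable_funB.
  rewrite (Lp_norm_lift e0 p0 (measurable_restr_lift md)) dE.
  have mp (f : T -> R) : measurable_fun setT f ->
      measurable_fun setT (fun x => (`|f x| `^ p)%:E).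
    move=> mf_; apply/measurable_EFinP; apply: (measurableT_comp (measurable_powR p)).
    exact: (measurableT_comp (@normr_measurable _ _) mf_).
  have mg : measurable_fun setT (gen mu K (lift (u t))).
    by apply: (measurable_gen hK) => //; apply: ml; exact: ltW.
  pose f1 x := h^-1 * (lift (u (t + h)) x - lift (u t) x) - lift (nonlocal_op J (u t)) x.
  pose f2 x := h^-1 * (lift (u (t + h)) x - lift (u t) x) - gen mu K (lift (u t)) x.
  have E : (\int[mu]_x (`|f1 x| `^ p)%:E = \int[mu]_x (`|f2 x| `^ p)%:E)%E.
    apply: ae_eq_integral => //; [by apply: mp; apply: measurable_funB..|].
    by apply: filterS (gen_lift_ae p1 (mr t (ltW t0)) (fin t (ltW t0))) => x xE _; rewrite /f1 xE.
  by rewrite E.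
Qed.

Lemma energy_form w : (forall f, measurable_fun setT (restr w f)) ->
  energy J w = form mu K (lift w).
Proof.
move=> mw; have mlw := measurable_lift (e0 := e0) mw.
have mq : measurable_fun setT (fun z : T * T => K z.1 z.2 * (lift w z.1 - lift w z.2) ^+ 2).
  apply: measurable_funM; first exact: (sk_measurable hK).
  apply: measurable_funX; apply: measurable_funB; [exact: measurable_comp1|exact: measurable_comp2].
have q0 x y : 0 <= K x y * (lift w x - lift w y) ^+ 2.
  by rewrite mulr_ge0 ?sqr_ge0// (sk_ge0 hK).
have ET e (A : set R) : A `&` [set s | [set: T] (e, s)] = A.
  by apply/seteqP; split=> s // [].
rewrite /form integral_gmeasure//; last 2 first.
- by apply: measurable_integral_snd => [x y|]; [exact: q0|exact: mq].
- by move=> x; apply: integral_ge0 => y _; rewrite lee_fin.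
apply: eq_bigr => f _; rewrite ET; apply: eq_integral => t tI.
rewrite integral_gmeasure//; last 2 first.
- apply/measurable_EFinP.
  exact: (measurable_section (g := fun x y => K x y * (lift w x - lift w y) ^+ 2) (f, t)).
- by move=> y; rewrite lee_fin.
apply: eq_bigr => e _; rewrite ET; apply: eq_integral => s sI; congr EFin.
pose x0 : T := (f, t); pose y0 : T := (e, s).
have KE : K x0 y0 = J (gdist (e, s) (f, t)).
  by rewrite /gkernel gdist_sym// /cpoint /= !clamp_id.
have [lx ly] : lift w x0 = w f t /\ lift w y0 = w e s by rewrite /lift /= !restrE.
by rewrite -KE -lx -ly -[in LHS]sqrrN opprB.
Qed.

End GraphEvolution.

(** * Norms of the initial datum *)

Section InitialDatum.
Context (R : realType) (G : metric_graph R) (e0 : edge G) (J : R -> R).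
Local Notation mu := (gmeasure (e0 := e0)).
Local Notation lift := (lift (e0 := e0)).
Variables (p : R) (u0 : gfun G) (u : R -> gfun G).
Hypotheses (p1 : 1 <= p) (sol : solution p J u0 u).

Let mu0 e : measurable_fun setT (restr (u 0) e).
Proof. exact: (in_Lp_measurable (solution_Lp sol (lexx 0)) e). Qed.

Lemma initial_integral (q : R) : 0 < q -> in_Lp q u0 ->
  (\int[mu]_x (`|lift (u 0) x| `^ q)%:E = (fine (Lp_norm q u0) `^ q)%:E)%E.
Proof.
move=> q0 hq; have mq := in_Lp_measurable hq.
have E : Lp_norm q u0 = ((\int[mu]_x (`|lift (u 0) x| `^ q)%:E) `^ q^-1)%E.
  rewrite -(Lp_norm_lift e0 q0 mu0); apply/esym; apply: Lp_norm_ae => //.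
  exact: (solution_initial sol).
have := Lp_norm_fin q0 hq; rewrite E => /(lty_poweRy (invr_neq0 (lt0r_neq0 q0))) Iy.
have I0 : (0 <= \int[mu]_x (`|lift (u 0) x| `^ q)%:E)%E.
  by apply: integral_ge0 => x _; rewrite lee_fin powR_ge0.
rewrite fine_poweR -powRrM mulVf ?gt_eqF// powRr1 ?fine_ge0//.
exact: ge0_fineE.
Qed.

Lemma initial_mass : in_Lp 1 u0 ->
  (\int[mu]_x `|lift (u 0) x|%:E = (fine (Lp_norm 1 u0))%:E)%E.
Proof.
move=> h1; have := initial_integral ltr01 h1.
rewrite powRr1 ?fine_ge0 ?Lp_norm_ge0// => <-.
by apply: eq_integral => x _; rewrite powRr1.
Qed.

Lemma Lp_norm_le_of_int (t B : R) : 0 <= t -> 0 <= B ->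
  (\int[mu]_x (`|lift (u t) x| `^ p)%:E <= B%:E)%E -> (Lp_norm p (u t) <= (B `^ p^-1)%:E)%E.
Proof.
move=> t0 B0 h; have p0 : 0 < p by rewrite (lt_le_trans ltr01).
rewrite (Lp_norm_lift e0 p0 (in_Lp_measurable (solution_Lp sol t0))).
have I0 : (0 <= \int[mu]_x (`|lift (u t) x| `^ p)%:E)%E.
  by apply: integral_ge0 => x _; rewrite lee_fin powR_ge0.
have E := ge0_fineE I0 (le_lt_trans h (ltry _)).
move: h; rewrite E poweR_EFin !lee_fin => h.
by rewrite ge0_ler_powR ?nnegrE ?invr_ge0 ?fine_ge0// ltW.
Qed.

End InitialDatum.

Theorem theorem5p2 (R : realType) (G : metric_graph R) (J : R -> R)
    (hG : graph_axioms G) (hJ : kernel_axioms J) :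
  (forall p : R, 1 <= p ->
     exists C : R -> R -> R,
     forall (u0 : gfun G) (u : R -> gfun G),
       in_Lp 1 u0 -> in_Lp p u0 -> solution p J u0 u ->
       forall t : R, 0 < t ->
         (Lp_norm p (u t) <=
            (C (fine (Lp_norm 1 u0)) (fine (Lp_norm p u0))
               / (1 + t) `^ (2^-1 * (1 - p^-1)))%:E)%E)
  /\
  (exists C : R -> R -> R,
     forall (u0 : gfun G) (u : R -> gfun G),
       in_Lp 1 u0 -> in_Lp 2 u0 -> solution 2 J u0 u ->
       forall t : R, 0 < t ->
         (energy J (u t) <=
            (C (fine (Lp_norm 1 u0)) (fine (Lp_norm 2 u0))
               * t `^ (- (3 / 2)))%:E)%E).
Proof.
have [e0 he0] := has_infinite_edge hG.
have hK := symmetric_gkernel e0 hG hJ.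
split=> [p p1|].
  have [C C0 nash] := graph_nash hG hJ he0 p1.
  have p0 : 0 < p by rewrite (lt_le_trans ltr01).
  move: p1; rewrite le_eqVlt => /predU1P[pE|p1].
    (* For p = 1 the exponent is 0 and the claim is the L^1 contraction, with the initial norm as
       constant. *)
    subst p; exists (fun A _ => A) => u0 u h1 _ sol t t0.
    have evol := solution_evolution e0 hG hJ (lexx 1) sol.
    rewrite invr1 subrr mulr0 powRr0 divr1.
    have := @Lp_norm_le_of_int _ _ e0 _ _ _ _ (lexx 1) sol t (fine (Lp_norm 1 u0)) (ltW t0).
    rewrite invr1 powRr1 ?fine_ge0 ?Lp_norm_ge0//; apply=> //.
    rewrite -(initial_mass e0 sol h1).
    have [h0 h00 hM] := small_step hK.
    rewrite (eq_integral (fun x => `|lift (e0 := e0) (u t) x|%:E)).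
      exact: (L1_nonincreasing hK (lexx 1) h00 hM evol (ltW t0)).
    by move=> x _; rewrite powRr1.
  have [K0 K00 hdecay] := Lp_decay hK p1 C0 nash.
  exists (fun A B => (K0 * (A `^ p + B `^ p)) `^ p^-1) => u0 u h1 hp sol t t0.
  set A := fine (Lp_norm 1 u0); set B := fine (Lp_norm p u0).
  have A0 : 0 <= A by rewrite fine_ge0// Lp_norm_ge0.
  have evol := solution_evolution e0 hG hJ (ltW p1) sol.
  have UA : (\int[gmeasure (e0 := e0)]_x `|lift (e0 := e0) (u 0) x|%:E <= A%:E)%E.
    by rewrite (initial_mass e0 sol h1).
  have := hdecay _ A A0 evol UA t (ltW t0).
  rewrite (initial_integral e0 sol p0 hp) -/B /= => h.
  have S0 : 0 <= K0 * (A `^ p + B `^ p) by rewrite mulr_ge0// addr_ge0 ?powR_ge0.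
  have := Lp_norm_le_of_int (ltW p1) sol (ltW t0) _ h; rewrite mulr_ge0 ?powR_ge0// => /(_ isT).
  rewrite powRM ?powR_ge0// -powRrM.
  have -> : - ((p - 1) / 2) * p^-1 = - (2^-1 * (1 - p^-1)).
    by field; rewrite gt_eqF.
  by rewrite powRN.
have [C C0 nash] := graph_nash hG hJ he0 (ler1n _ 2).
have [K0 K00 hdecay] := energy_decay hK C0 nash.
exists (fun A B => K0 * (A `^ 2 + B `^ 2)) => u0 u h1 h2 sol t t0.
have p1 : 1 <= 2 :> R by rewrite ler1n.
have evol := solution_evolution e0 hG hJ p1 sol.
rewrite (energy_form e0 hG hJ (in_Lp_measurable (solution_Lp sol (ltW t0)))).
set A := fine (Lp_norm 1 u0).
have A0 : 0 <= A by rewrite fine_ge0// Lp_norm_ge0.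
have UA : (\int[gmeasure (e0 := e0)]_x `|lift (e0 := e0) (u 0) x|%:E <= A%:E)%E.
  by rewrite (initial_mass e0 sol h1).
have := hdecay _ A A0 evol UA t t0.
by rewrite (initial_integral e0 sol (ltr0n _ 2) h2).
Qed.
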